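(* Let $0<r\le 1$ and $n\in\mathbb N$. Suppose that for every measurable space $\Omega$ we are given a covariant $n$-tensor field $\Theta^n_{\Omega;r}$ on $\mathcal M^r(\Omega)$ (respectively, on $\mathcal P^r(\Omega)$). Then the following are equivalent: (1) $(\Theta^n_{\Omega;r})$ is a congruent family of covariant $n$-tensors of regularity $r$, i.e. $K_r^*\Theta^n_{\Omega';r}=\Theta^n_{\Omega;r}$ for every congruent Markov kernel $K:\Omega\to\mathcal P(\Omega')$ between arbitrary measurable spaces. (2) For every finite set $I$ (with its discrete $\sigma$-algebra), every measurable space $\Omega$ and every congruent Markov kernel $K:I\to\mathcal P(\Omega)$ we have $K_r^*\Theta^n_{\Omega;r}=\Theta^n_{I;r}$. (3) In the case of $\mathcal M^r$: there are uniquely determined continuous functions $a_{\mathbf P}:(0,\infty)\to\mathbb R$, indexed by the partitions $\mathbf P=\{P_1,\dots,P_l\}$ of $\{1,\dots,n\}$ with $|P_i|\le 1/r$ for all $i$, such that for every $\Omega$ and every $\mu_r\in\mathcal M^r(\Omega)$, $$(\Theta^n_{\Omega;r})_{\mu_r}=\sum_{\mathbf P}a_{\mathbf P}\big(\|\pi^{1/r}(\mu_r)\|\big)\,(\tau^{\mathbf P}_{\Omega;r})_{\mu_r};$$ in the case of $\mathcal P^r$: there are uniquely determined constants $c_{\mathbf P}\in\mathbb R$, indexed by the partitions $\mathbf P=\{P_1,\dots,P_l\}$ of $\{1,\dots,n\}$ with $1<|P_i|\le 1/r$ for all $i$, such that $\Theta^n_{\Omega;r}=\sum_{\mathbf P}c_{\mathbf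 P}\,\tau^{\mathbf P}_{\Omega;r}$ on $\mathcal P^r(\Omega)$ for every $\Omega$.
   Context: For a measurable space $(\Omega,\Sigma)$, $\mathcal S(\Omega)$ is the Banach space of finite signed measures (total variation norm), $\mathcal M(\Omega)\subset\mathcal S(\Omega)$ the finite measures and $\mathcal P(\Omega)$ the probability measures; for $\mu\in\mathcal M(\Omega)$, $\|\mu\|=\mu(\Omega)$. For $r\in(0,1]$, $\mathcal S^r(\Omega)$ is the Banach lattice of $r$-th powers of finite signed measures: its elements are formal expressions $\phi\mu^r$ with $\mu\in\mathcal M(\Omega)$, $\phi\in L^{1/r}(\Omega,\mu)$, where $\phi\mu^r=\psi\nu^r$ iff $\phi(d\mu/d\rho)^r=\psi(d\nu/d\rho)^r$ $\rho$-a.e. for a measure $\rho$ dominating $\mu,\nu$; $\mathcal S^1(\Omega)=\mathcal S(\Omega)$ via $\phi\mu^1=\phi\mu$. For $\mu\in\mathcal M(\Omega)$ put $\mathcal S^r(\Omega;\mu)=\{\phi\mu^r:\phi\in L^{1/r}(\Omega,\mu)\}$ and $\mathcal S^r_0(\Omega;\mu)=\{\phi\mu^r:\int\phi\,d\mu=0\}$. $\mathcal M^r(\Omega)=\{\mu^r:\mu\in\mathcal M(\Omega)\}$, $\mathcal P^r(\Omega)=\{\mu^r:\mu\in\mathcal P(\Omega)\}$. The map $\pi^k$ ($0<k\le 1/r$) is $\pi^k(\phi\mu^r)=\mathrm{sign}(\phi)|\phi|^k\mu^{kr}$, so $\pi^{1/r}(\mu^r)=\mu$. Tangent spaces: $T_{\mu^r}\mathcal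 M^r(\Omega)=\mathcal S^r(\Omega;\mu)$, $T_{\mu^r}\mathcal P^r(\Omega)=\mathcal S^r_0(\Omega;\mu)$. A covariant $n$-tensor field $\Psi$ on $\mathcal M^r(\Omega)$ (resp. $\mathcal P^r(\Omega)$) assigns to each point $\mu^r$ an $n$-multilinear form $\Psi_{\mu^r}$ on the tangent space at $\mu^r$ such that $\mu^r\mapsto\Psi_{\mu^r}(X^1_{\mu^r},\dots,X^n_{\mu^r})$ is continuous for all continuous maps $X^j$ into $\mathcal S^r(\Omega)$ with $X^j_{\mu^r}$ in the tangent space at $\mu^r$. Canonical tensors: for an integer $m\ge1$ and $0<r\le 1/m$, $(\tau^m_{\Omega;r})_{\mu^r}(\phi_1\mu^r,\dots,\phi_m\mu^r)=r^{-m}\int_\Omega\phi_1\cdots\phi_m\,d\mu$. For a partition $\mathbf P=\{P_1,\dots,P_l\}$ of $\{1,\dots,n\}$ with $|P_i|\le 1/r$, $(\tau^{\mathbf P}_{\Omega;r})_{\mu^r}(V_1,\dots,V_n)=\prod_{i=1}^l(\tau^{|P_i|}_{\Omega;r})_{\mu^r}\big((V_j)_{j\in P_i}\big)$ (well defined since each $\tau^m$ is symmetric). A Markov kernel $K:\Omega\to\mathcal P(\Omega')$ assigns probability measures $K(\omega)$ with $\omega\mapsto K(\omega)(A')$ measurable for every measurable $A'$; it induces $K_*:\mathcal S(\Omega)\to\mathcal S(\Omega')$, $K_*\mu(A')=\int_\Omega K(\omega)(A')\,d\mu(\omega)$. $K$ is congruent if there is a measurable $\kappa:\Omega'\to\Omega$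 with $\kappa_*K(\omega)=\delta_\omega$ for all $\omega$. Put $K_r:=\pi^rK_*\pi^{1/r}$, so $K_r(\mu^r)=(K_*\mu)^r$. Its formal derivative at $\mu^r$, with $\mu'=K_*\mu$, is $d_{\mu^r}K_r:\mathcal S^r(\Omega;\mu)\to\mathcal S^r(\Omega';\mu')$, $d_{\mu^r}K_r(\phi\mu^r)=\frac{d\{K_*(\phi\mu)\}}{d\mu'}\,{\mu'}^r$. For a tensor field $\Psi$ on $\mathcal M^r(\Omega')$ (or $\mathcal P^r(\Omega')$), $(K_r^*\Psi)_{\mu^r}(V_1,\dots,V_n):=\Psi_{K_r(\mu^r)}(d_{\mu^r}K_rV_1,\dots,d_{\mu^r}K_rV_n)$. *)

(* Defs.v *)
From HB Require Import structures.
From mathcomp Require Import all_boot all_order all_algebra.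
From mathcomp Require Import all_classical all_reals all_analysis.
Set Implicit Arguments.
Unset Strict Implicit.
Unset Printing Implicit Defensive.
Import Order.TTheory GRing.Theory Num.Theory.
Import numFieldNormedType.Exports.
Local Open Scope classical_set_scope.
Local Open Scope ring_scope.

Section Defs.
Variable R : realType.

Definition Lr (r : R) d (T : measurableType d) (mu : {measure set T -> \bar R})
  (phi : T -> R) : Prop :=
  measurable_fun [set: T] phi /\
  (\int[mu]_x ((`|phi x| `^ r^-1)%:E) < +oo)%E.

Definition is_density d (T : measurableType d) (rho : {measure set T -> \bar R})
  (f : T -> R) (mu : set T -> \bar R) : Prop :=
  measurable_fun [set: T] f /\ (forall x, 0 <= f x) /\
  forall A, measurable A -> mu A = (\int[rho]_(x in A) (f x)%:E)%E.

Definition is_signed_density d (T : measurableType d)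
  (mu' : {measure set T -> \bar R}) (psi : T -> R) (nu : set T -> \bar R) : Prop :=
  measurable_fun [set: T] psi /\ mu'.-integrable [set: T] (EFin \o psi) /\
  forall A, measurable A -> (\int[mu']_(x in A) (psi x)%:E)%E = nu A.

(* || phi mu^r - psi nu^r ||_{S^r(Omega)} < eps, computed with any dominating
   finite measure rho (the value does not depend on the choice of rho) *)
Definition Sr_close (r : R) d (T : measurableType d)
  (mu : {measure set T -> \bar R}) (phi : T -> R)
  (nu : {measure set T -> \bar R}) (psi : T -> R) (eps : R) : Prop :=
  exists (rho : {finite_measure set T -> \bar R}) (f g : T -> R),
    is_density rho f mu /\ is_density rho g nu /\
    (\int[rho]_x ((`| phi x * f x `^ r - psi x * g x `^ r| `^ r^-1)%:E)
       < (eps `^ r^-1)%:E)%E.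

Definition Mr_close (r : R) d (T : measurableType d)
  (mu nu : {measure set T -> \bar R}) (eps : R) : Prop :=
  Sr_close r mu (fun _ => 1) nu (fun _ => 1) eps.

(* A covariant n-tensor field on a set of points Pt (M^r or P^r of T), the
   point p being identified with the measure pt p (p = (pt p)^r), and the
   tangent space at p being { phi (pt p)^r : tang p phi }. *)
Definition is_tensor_field (r : R) d (T : measurableType d) (n : nat)
  (Pt : Type) (pt : Pt -> {measure set T -> \bar R})
  (tang : Pt -> (T -> R) -> Prop)
  (Theta : Pt -> ('I_n -> T -> R) -> R) : Prop :=
  [/\ (* well defined on S^r(Omega;mu): phi mu^r only depends on phi mu-a.e. *)
      (forall p (phi phi' : 'I_n -> T -> R),
         (forall j, tang p (phi j)) -> (forall j, tang p (phi' j)) ->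
         (forall j, {ae pt p, forall x, phi j x = phi' j x}) ->
         Theta p phi = Theta p phi'),
      (forall p (phi : 'I_n -> T -> R) (j : 'I_n) (c : R) (psi : T -> R),
         (forall i, tang p (phi i)) -> tang p psi ->
         Theta p (fun i => if i == j then (fun x => c * phi i x + psi x)
                           else phi i)
         = c * Theta p phi + Theta p (fun i => if i == j then psi else phi i))
    &
      (forall X : 'I_n -> Pt -> T -> R,
         (forall j p, tang p (X j p)) ->
         (forall j p0 eps, 0 < eps -> exists2 delta, 0 < delta &
            forall p, Mr_close r (pt p0) (pt p) delta ->
              Sr_close r (pt p0) (X j p0) (pt p) (X j p) eps) ->
         forall p0 eps, 0 < eps -> exists2 delta, 0 < delta &
            forall p, Mr_close r (pt p0) (pt p) delta ->
              `| Theta p (fun j => X j p) - Theta p0 (fun j => X j p0) | < eps)].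

Definition tangM (r : R) d (T : measurableType d)
  (mu : {finite_measure set T -> \bar R}) (phi : T -> R) : Prop := Lr r mu phi.

Definition tangP (r : R) d (T : measurableType d)
  (mu : probability T R) (phi : T -> R) : Prop :=
  Lr r mu phi /\ (\int[mu]_x (phi x)%:E = 0)%E.

Definition fmeas d (T : measurableType d) (mu : {finite_measure set T -> \bar R})
  : {measure set T -> \bar R} := mu.
Definition pmeas d (T : measurableType d) (mu : probability T R)
  : {measure set T -> \bar R} := mu.

Definition MFamily (n : nat) :=
  forall d (T : measurableType d),
    {finite_measure set T -> \bar R} -> ('I_n -> T -> R) -> R.
Definition PFamily (n : nat) :=
  forall d (T : measurableType d), probability T R -> ('I_n -> T -> R) -> R.

Definition is_M_tensor_family (r : R) (n : nat) (Theta : MFamily n) : Prop :=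
  forall d (T : measurableType d),
    is_tensor_field r (@fmeas d T) (@tangM r d T) (Theta d T).
Definition is_P_tensor_family (r : R) (n : nat) (Theta : PFamily n) : Prop :=
  forall d (T : measurableType d),
    is_tensor_field r (@pmeas d T) (@tangP r d T) (Theta d T).

Definition congruent d d' (T : measurableType d) (T' : measurableType d')
  (K : R.-pker T ~> T') : Prop :=
  exists kappa : T' -> T, measurable_fun [set: T'] kappa /\
    forall (w : T) (A : set T), measurable A ->
      K w (kappa @^-1` A) = \d_w A.

Definition push_dens d d' (T : measurableType d) (T' : measurableType d')
  (K : R.-pker T ~> T') (mu : {measure set T -> \bar R}) (phi : T -> R)
  : set T' -> \bar R :=
  fun A => (\int[mu]_x (K x A * (phi x)%:E))%E.

Definition pullback_eqM (r : R) (n : nat) d d' (T : measurableType d)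
  (T' : measurableType d') (K : R.-pker T ~> T')
  (Theta' : {finite_measure set T' -> \bar R} -> ('I_n -> T' -> R) -> R)
  (Theta : {finite_measure set T -> \bar R} -> ('I_n -> T -> R) -> R) : Prop :=
  forall (mu : {finite_measure set T -> \bar R})
         (mu' : {finite_measure set T' -> \bar R}),
    (forall A, measurable A -> mu' A = push_dens K mu (fun _ => 1) A) ->
    forall (phi : 'I_n -> T -> R) (psi : 'I_n -> T' -> R),
      (forall j, tangM r mu (phi j)) ->
      (forall j, is_signed_density mu' (psi j) (push_dens K mu (phi j))) ->
      Theta' mu' psi = Theta mu phi.

Definition pullback_eqP (r : R) (n : nat) d d' (T : measurableType d)
  (T' : measurableType d') (K : R.-pker T ~> T')
  (Theta' : probability T' R -> ('I_n -> T' -> R) -> R)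
  (Theta : probability T R -> ('I_n -> T -> R) -> R) : Prop :=
  forall (mu : probability T R) (mu' : probability T' R),
    (forall A, measurable A -> mu' A = push_dens K mu (fun _ => 1) A) ->
    forall (phi : 'I_n -> T -> R) (psi : 'I_n -> T' -> R),
      (forall j, tangP r mu (phi j)) ->
      (forall j, is_signed_density mu' (psi j) (push_dens K mu (phi j))) ->
      Theta' mu' psi = Theta mu phi.

Definition finite_discrete d (I : measurableType d) : Prop :=
  finite_set [set: I] /\ forall A : set I, measurable A.

Definition admissibleM (r : R) (n : nat) (P : {set {set 'I_n}}) : bool :=
  finset.partition P [set: 'I_n] && [forall B in P, (#|B|%:R <= r^-1 :> R)].
Definition admissibleP (r : R) (n : nat) (P : {set {set 'I_n}}) : bool :=
  finset.partition P [set: 'I_n] && [forall B in P, (1 < #|B|)%N && (#|B|%:R <= r^-1 :> R)].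

Definition tau_m (r : R) d (T : measurableType d) (mu : {measure set T -> \bar R})
  (m : nat) (phi : 'I_m -> T -> R) : R :=
  r^-1 ^+ m * fine (\int[mu]_x (\prod_(j < m) phi j x)%:E).

Definition tauP (r : R) d (T : measurableType d) (mu : {measure set T -> \bar R})
  (n : nat) (P : {set {set 'I_n}}) (phi : 'I_n -> T -> R) : R :=
  \prod_(B in P) (r^-1 ^+ #|B| * fine (\int[mu]_x (\prod_(j in B) phi j x)%:E)).

(* the representation formula of (3) in the M^r case; a P only matters on (0,oo) *)
Definition formulaM (r : R) (n : nat) (Theta : MFamily n)
  (a : {set {set 'I_n}} -> R -> R) : Prop :=
  forall d (T : measurableType d) (mu : {finite_measure set T -> \bar R}),
    (0 < mu [set: T])%E ->
    forall phi : 'I_n -> T -> R, (forall j, tangM r mu (phi j)) ->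
      Theta d T mu phi =
      \sum_(P : {set {set 'I_n}} | admissibleM r P)
         a P (fine (mu [set: T])) * tauP r mu P phi.

Definition formulaP (r : R) (n : nat) (Theta : PFamily n)
  (c : {set {set 'I_n}} -> R) : Prop :=
  forall d (T : measurableType d) (mu : probability T R),
    forall phi : 'I_n -> T -> R, (forall j, tangP r mu (phi j)) ->
      Theta d T mu phi =
      \sum_(P : {set {set 'I_n}} | admissibleP r P) c P * tauP r mu P phi.

End Defs.

(* Main.v *)
Require Import Defs.
From HB Require Import structures.
From mathcomp Require Import all_boot all_order all_algebra.
From mathcomp Require Import all_classical all_reals all_analysis.
From mathcomp Require Import measurable_realfun zify ring lra.
Set Implicit Arguments.
Unset Strict Implicit.
Unset Printing Implicit Defensive.
Import Order.TTheory GRing.Theory Num.Theory.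
Import numFieldNormedType.Exports.
Local Open Scope classical_set_scope.
Local Open Scope ring_scope.

(** A congruent family is first read off on finite spaces.  Congruence under
   arbitrary maps between finite spaces makes the value at a uniform
   distribution, on tuples of indicators of points, depend only on the
   partition of the slots according to equality of the points; inverting the
   triangular system given by refinement of partitions yields coefficients
   independent of the space, and rational, then real weights follow by
   congruence and continuity.  Hence the formula holds for simple functions,
   with all partitions.  A block of size [m > 1/r] is excluded by continuity
   along the field [q^-s u], where [q] is the mass of a shrinking set carrying
   [u] and [1/m < s < r]: it tends to 0 in S^r although [q^(1 - s m)] does not.
   A general tangent vector is reached through a continuous field that takes
   simple values at all points with measure different from the given one.
   Conversely, for a congruent kernel the derivative of [K_r] is composition
   with kappa, which preserves all moments.  The probability case is handled
   along with the other one by subtracting means. *)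

(** * Finite spaces *)

(** A tensor field is known to be continuous only along vector fields that are defined and
    continuous at every point, so each passage to the limit needs a field on the whole space of
    measures. For a general tangent vector the obstacle is that [phi] in L^(1/r)(mu) need not lie in
    L^(1/r)(nu) for [nu] near [mu]. Hence the field truncates [phi] at a level that depends on the
    total variation distance to [mu] and tends to infinity at [mu], slowly enough for the truncated
    vectors to converge in S^r. The topology of [M^r] is that of total variation, so closeness is
    handled through L1 distances of densities. Congruent kernels preserve the total mass. The
    coefficients are therefore found one mass at a time, and their continuity in the mass is proved
    afterwards from the same triangular system. In [P^r] the functions that detect the coefficients
    must have mean 0 while their higher power sums must not vanish; this rules out indicators and
    two opposite values, and leads to the values 2, -1, -1. *)

Section Multilinear.
Variables (R : realType) (n : nat).

Definition setslot (T : Type) (f : 'I_n -> T) (j : 'I_n) (g : T) : 'I_n -> T :=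
  fun i => if i == j then g else f i.

Definition multilinear (T : Type) (F : ('I_n -> T -> R) -> R) : Prop :=
  forall f j c g, F (setslot f j (fun x => c * f j x + g x))
                = c * F f + F (setslot f j g).

Variables (T : Type) (F : ('I_n -> T -> R) -> R).
Hypothesis linF : multilinear F.

Lemma setslot_id (f : 'I_n -> T -> R) j : setslot f j (f j) = f.
Proof. by apply/funext => i; rewrite /setslot; case: eqP => [->|]. Qed.

Lemma setslot_set (f : 'I_n -> T -> R) j g h :
  setslot (setslot f j g) j h = setslot f j h.
Proof. by apply/funext => i; rewrite /setslot; case: eqP. Qed.

Lemma setslot_eq (f : 'I_n -> T -> R) j g : setslot f j g j = g.
Proof. by rewrite /setslot eqxx. Qed.

Lemma multilinear0 f j : F (setslot f j (fun=> 0)) = 0.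
Proof.
have := linF (setslot f j (fun=> 0)) j 1 (fun=> 0).
rewrite setslot_set setslot_eq.
under [X in setslot _ _ X]eq_fun do rewrite mulr0 addr0.
by move/eqP; rewrite mul1r -subr_eq0 opprD addNKr oppr_eq0 => /eqP; rewrite setslot_set.
Qed.

Lemma multilinearZ f j c : F (setslot f j (fun x => c * f j x)) = c * F f.
Proof.
have := linF f j c (fun=> 0); rewrite multilinear0 addr0 => <-.
by congr (F (setslot _ _ _)); apply/funext => x; rewrite addr0.
Qed.

Lemma multilinearD f j g h :
  F (setslot f j (fun x => g x + h x)) = F (setslot f j g) + F (setslot f j h).
Proof.
have := linF (setslot f j g) j 1 h.
rewrite !setslot_set !setslot_eq mul1r => <-.
by congr (F (setslot _ _ _)); apply/funext => x; rewrite mul1r.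
Qed.

Lemma multilinear_sum f j (J : Type) (s : seq J) (g : J -> T -> R) :
  F (setslot f j (fun x => \sum_(y <- s) g y x)) = \sum_(y <- s) F (setslot f j (g y)).
Proof.
elim: s => [|y s IH].
  rewrite big_nil -[RHS](multilinear0 f j).
  by congr (F (setslot _ _ _)); apply/funext => x; rewrite big_nil.
rewrite big_cons -IH -multilinearD.
by congr (F (setslot _ _ _)); apply/funext => x; rewrite big_cons.
Qed.

Lemma multilinear_scale f (s : 'I_n -> R) :
  F (fun j x => s j * f j x) = (\prod_j s j) * F f.
Proof.
suff H : forall t : seq 'I_n, uniq t ->
    F (fun j x => (if j \in t then s j else 1) * f j x) = (\prod_(j <- t) s j) * F f.
  have := H (index_enum 'I_n) (index_enum_uniq _).
  under [X in F X]eq_fun do rewrite mem_index_enum.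
  by [].
elim=> [_|j t IH /= /andP[jt ut]].
  rewrite big_nil mul1r; congr F; apply/funext => j; apply/funext => x.
  by rewrite in_nil mul1r.
rewrite big_cons -mulrA -IH // -(multilinearZ _ j).
congr F; apply/funext => i; rewrite /setslot inE.
by case: eqP => [->|_] //=; rewrite (negbTE jt); under [RHS]eq_fun do rewrite mul1r.
Qed.

End Multilinear.

Section Basis.
Variables (R : realType) (n : nat) (I : finType).
Variable F : ('I_n -> I -> R) -> R.
Hypothesis linF : multilinear F.

Definition ebasis (y : I) : I -> R := fun x => (x == y)%:R.

Lemma multilinear_ebasis_eq0 :
  (forall i : 'I_n -> I, F (fun j => ebasis (i j)) = 0) -> forall f, F f = 0.
Proof.
move=> F0 f.
(* All slots from [k] on already hold basis vectors; expanding slot [k] in the basis leads from [k]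
   to [k.+1]. *)
suff H : forall k, (k <= n)%N -> forall f : 'I_n -> I -> R,
    (forall j : 'I_n, (k <= j)%N -> exists y, f j = ebasis y) -> F f = 0.
  by apply: (H n) => // j; rewrite leqNgt ltn_ord.
elim=> [_ g gb|k IH kn g gb].
  have [i ih] := choice (fun j => gb j (leq0n j)).
  by rewrite (_ : g = fun j => ebasis (i j)) ?F0 //; apply/funext => j.
pose j0 := Ordinal kn.
have -> : g = setslot g j0 (fun x => \sum_(y <- index_enum I) g j0 y * ebasis y x).
  rewrite -[LHS](setslot_id g j0); congr setslot; apply/funext => x.
  rewrite (bigD1_seq x) ?mem_index_enum ?index_enum_uniq //= /ebasis eqxx mulr1.
  by rewrite big1 ?addr0 // => y /negbTE; rewrite eq_sym => ->; rewrite mulr0.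
rewrite multilinear_sum // big1 // => y _.
rewrite (_ : setslot _ _ _ = setslot (setslot g j0 (ebasis y)) j0
  (fun x => g j0 y * setslot g j0 (ebasis y) j0 x)); last first.
  by rewrite setslot_set setslot_eq.
rewrite multilinearZ // IH ?mulr0 //; first exact: ltnW.
move=> j kj; rewrite /setslot; case: eqP => [_|/eqP jj0]; first by exists y.
apply: gb; rewrite ltn_neqAle kj andbT; apply: contra jj0 => /eqP kj0.
by apply/eqP/val_inj.
Qed.

End Basis.

(** * Partitions of the slots, ordered by refinement *)

Section Partitions.
Variable n : nat.
Local Notation pblock := finset.pblock.
Implicit Types P Q : {set {set 'I_n}}.
Definition ispart P := finset.partition P [set: 'I_n].

Definition refines Q P := [forall C in Q, exists B in P, C \subset B].

Lemma ispart_pblock P j : ispart P -> j \in pblock P j.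
Proof. by move=> /finset.cover_partition cP; rewrite finset.mem_pblock cP inE. Qed.

Lemma ispart_pblock_mem P j : ispart P -> pblock P j \in P.
Proof. by move=> /finset.cover_partition cP; apply: finset.pblock_mem; rewrite cP inE. Qed.

Lemma ispart_def_pblock P B j : ispart P -> B \in P -> j \in B -> pblock P j = B.
Proof. by move=> /finset.partition_trivIset; exact: finset.def_pblock. Qed.

Lemma ispart_nonempty P B : ispart P -> B \in P -> exists j, j \in B.
Proof. by move=> pP BP; apply/finset.set0Pn; exact: finset.partition_neq0 pP BP. Qed.

Definition coarse P (C : {set 'I_n}) : {set 'I_n} :=
  odflt finset.set0 [pick B in P | C \subset B].

Lemma coarseE P (C B : {set 'I_n}) j : ispart P -> j \in C -> B \in P -> C \subset B ->
  coarse P C = B.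
Proof.
move=> pP jC BP CB; rewrite /coarse; case: pickP => [B' /andP[B'P CB']|/(_ B)]; last first.
  by rewrite BP CB.
by rewrite /= -(ispart_def_pblock pP BP (fintype.subsetP CB _ jC))
  (ispart_def_pblock pP B'P (fintype.subsetP CB' _ jC)).
Qed.

Lemma refines_pblock Q P : ispart P -> ispart Q -> refines Q P =
  [forall C in Q, forall j in C, forall k in C, pblock P j == pblock P k].
Proof.
move=> pP pQ; apply/idP/idP => /forall_inP H; apply/forall_inP => C CQ.
  have /exists_inP[B BP /fintype.subsetP CB] := H C CQ.
  apply/forall_inP => j jC; apply/forall_inP => k kC.
  by rewrite !(ispart_def_pblock pP BP) ?CB.
have [j jC] := ispart_nonempty pQ CQ.
apply/exists_inP; exists (pblock P j); first exact: ispart_pblock_mem.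
apply/fintype.subsetP => k kC; have /forall_inP/(_ j jC)/forall_inP/(_ k kC)/eqP-> := H C CQ.
exact: ispart_pblock.
Qed.

(** Sending a block of [Q] to the block of [P] around it maps [Q] onto [P]: a block of [P] contains
    a slot, and the [Q]-block of this slot lies inside it. *)
Lemma refines_card Q P : ispart P -> ispart Q -> refines Q P -> (#|P| <= #|Q|)%N.
Proof.
move=> pP pQ /forall_inP rQP.
have PQ : P \subset coarse P @: Q.
  apply/fintype.subsetP => B BP; have [j jB] := ispart_nonempty pP BP.
  apply/imsetP; exists (pblock Q j); first exact: ispart_pblock_mem.
  have /exists_inP[B' B'P CB'] := rQP _ (ispart_pblock_mem j pQ).
  have -> : B = B'.
    by rewrite -(ispart_def_pblock pP BP jB) (ispart_def_pblock pP B'P) // (fintype.subsetP CB') // ispart_pblock.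
  by rewrite (coarseE pP (ispart_pblock j pQ) B'P CB').
exact: leq_trans (subset_leq_card PQ) (leq_imset_card _ _).
Qed.

(** With equally many blocks the surjection from the blocks of [Q] to those of [P] is injective. Two
    slots in one block of [P] have [Q]-blocks with the same image, hence the same [Q]-block. *)
Lemma refines_eq Q P : ispart P -> ispart Q -> refines Q P -> (#|Q| <= #|P|)%N -> Q = P.
Proof.
move=> pP pQ rQP QP.
have bl j : coarse P (pblock Q j) = pblock P j.
  have /forall_inP/(_ _ (ispart_pblock_mem j pQ))/exists_inP[B BP CB] := rQP.
  rewrite (coarseE pP (ispart_pblock j pQ) BP CB).
  by rewrite (ispart_def_pblock pP BP) // (fintype.subsetP CB) // ispart_pblock.
have mQ : coarse P @: Q = P.
  apply/setP => B; apply/imsetP/idP => [[C CQ ->]|BP].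
    have [j jC] := ispart_nonempty pQ CQ.
    by rewrite -(ispart_def_pblock pQ CQ jC) bl ispart_pblock_mem.
  have [j jB] := ispart_nonempty pP BP.
  by exists (pblock Q j); rewrite ?ispart_pblock_mem // bl (ispart_def_pblock pP BP).
have injm : {in Q &, injective (coarse P)}.
  by apply/imset_injP; rewrite mQ eqn_leq QP andbT refines_card.
have pbl j : pblock Q j = pblock P j.
  apply/setP => k; apply/idP/idP => H.
    rewrite -bl -(ispart_def_pblock pQ (ispart_pblock_mem j pQ) H) bl.
    exact: ispart_pblock.
  have : pblock Q k = pblock Q j.
    apply: injm; rewrite ?ispart_pblock_mem // !bl.
    by rewrite (ispart_def_pblock pP (ispart_pblock_mem j pP) H).
  by move=> <-; exact: ispart_pblock.
apply/setP => B; apply/idP/idP => BP.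
  have [j jB] := ispart_nonempty pQ BP.
  by rewrite -(ispart_def_pblock pQ BP jB) pbl ispart_pblock_mem.
have [j jB] := ispart_nonempty pP BP.
by rewrite -(ispart_def_pblock pP BP jB) -pbl ispart_pblock_mem.
Qed.

Lemma ispart_card_le P : ispart P -> (#|P| <= n)%N.
Proof.
move=> pP; have := card_partition pP; rewrite cardsT card_ord => nE.
rewrite [X in (_ <= X)%N]nE -sum1_card; apply: leq_sum => B BP; rewrite card_gt0.
exact: finset.partition_neq0 pP BP.
Qed.

Variable I : finType.
(** The pattern of coincidences in the tuple [i]: its nonempty fibres. *)
Definition kerpart (i : 'I_n -> I) := preim_partition i [set: 'I_n].

Lemma kerpartP i : ispart (kerpart i).
Proof. exact: preim_partitionP. Qed.

Lemma pblock_kerpart i j k : (k \in pblock (kerpart i) j) = (i j == i k).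
Proof.
rewrite pblock_equivalence_partition ?inE //.
by split => // /eqP->.
Qed.

Lemma kerpart_pblockE i j : pblock (kerpart i) j = [set k | i j == i k]%SET.
Proof. by apply/setP => k; rewrite inE pblock_kerpart. Qed.

Lemma refines_kerpart Q i : ispart Q -> refines Q (kerpart i) =
  [forall C in Q, forall j in C, forall k in C, i j == i k].
Proof.
move=> pQ; rewrite refines_pblock ?kerpartP //.
apply: eq_forallb => C; congr (_ ==> _); apply: eq_forallb => j; congr (_ ==> _).
apply: eq_forallb => k; congr (_ ==> _); rewrite !kerpart_pblockE.
apply/eqP/eqP => [/setP/(_ k)|->] //; by rewrite !inE eqxx => /eqP.
Qed.

End Partitions.

(** * Moment tensors of a finite weighted set *)

Section Moments.
Variables (R : realType) (n : nat).
Implicit Types (P Q : {set {set 'I_n}}).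
Local Notation pblock := finset.pblock.

(** The tensor tau^P on a finite set with weights [p], without its power of 1/r. *)
Definition smom (I : finType) (p : I -> R) P (f : 'I_n -> I -> R) : R :=
  \prod_(B in P) \sum_x p x * \prod_(j in B) f j x.

Definition smomsum (a : {set {set 'I_n}} -> R) (I : finType) (p : I -> R)
  (f : 'I_n -> I -> R) : R := \sum_(P | ispart P) a P * smom p P f.

Definition push (I J : finType) (kappa : I -> J) (p : I -> R) (y : J) : R :=
  \sum_(x | kappa x == y) p x.

Lemma sum_push (I J : finType) (kappa : I -> J) (p : I -> R) (g : J -> R) :
  \sum_y push kappa p y * g y = \sum_x p x * g (kappa x).
Proof.
rewrite [RHS](partition_big kappa predT) //=; apply: eq_bigr => y _.
by rewrite /push big_distrl /=; apply: eq_bigr => x /eqP ->.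
Qed.

Lemma smom_push (I J : finType) (kappa : I -> J) (p : I -> R) P f :
  smom p P (fun j x => f j (kappa x)) = smom (push kappa p) P f.
Proof. by apply: eq_bigr => B _; rewrite (sum_push kappa p (fun y => \prod_(j in B) f j y)). Qed.

(** Slot [j] belongs to exactly one block of [P], so it enters exactly one factor of the product,
    and linearly. *)
Lemma smom_multilinear (I : finType) (p : I -> R) P :
  ispart P -> multilinear (smom p P).
Proof.
move=> pP f j c g.
have jB := ispart_pblock j pP; have BP := ispart_pblock_mem j pP.
have nj C : (C \in P) && (C != pblock P j) -> forall k, k \in C -> (k == j) = false.
  move=> /andP[CP CB] k kC; apply/eqP => kj; move/eqP: CB; apply.
  by rewrite -(ispart_def_pblock pP CP kC) kj.
have D h : smom p P h = (\sum_x p x * \prod_(k in pblock P j) h k x) *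
    \prod_(C in P | C != pblock P j) \sum_x p x * \prod_(k in C) h k x.
  by rewrite /smom (bigD1 (pblock P j)).
rewrite !{}D.
have E h : \prod_(C in P | C != pblock P j) \sum_x p x * \prod_(k in C) setslot f j h k x
    = \prod_(C in P | C != pblock P j) \sum_x p x * \prod_(k in C) f k x.
  apply: eq_bigr => C /nj CN; apply: eq_bigr => x _; congr (_ * _).
  by apply: eq_bigr => k /CN; rewrite /setslot => ->.
rewrite !{}E mulrA -mulrDl; congr (_ * _).
have E h : \sum_x p x * \prod_(k in pblock P j) setslot f j h k x =
   \sum_x p x * (h x * \prod_(k in pblock P j | k != j) f k x).
  apply: eq_bigr => x _; congr (_ * _); rewrite (bigD1 j) //=.
  rewrite /setslot eqxx; congr (_ * _).
  by apply: eq_bigr => k /andP[_ /negbTE ->].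
rewrite !E mulr_sumr -big_split; apply: eq_bigr => x _ /=.
by rewrite [\prod_(k in pblock P j) f k x](bigD1 j) //=; ring.
Qed.

Lemma smomsum_multilinear a (I : finType) (p : I -> R) : multilinear (smomsum a p).
Proof.
move=> f j c g; rewrite /smomsum mulr_sumr -big_split; apply: eq_bigr => P pP /=.
by rewrite smom_multilinear //; ring.
Qed.

Lemma smomsum_push a (I J : finType) (kappa : I -> J) (p : I -> R) f :
  smomsum a p (fun j x => f j (kappa x)) = smomsum a (push kappa p) f.
Proof. by apply: eq_bigr => P _; rewrite smom_push. Qed.

Lemma sum_prod_ebasis (I : finType) (p : I -> R) (i : 'I_n -> I) (C : {set 'I_n}) j :
  j \in C -> \sum_x p x * \prod_(k in C) ebasis R (i k) x =
  [forall j in C, forall k in C, i j == i k]%:R * p (i j).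
Proof.
move=> jC; rewrite (bigD1 (i j)) //= [X in _ + X]big1 ?addr0; last first.
  by move=> x /negbTE xj; rewrite (bigD1 j) //= /ebasis xj mul0r mulr0.
rewrite mulrC; congr (_ * _).
case: (boolP [forall j in C, forall k in C, i j == i k]) => /= [/forall_inP H|].
  have /forall_inP Hj := H j jC.
  by rewrite big1 // => k /Hj; rewrite /ebasis => ->.
move=> /forall_inPn [k kC] /forall_inPn [l lC kl].
have [kj|kj] := eqVneq (i j) (i k).
  by rewrite (bigD1 l) //= /ebasis kj (negbTE kl) mul0r.
by rewrite (bigD1 k) //= /ebasis (negbTE kj) mul0r.
Qed.

(** A product of indicators of points over a block is 0 unless the points agree on it. For uniform
    weights the matrix indexed by [Q] and the pattern of [i] is thus triangular for refinement, with
    diagonal entries [w ^+ #|Q|]. *)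
Lemma smom_cst_ebasis (I : finType) (w : R) (i : 'I_n -> I) Q : ispart Q ->
  smom (fun=> w) Q (fun j => ebasis R (i j)) = (refines Q (kerpart i))%:R * w ^+ #|Q|.
Proof.
move=> pQ; rewrite refines_kerpart // /smom.
under eq_bigr => C CQ.
  have [j jC] := cid (ispart_nonempty pQ CQ).
  rewrite (sum_prod_ebasis _ _ jC); over.
rewrite big_split /= prodr_const; congr (_ * _).
case: (boolP [forall C in Q, _]) => [/forall_inP H|/forall_inPn [C CQ /negbTE nC]].
  by rewrite big1 // => C /H ->.
by rewrite (bigD1 C) //= nC mul0r.
Qed.

(* Three atoms per block leave room for a vector with zero mean; [None] absorbs
   the remaining mass. *)
Definition testspace : finType := option ({set 'I_n} * 'I_3)%type.

(** Slot [j] carries a copy of [u] on the three atoms labelled by its block, so slots of different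
    blocks have disjoint supports. The labels are all sets of slots, so one space serves every
    partition. *)
Definition testfun P (u : 'I_3 -> R) (j : 'I_n) (z : testspace) : R :=
  if z is Some Bk then (Bk.1 == pblock P j)%:R * u Bk.2 else 0.

Lemma big_option (T : finType) (F : option T -> R) :
  \sum_x F x = F None + \sum_x F (Some x).
Proof.
rewrite (bigD1 None) //=; congr (_ + _).
rewrite [LHS](reindex_omap Some id) /=; last by case.
by apply: eq_bigl => x; rewrite eqxx.
Qed.

Lemma sum_testfun P u (p : testspace -> R) (w : {set 'I_n} -> R) (C : {set 'I_n}) j :
  ispart P -> j \in C -> (forall B k, p (Some (B, k)) = w B) ->
  \sum_x p x * \prod_(l in C) testfun P u l x =
  [exists B in P, C \subset B]%:R * (w (coarse P C) * \sum_k u k ^+ #|C|).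
Proof.
move=> pP jC pw; rewrite big_option.
rewrite [X in X + _](_ : _ = 0) ?add0r; last first.
  by rewrite (bigD1 j) //= mul0r mulr0.
pose B := pblock P j.
transitivity (\sum_B' \sum_k p (Some (B', k)) * \prod_(l in C) testfun P u l (Some (B', k))).
  by rewrite pair_bigA; apply: eq_bigr => -[].
rewrite (bigD1 B) //= [X in _ + X]big1 ?addr0; last first.
  move=> B' /negbTE B'B; apply: big1 => k _; rewrite (bigD1 j) //=.
  by rewrite B'B !mul0r mulr0.
have -> : \sum_(i < 3) p (Some (B, i)) * \prod_(l in C) testfun P u l (Some (B, i))
   = \sum_(i < 3) w B * ((C \subset B)%:R * u i ^+ #|C|).
  apply: eq_bigr => i _; rewrite pw; congr (_ * _) => /=.
  rewrite big_split /= prodr_const; congr (_ * _).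
  case: (boolP (C \subset B)) => [/fintype.subsetP CB|/fintype.subsetPn [k kC kB]].
    by rewrite big1 // => k /CB kB; rewrite (ispart_def_pblock pP _ kB) ?eqxx // ispart_pblock_mem.
  rewrite (bigD1 k) //=; case: eqP => [E|_]; rewrite ?mul0r //.
  by move: kB; rewrite E ispart_pblock.
have -> : [exists B in P, C \subset B] = (C \subset B).
  apply/exists_inP/idP => [[B' B'P CB']|CB].
    by rewrite /B (ispart_def_pblock pP B'P) // (fintype.subsetP CB').
  by exists B => //; exact: ispart_pblock_mem.
case: (boolP (C \subset B)) => CB; last by rewrite mul0r big1 // => i _; rewrite mul0r mulr0.
rewrite mul1r (coarseE pP jC _ CB) ?ispart_pblock_mem // mulr_sumr.
by apply: eq_bigr => k _; rewrite mul1r.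
Qed.

(** The triangular pattern found for indicators, now with functions that have mean 0 when [u] sums
    to 0; the price is the power sums of [u] on the diagonal. *)
Lemma smom_testfun P u (p : testspace -> R) (w : {set 'I_n} -> R) Q :
  ispart P -> ispart Q -> (forall B k, p (Some (B, k)) = w B) ->
  smom p Q (testfun P u) = (refines Q P)%:R *
    \prod_(C in Q) (w (coarse P C) * \sum_k u k ^+ #|C|).
Proof.
move=> pP pQ pw; rewrite /smom.
under eq_bigr => C CQ.
  have [j jC] := cid (ispart_nonempty pQ CQ).
  rewrite (sum_testfun u pP jC pw); over.
rewrite big_split /=; congr (_ * _).
rewrite /refines; case: (boolP [forall C in Q, _]) => [/forall_inP H|/forall_inPn [C CQ /negbTE nC]].
  by rewrite big1 // => C /H ->.
by rewrite (bigD1 C) //= nC mul0r.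
Qed.

(** Induction by decreasing number of blocks, which is bounded by [n]. The proper refinements of [P]
    have more blocks than [P], so this is the order in which the triangular systems are solved. *)
Lemma ispart_ind (A : {set {set 'I_n}} -> Prop) :
  (forall P, ispart P -> (forall Q, ispart Q -> (#|P| < #|Q|)%N -> A Q) -> A P) ->
  forall P, ispart P -> A P.
Proof.
move=> IH P; have [m] := ubnP (n - #|P|); elim: m P => // m IHm P Pm pP.
apply: IH => // Q pQ PQ; apply: IHm => //.
have := ispart_card_le pQ; have := ispart_card_le pP; move: Pm PQ; lia.
Qed.

(** The test function of [P] detects only coefficients of refinements of [P], with a nonzero factor
    at [P] itself. So the coefficient at [P] is the tested sum minus the terms of finer partitions,
    divided by that factor, and all of these converge. Constant sequences give uniqueness of
    coefficients, varying masses give their continuity. *)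
Lemma smom_testfun_cvg (adm : pred {set {set 'I_n}}) (u : 'I_3 -> R)
    (p_ : nat -> testspace -> R) (p : testspace -> R) (w_ : nat -> R) (w : R)
    (c_ : nat -> {set {set 'I_n}} -> R) (c : {set {set 'I_n}} -> R) :
  (forall P, adm P -> ispart P) ->
  (forall P B, adm P -> B \in P -> \sum_k u k ^+ #|B| != 0) ->
  w != 0 -> (forall k, w_ k != 0) -> w_ k @[k --> \oo] --> w ->
  (forall B i, p (Some (B, i)) = w) -> (forall k B i, p_ k (Some (B, i)) = w_ k) ->
  (forall P, adm P ->
     \sum_(Q | adm Q) c_ k Q * smom (p_ k) Q (testfun P u) @[k --> \oo] -->
     \sum_(Q | adm Q) c Q * smom p Q (testfun P u)) ->
  forall P, adm P -> c_ k P @[k --> \oo] --> c P.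
Proof.
move=> ap au w0 w_0 wcv pw p_w scv P0 aP0; move: (ap P0 aP0) (aP0).
move: P0 {aP0}; apply: ispart_ind => P pP IH aP.
have smE q v Q : (forall B i, q (Some (B, i)) = v) -> adm Q ->
    smom q Q (testfun P u) = (refines Q P)%:R * \prod_(C in Q) (v * \sum_k u k ^+ #|C|).
  by move=> qv aQ; rewrite (smom_testfun u pP (ap _ aQ) (w := fun=> v)).
have smcv Q : adm Q -> smom (p_ k) Q (testfun P u) @[k --> \oo] --> smom p Q (testfun P u).
  move=> aQ; rewrite (smE _ _ _ pw) //; under eq_fun do rewrite (smE _ _ _ (p_w _)) //.
  apply: cvgMr; rewrite big_mkcond /=; under eq_fun do rewrite big_mkcond /=.
  apply: cvg_big => [|C _]; first exact: mul_continuous.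
  by case: ifP => _; [exact: cvgMl|exact: cvg_cst].
have rPP : refines P P by apply/forall_inP => B BP; apply/exists_inP; exists B.
have nz q v : (forall B i, q (Some (B, i)) = v) -> v != 0 -> smom q P (testfun P u) != 0.
  move=> qv v0; rewrite (smE _ _ _ qv) // rPP mul1r.
  by apply/prodf_neq0 => C CP; rewrite mulf_neq0 // (au P).
have solve q v e : (forall B i, q (Some (B, i)) = v) -> v != 0 ->
    e P = (\sum_(Q | adm Q) e Q * smom q Q (testfun P u) -
      \sum_(Q | adm Q && (Q != P)) e Q * smom q Q (testfun P u)) / smom q P (testfun P u).
  by move=> qv v0; rewrite (bigD1 P) //= addrK mulfK // (nz _ _ qv).
rewrite (solve _ _ c pw w0); under eq_fun => k do rewrite (solve _ _ (c_ k) (p_w k) (w_0 k)).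
apply: cvgM; last by apply: cvgV; [exact: nz pw w0|exact: smcv].
apply: cvgB; first exact: scv.
rewrite big_mkcond /=; under eq_fun do rewrite big_mkcond /=.
apply: cvg_big => [|Q _]; first exact: add_continuous.
case: ifP => [/andP[aQ QP]|_]; last exact: cvg_cst.
have [rQ|/negbTE nrQ] := boolP (refines Q P); last first.
  rewrite (smE _ _ _ pw) // nrQ mul0r mulr0.
  by under eq_fun do rewrite (smE _ _ _ (p_w _)) // nrQ mul0r mulr0; exact: cvg_cst.
apply: cvgM; last exact: smcv.
apply: IH => //; first exact: ap.
rewrite ltnNge; apply/negP => cQP; move/eqP: QP; apply.
apply: refines_eq => //; exact: ap.
Qed.

Lemma smom_testfun_inj (adm : pred {set {set 'I_n}}) u (p : testspace -> R) (w : R)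
    (d : {set {set 'I_n}} -> R) :
  (forall P, adm P -> ispart P) ->
  (forall P B, adm P -> B \in P -> \sum_k u k ^+ #|B| != 0) ->
  w != 0 -> (forall B k, p (Some (B, k)) = w) ->
  (forall P, adm P -> \sum_(Q | adm Q) d Q * smom p Q (testfun P u) = 0) ->
  forall P, adm P -> d P = 0.
Proof.
move=> ap au w0 pw d0 P aP.
have dcv : d P @[_ --> \oo] --> (0 : R).
  apply: (@smom_testfun_cvg adm u (fun=> p) p (fun=> w) w (fun=> d) (fun=> 0) ap au w0) => //.
    exact: cvg_cst.
  move=> Q aQ; rewrite d0 // [X in _ --> X]big1 => [|Q' _]; last by rewrite mul0r.
  exact: cvg_cst.
rewrite -(cvg_lim (@Rhausdorff R) dcv); apply/esym/(cvg_lim (@Rhausdorff R)).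
exact: cvg_cst.
Qed.

End Moments.

(** * Congruence between finite weighted sets forces the moment form *)

Section FiniteCongruence.
Variables (R : realType) (n : nat) (lam : R).
Hypothesis lam0 : 0 < lam.
Local Notation pblock := finset.pblock.
(** Stands for the value of the family at the finite space [I] with weights [p]. The point of [I] is
    carried along because measurable types are pointed. *)
Variable G : forall I : finType, I -> (I -> R) -> ('I_n -> I -> R) -> R.

Definition isdist (I : finType) (p : I -> R) :=
  (forall x, 0 <= p x) /\ \sum_x p x = lam.

Hypothesis linG : forall (I : finType) (x0 : I) p, isdist p -> multilinear (G x0 p).
Hypothesis congG : forall (I J : finType) (x0 : I) (y0 : J) (kappa : I -> J) p f,
  isdist p -> G x0 p (fun j x => f j (kappa x)) = G y0 (push kappa p) f.
Hypothesis contG : forall (I : finType) (x0 : I) (p_ : nat -> I -> R) p f,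
  (forall k, isdist (p_ k)) -> isdist p ->
  (forall x, p_ k x @[k --> \oo] --> p x) ->
  G x0 (p_ k) f @[k --> \oo] --> G x0 p f.

Definition unif (S : finType) : S -> R := fun=> lam / #|S|%:R.

Lemma card_pos (S : finType) (s0 : S) : 0 < #|S|%:R :> R.
Proof. by rewrite ltr0n; apply/card_gt0P; exists s0. Qed.

Lemma unif_gt0 (S : finType) (s0 : S) : 0 < lam / #|S|%:R.
Proof. by rewrite divr_gt0 // (card_pos s0). Qed.

Lemma isdist_unif (S : finType) (s0 : S) : isdist (@unif S).
Proof.
split=> [x|]; first exact: ltW (unif_gt0 s0).
by rewrite /unif sumr_const -[LHS]mulr_natr divfK // gt_eqF // (card_pos s0).
Qed.

(** The map from [s] to the set of slots [j] with [i j = s] pulls the indicators of blocks back to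
    the indicators of the points [i j]. The image of the uniform weights gives each block of
    [kerpart i] the mass of one atom and the rest to the empty set, so it depends on [kerpart i]
    only. *)
Lemma unif_ebasis_sym (S : finType) (s0 : S) (i i' : 'I_n -> S) :
  kerpart i = kerpart i' ->
  G s0 (@unif S) (fun j => ebasis R (i j)) = G s0 (@unif S) (fun j => ebasis R (i' j)).
Proof.
move=> Eii.
pose fib (i : 'I_n -> S) s : {set 'I_n} := [set j | i j == s]%SET.
have fibE (k : 'I_n -> S) j s : (fib k s == pblock (kerpart k) j) = (s == k j).
  apply/eqP/eqP => [/setP/(_ j)|->].
    by rewrite ispart_pblock ?kerpartP // inE => /eqP.
  by apply/setP => l; rewrite pblock_kerpart inE eq_sym.
have H (k : 'I_n -> S) : G s0 (@unif S) (fun j => ebasis R (k j)) =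
    G finset.set0 (push (fib k) (@unif S)) (fun j => ebasis R (pblock (kerpart k) j)).
  rewrite -(congG s0) //; last exact: isdist_unif.
  congr (G _ _ _); apply/funext => j; apply/funext => s.
  by rewrite /ebasis fibE.
rewrite !{}H Eii; congr (G _ _ _); apply/funext => B; rewrite /push /unif.
rewrite !sumr_const; congr (_ *+ _).
have cardB (k : 'I_n -> S) (C : {set 'I_n}) j : j \in C ->
    #|[pred s | fib k s == C]| = (pblock (kerpart k) j == C).
  move=> jB; have [<-|nB] := eqVneq (pblock (kerpart k) j) C.
    rewrite -[RHS](card1 (k j)); apply: eq_card => s; rewrite !inE.
    exact: fibE.
  apply: eq_card0 => s; rewrite !inE; apply/eqP => sB; move/eqP: nB; apply.
  apply/eqP; rewrite -sB eq_sym fibE; apply/eqP.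
  by move: jB; rewrite -sB inE => /eqP.
have [->|/finset.set0Pn[j jB]] := eqVneq B finset.set0; last first.
  by rewrite !(cardB _ _ j) // Eii.
(* The empty set labels the points missed by the tuple; their number is what the blocks leave
   over. *)
have tot (k : 'I_n -> S) : (#|S| = \sum_(C : {set 'I_n} | C != finset.set0) #|[pred s | fib k s == C]| + #|[pred s | fib k s == finset.set0]|)%N.
  rewrite -sum1_card (partition_big (fib k) predT) //= (bigD1 finset.set0) //= addnC.
  by congr addn; [apply: eq_bigr => C _|]; rewrite sum1_card.
have := tot i; rewrite (tot i') (_ : (\sum_(C | C != finset.set0) #|[pred s | fib i' s == C]| = \sum_(C | C != finset.set0) #|[pred s | fib i s == C]|)%N).
  by move/addnI => ->.
by apply: eq_bigr => C /finset.set0Pn[j jC]; rewrite !(cardB _ _ j) // Eii.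
Qed.

(** Correcting the coefficient of [P] changes the values only at patterns that [P] refines, and
    among patterns with at least as many blocks this is [P] alone. So the coefficients can be fixed
    from the finest partitions on. *)
Lemma unif_moments (S : finType) (s0 : S) :
  exists a, forall f, G s0 (@unif S) f = smomsum a (@unif S) f.
Proof.
have w0 := unif_gt0 s0; set w := lam / #|S|%:R in w0.
suff [a Ha] : exists a, forall i : 'I_n -> S,
    G s0 (@unif S) (fun j => ebasis R (i j)) = smomsum a (@unif S) (fun j => ebasis R (i j)).
  exists a => f; apply/eqP; rewrite -subr_eq0; apply/eqP.
  pose F g := G s0 (@unif S) g - smomsum a (@unif S) g.
  apply: (@multilinear_ebasis_eq0 _ _ _ F) => [|i]; last by rewrite /F Ha subrr.
  move=> g j c h; rewrite /F linG ?smomsum_multilinear; last exact: isdist_unif.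
  ring.
(* At stage [m] the values are right at all patterns with more than [n - m] blocks; the next stage
   corrects the partitions with exactly [n - m] blocks. *)
suff H m : exists a, forall i : 'I_n -> S, (n < #|kerpart i| + m)%N ->
    G s0 (@unif S) (fun j => ebasis R (i j)) = smomsum a (@unif S) (fun j => ebasis R (i j)).
  by have [a Ha] := H n.+1; exists a => i; apply: Ha; rewrite addnS ltnS leq_addl.
elim: m => [|m [a Ha]].
  by exists (fun=> 0) => i; rewrite addn0 ltnNge ispart_card_le // kerpartP.
(* A partition with more blocks than [S] has points is the pattern of no tuple; its correction is
   0. *)
pose err P := if pselect (exists i : 'I_n -> S, kerpart i = P) is left h then
   (G s0 (@unif S) (fun j => ebasis R (sval (cid h) j)) -
   smomsum a (@unif S) (fun j => ebasis R (sval (cid h) j))) / w ^+ #|P| else 0.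
have errP i : err (kerpart i) = (G s0 (@unif S) (fun j => ebasis R (i j)) -
   smomsum a (@unif S) (fun j => ebasis R (i j))) / w ^+ #|kerpart i|.
  rewrite /err; case: pselect => [h|[]]; last by exists i.
  case: cid => i' /= Ei'; rewrite (unif_ebasis_sym _ Ei'); congr ((_ - _) / _).
  apply: eq_bigr => Q pQ; congr (_ * _).
  by rewrite !smom_cst_ebasis // Ei'.
exists (fun P => a P + (#|P| + m == n)%:R * err P) => i im.
have key Q : ispart Q -> (#|Q| + m)%N == n -> refines Q (kerpart i) -> Q = kerpart i.
  move=> pQ /eqP Qm rQ; apply: refines_eq => //; first exact: kerpartP.
  by rewrite -(leq_add2r m) Qm -ltnS -addnS.
have -> : smomsum (fun P => a P + (#|P| + m == n)%:R * err P) (@unif S) (fun j => ebasis R (i j))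
   = smomsum a (@unif S) (fun j => ebasis R (i j))
     + (#|kerpart i| + m == n)%:R * err (kerpart i) * w ^+ #|kerpart i|.
  rewrite /smomsum (bigD1 (kerpart i)) ?kerpartP //= [X in _ = X + _](bigD1 (kerpart i)) ?kerpartP //=.
  rewrite !smom_cst_ebasis ?kerpartP //.
  have -> : refines (kerpart i) (kerpart i).
    by apply/forall_inP => B BP; apply/exists_inP; exists B.
  rewrite mul1r -/w [X in _ + X = _](_ : _ = \sum_(Q | ispart Q && (Q != kerpart i))
    a Q * smom (@unif S) Q (fun j => ebasis R (i j))).
    by rewrite mulrDl addrAC.
  apply: eq_bigr => Q /andP[pQ Qi]; rewrite mulrDl [X in _ + X](_ : _ = 0) ?addr0 //.
  case: (boolP (#|Q| + m == n)%N) => [Qm|_]; last by rewrite !mul0r.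
  rewrite smom_cst_ebasis //; case: (boolP (refines Q (kerpart i))) => [rQ|_].
    by rewrite (key Q) ?eqxx in Qi.
  by rewrite mul0r mulr0.
case: (boolP (#|kerpart i| + m == n)%N) => [Em|Nm].
  by rewrite errP mul1r divfK ?expf_neq0 ?gt_eqF // addrC subrK.
by rewrite !mul0r addr0; apply: Ha; rewrite ltn_neqAle eq_sym Nm -ltnS -addnS.
Qed.

Lemma push_unif_fst (S Z : finType) (z0 : Z) : push fst (@unif (S * Z)%type) = @unif S.
Proof.
apply/funext => s; rewrite /push /unif sumr_const.
have -> : #|[pred x : S * Z | x.1 == s]| = #|Z|.
  rewrite -(fintype.card_image (f := fun z : Z => (s, z))); last by move=> x y [].
  apply: eq_card => -[x y]; rewrite !inE /=; apply/eqP/fintype.imageP => [->|[z _ [->]]] //.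
  by exists y.
rewrite card_prod natrM -[LHS]mulr_natr; field.
by rewrite !gt_eqF // ?(card_pos z0) ?(card_pos s).
Qed.

Lemma push_unif_snd (S Z : finType) (s0 : S) : push snd (@unif (S * Z)%type) = @unif Z.
Proof.
apply/funext => s; rewrite /push /unif sumr_const.
have -> : #|[pred x : S * Z | x.2 == s]| = #|S|.
  rewrite -(fintype.card_image (f := fun z : S => (z, s))); last by move=> x y [].
  apply: eq_card => -[x y]; rewrite !inE /=; apply/eqP/fintype.imageP => [->|[z _ [_ ->]]] //.
  by exists x.
rewrite card_prod natrM -[LHS]mulr_natr; field.
by rewrite !gt_eqF // ?(card_pos s0) ?(card_pos s).
Qed.

(** A small [S] does not determine its coefficients, so [S] and the test space are compared through
    their product. Projection to the test space, where coefficients are determined, identifies those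
    of the product; projection to [S] then carries them over. *)
Lemma unif_moments_all : exists a, forall (S : finType) (s0 : S) f,
  G s0 (@unif S) f = smomsum a (@unif S) f.
Proof.
have [a Ha] := unif_moments (None : testspace n).
exists a => S s0 f.
have [b Hb] := unif_moments (s0, None : testspace n).
have bdist := isdist_unif (s0, None : testspace n).
have Eab : forall P, ispart P -> b P - a P = 0.
  apply: (@smom_testfun_inj _ _ (@ispart n) (fun=> 1) (@unif (testspace n)) (lam / #|testspace n|%:R) (fun P => b P - a P)) => //.
  - move=> P B _ _; under eq_bigr do rewrite expr1n.
    by rewrite sumr_const card_ord pnatr_eq0.
  - by rewrite gt_eqF // (unif_gt0 (None : testspace n)).
  move=> P pP.
  have := Ha (testfun P (fun=> 1)); rewrite -(push_unif_snd _ s0).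
  rewrite -(congG (s0, None : testspace n)) // Hb smomsum_push push_unif_snd // => /eqP.
  rewrite /smomsum -subr_eq0 -sumrB => /eqP H; rewrite -[RHS]H.
  by apply: eq_bigr => Q _; rewrite mulrBl.
rewrite -(push_unif_fst S (None : testspace n)) -(congG (s0, None : testspace n)) //.
rewrite Hb smomsum_push; apply: eq_bigr => P /Eab/eqP.
by rewrite subr_eq0 => /eqP ->.
Qed.

(** Splitting the atom [i] into [N i] equal atoms exhibits weights proportional to integers as the
    image of uniform weights. *)
Lemma push_unif_tag (I : finType) (N : I -> nat) :
  push (@tag I (fun i => 'I_(N i))) (@unif {i : I & 'I_(N i)}) =
  fun i => lam * (N i)%:R / (\sum_i N i)%:R.
Proof.
apply/funext => i; rewrite /push /unif sumr_const card_tagged.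
have -> : #|[pred x : {i : I & 'I_(N i)} | tag x == i]| = N i.
  rewrite -[RHS]card_ord -(fintype.card_image (f := fun z : 'I_(N i) => Tagged (fun i => 'I_(N i)) z)).
    apply: eq_card => -[x y]; rewrite !inE /=; apply/eqP/fintype.imageP => [xi|[z _ E]].
      by subst x; exists y.
    by have := congr1 tag E.
  by move=> x y /eqP; rewrite eq_Tagged => /eqP.
rewrite sumnE big_map big_enum /=.
under eq_bigr do rewrite card_ord.
by rewrite -[LHS]mulr_natr mulrAC.
Qed.

Theorem finite_moments : exists a, forall (I : finType) (x0 : I) p f,
  isdist p -> G x0 p f = smomsum a p f.
Proof.
have [a Ha] := unif_moments_all; exists a => I x0 p f dp.
(* The added 1 keeps every [N k i] positive, so that ['I_(N k i)] has a point and the normalising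
   sum [M k] is nonzero. *)
pose N (k : nat) (i : I) := (Num.truncn (k.+1%:R * p i)).+1.
pose M k := (\sum_i N k i)%N.
pose p_ k i := lam * (N k i)%:R / (M k)%:R.
have M0 k : 0 < (M k)%:R :> R.
  by rewrite ltr0n /M (bigD1 x0).
have dp_ k : isdist (p_ k).
  split=> [x|]; first by rewrite divr_ge0 ?mulr_ge0 // ltW.
  rewrite /p_ -mulr_suml -mulr_sumr -natr_sum -/(M k).
  by rewrite -mulrA divff ?mulr1 // gt_eqF.
have Nb k i : k.+1%:R * p i <= (N k i)%:R <= k.+1%:R * p i + 1.
  have := truncn_itv (mulr_ge0 (ler0n R k.+1) (dp.1 i)).
  move=> /andP[h1 h2]; rewrite (ltW h2) /=.
  by rewrite /N -natr1 lerD2r.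
have Mb k : k.+1%:R * lam <= (M k)%:R <= k.+1%:R * lam + #|I|%:R.
  rewrite /M natr_sum -dp.2 mulr_sumr; apply/andP; split.
    by apply: ler_sum => i _; case/andP: (Nb k i).
  rewrite -sum1_card natr_sum -big_split; apply: ler_sum => i _.
  by case/andP: (Nb k i).
have cvgp x : p_ k x @[k --> \oo] --> p x.
  apply/cvgrPdist_le => e e0.
  (* Rounding moves each [N k i] by at most 1 and their sum by at most [#|I|]; both errors together
     stay below [lam * c]. *)
  pose c := (1 + #|I|%:R) : R.
  have c0 : 0 < c by rewrite /c ltr_pwDl.
  near=> k.
  have kb : c / e <= k.+1%:R.
    near: k; exists (Num.truncn (c / e)) => //= k hk.
    apply: le_trans (ltW (truncnS_gt _)) _; by rewrite ler_nat ltnS.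
  have px : p x <= lam by rewrite -dp.2 (bigD1 x) //= lerDl sumr_ge0 // => i _; exact: dp.1.
  have -> : p x - p_ k x = (p x * (M k)%:R - lam * (N k x)%:R) / (M k)%:R.
    by rewrite /p_; field; rewrite gt_eqF.
  rewrite normrM normfV (gtr0_norm (M0 k)) ler_pdivrMr //.
  have h1 : `|p x * (M k)%:R - lam * (N k x)%:R| <= lam * c.
    have := dp.1 x; case/andP: (Nb k x); case/andP: (Mb k) => m1 m2 n1 n2 p0.
    rewrite /c ler_norml; move: m1 m2 n1 n2 px p0 lam0 => *; apply/andP; split; nra.
  apply: (le_trans h1).
  case/andP: (Mb k) => m1 _.
  have h2 : c <= e * k.+1%:R by rewrite mulrC -ler_pdivrMr.
  apply: (@le_trans _ _ (e * (k.+1%:R * lam))); last by rewrite ler_pM2l.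
  by rewrite mulrA [leRHS]mulrC ler_pM2l.
have c1 := @contG I x0 p_ p f dp_ dp cvgp.
have c2 : smomsum a (p_ k) f @[k --> \oo] --> smomsum a p f.
  apply: cvg_big => [|P _]; first exact: add_continuous.
  apply: cvgMr; apply: cvg_big => [|B _]; first exact: mul_continuous.
  apply: cvg_big => [|x _]; first exact: add_continuous.
  exact: cvgMl.
rewrite -(cvg_lim (@Rhausdorff _) c1) -(cvg_lim (@Rhausdorff _) c2).
congr (lim (_ @ \oo)); apply/funext => k.
pose s0 : {i : I & 'I_(N k i)} := Tagged (fun i => 'I_(N k i)) (ord0 : 'I_(N k x0)).
by rewrite /p_ /M -push_unif_tag -smomsum_push -(Ha _ s0) -(congG s0) //; exact: isdist_unif.
Unshelve. all: by end_near.
Qed.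

End FiniteCongruence.

(** * The moment sum when the atoms of one block lose their mass *)

Section BlowUpLimit.
Variables (R : realType) (n : nat).
Implicit Types (P Q : {set {set 'I_n}}).
Local Notation pblock := finset.pblock.

(** Only refinements [Q] of [P] contribute. If [B0] is a block of [Q], the term carries exactly one
    factor [e_ k], and for [Q] other than [P] it vanishes by hypothesis. If [Q] cuts [B0] into
    several blocks, the factor occurs at least twice and the quotient tends to 0. *)
Lemma blowup_limit (a : {set {set 'I_n}} -> R) P (B0 : {set 'I_n}) (u : 'I_3 -> R)
    (w : R) (e_ : nat -> R) (p_ : nat -> testspace n -> R) :
  ispart P -> B0 \in P ->
  (forall k, e_ k != 0) -> e_ k @[k --> \oo] --> 0 ->
  (forall k B i, p_ k (Some (B, i)) = if B == B0 then e_ k else w) ->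
  (forall Q, ispart Q -> refines Q P -> B0 \in Q -> Q != P ->
     a Q * \prod_(C in Q) \sum_i u i ^+ #|C| = 0) ->
  (e_ k)^-1 * smomsum a (p_ k) (testfun P u) @[k --> \oo] -->
    a P * ((\sum_i u i ^+ #|B0|) * \prod_(C in P | C != B0) (w * \sum_i u i ^+ #|C|)).
Proof.
move=> pP B0P e0 ecv pw aQ.
set K := (\sum_i _) * _.
have -> : a P * K = \sum_(Q | ispart Q) (if Q == P then a P * K else 0).
  rewrite (bigD1 P) //= eqxx big1 ?addr0 // => Q /andP[_ /negbTE ->] //.
under eq_fun do rewrite /smomsum mulr_sumr.
apply: cvg_big => [|Q pQ]; first exact: add_continuous.
pose W k (B : {set 'I_n}) := if B == B0 then e_ k else w.
have sE k : smom (p_ k) Q (testfun P u) =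
    (refines Q P)%:R * \prod_(C in Q) (W k (coarse P C) * \sum_i u i ^+ #|C|).
  by apply: (smom_testfun u pP pQ) => B i; exact: pw.
under eq_fun do rewrite sE.
have Wcv B : W k B @[k --> \oo] --> (if B == B0 then 0 else w).
  by rewrite /W; case: eqP => _; [exact: ecv|exact: cvg_cst].
have [rQP|nQP] := boolP (refines Q P); last first.
  under eq_fun do rewrite mul0r !mulr0.
  case: eqP => [QP|_]; last exact: cvg_cst.
  case/negP: nQP; rewrite QP; apply/forall_inP => B BP; apply/exists_inP; by exists B.
have coarseP C : C \in Q -> coarse P C \in P /\ C \subset coarse P C.
  move=> CQ; have /forall_inP/(_ C CQ)/exists_inP[B BP CB] := rQP.
  have [j jC] := ispart_nonempty pQ CQ.
  by rewrite (coarseE pP jC BP CB).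
have [B0Q|B0Q] := boolP (B0 \in Q).
  have coarse_B0 : coarse P B0 = B0.
    by have [j jB] := ispart_nonempty pP B0P; exact: (coarseE pP jB).
  have coarse_ne C : C \in Q -> C != B0 -> coarse P C != B0.
    move=> CQ CB0; apply/eqP => cE; have [_ Csub] := coarseP C CQ.
    have [j jC] := ispart_nonempty pQ CQ; move/eqP: CB0; apply.
    rewrite cE in Csub.
    by rewrite -(ispart_def_pblock pQ CQ jC) (ispart_def_pblock pQ B0Q) // (fintype.subsetP Csub).
  have E k : (e_ k)^-1 * (a Q * (true%:R * \prod_(C in Q) (W k (coarse P C) * \sum_i u i ^+ #|C|)))
      = a Q * ((\sum_i u i ^+ #|B0|) * \prod_(C in Q | C != B0) (w * \sum_i u i ^+ #|C|)).
    rewrite (bigD1 B0) //= {1}/W coarse_B0 eqxx mul1r.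
    rewrite (eq_bigr (fun C : {set 'I_n} => w * \sum_i u i ^+ #|C|)); last first.
      by move=> C /andP[CQ CB0]; rewrite /W (negbTE (coarse_ne C CQ CB0)).
    by field; exact: e0.
  under eq_fun do rewrite E.
  case: eqP => [->|/eqP QP]; first exact: cvg_cst.
  suff -> : a Q * ((\sum_i u i ^+ #|B0|) * \prod_(C in Q | C != B0) (w * \sum_i u i ^+ #|C|)) = 0.
    exact: cvg_cst.
  have := aQ Q pQ rQP B0Q QP; rewrite (bigD1 B0) //= => z.
  rewrite big_split /=; set S := \prod_(C in Q | C != B0) \sum_i _ in z *.
  set V := \prod_(C in Q | C != B0) w.
  transitivity (V * (a Q * ((\sum_i u i ^+ #|B0|) * S))); first ring.
  by rewrite z mulr0.
have -> : (Q == P) = false.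
  by apply/eqP => QP; move: B0Q; rewrite QP B0P.
have [x xB0] := ispart_nonempty pP B0P.
have sub y : y \in B0 -> coarse P (pblock Q y) = B0.
  move=> yB; have [cP Cs] := coarseP _ (ispart_pblock_mem y pQ).
  by rewrite -(ispart_def_pblock pP cP (fintype.subsetP Cs _ (ispart_pblock y pQ))) (ispart_def_pblock pP B0P yB).
(* [B0] is not a block of [Q], so [Q] cuts it: the blocks of [x] and [y] differ and both lie in
   [B0], which gives the factor [e_ k] twice. *)
have [y yB0 yx] : exists2 y, y \in B0 & y \notin pblock Q x.
  apply/fintype.subsetPn; apply/negP => Bs.
  have [_] := coarseP _ (ispart_pblock_mem x pQ); rewrite (sub x xB0) => Cs.
  have E : pblock Q x = B0 by apply/eqP; rewrite finset.eqEsubset Cs Bs.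
  by move: B0Q; rewrite -E ispart_pblock_mem.
have C12 : pblock Q y != pblock Q x.
  by apply: contraNneq yx => <-; exact: ispart_pblock.
have E k : (e_ k)^-1 * (a Q * (true%:R * \prod_(C in Q) (W k (coarse P C) * \sum_i u i ^+ #|C|)))
   = e_ k * (a Q * (\sum_i u i ^+ #|pblock Q x|) * (\sum_i u i ^+ #|pblock Q y|) *
     \prod_(C in Q | (C != pblock Q x) && (C != pblock Q y)) (W k (coarse P C) * \sum_i u i ^+ #|C|)).
  rewrite (bigD1 (pblock Q x)) ?ispart_pblock_mem //=.
  rewrite (bigD1 (pblock Q y)) ?ispart_pblock_mem //=.
  rewrite /W !sub // eqxx mul1r.
  rewrite (eq_bigl (fun C => (C \in Q) && ((C != pblock Q x) && (C != pblock Q y)))); last first.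
    by move=> C; rewrite andbA.
  by field; exact: e0.
under eq_fun do rewrite E.
set c := a Q * _ * _.
have H : c * \prod_(C in Q | (C != pblock Q x) && (C != pblock Q y))
      (W k (coarse P C) * \sum_i u i ^+ #|C|) @[k --> \oo] -->
    c * \prod_(C in Q | (C != pblock Q x) && (C != pblock Q y))
      ((if coarse P C == B0 then 0 else w) * \sum_i u i ^+ #|C|).
  apply: cvgMr; apply: cvg_big => [|C _]; first exact: mul_continuous.
  by apply: cvgMl; exact: Wcv.
have H2 := cvgM ecv H; rewrite mul0r in H2; exact: H2.
Qed.

End BlowUpLimit.

(** * Topology of S^r through densities *)

Section Density.
Import HBNNSimple.
Context d (T : measurableType d) (R : realType).

(** The definition of a density gives the case of indicators, hence of simple functions. An
    increasing approximation of [f] stays increasing after multiplication by [g >= 0], so monotone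
    convergence applies to both sides. *)
Lemma ge0_integral_density (rho nu : {measure set T -> \bar R}) (g : T -> R)
    (f : T -> \bar R) :
  is_density rho g nu -> (forall x, 0 <= f x)%E -> measurable_fun [set: T] f ->
  (\int[nu]_x f x = \int[rho]_x (f x * (g x)%:E))%E.
Proof.
move=> [mg [g0 dg]] f0 mf; have mG := (measurable_EFinP [set: T] g).2 mg.
pose h := nnsfun_approx measurableT mf.
have simp (k : {nnsfun T >-> R}) :
    (\int[nu]_x (k x)%:E = \int[rho]_x ((k x)%:E * (g x)%:E))%E.
  pose F y x := ((y * \1_(k @^-1` [set y]) x)%:E * (g x)%:E)%E.
  have F0 y x : (0 <= F y x)%E.
    by rewrite mule_ge0 ?lee_fin //; exact: nnfun_muleindic_ge0.
  have mF y : measurable_fun [set: T] (F y).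
    apply: emeasurable_funM => //; apply/measurable_EFinP; apply: measurable_funM => //.
  rewrite integralT_nnsfun sintegralE.
  rewrite (eq_integral (fun x => \sum_(y \in range k) F y x)%E); last first.
    move=> x _; rewrite {1}(fimfunE k x) -fsumEFin // ge0_mule_fsuml // => y.
    exact: nnfun_muleindic_ge0.
  rewrite ge0_integral_fsum //; apply: eq_fsbigr => y /set_mem[z _ <-{y}].
  rewrite /F dg; last by rewrite -[X in measurable X]setTI; exact: measurable_funP.
  rewrite integral_mkcond -ge0_integralZl_EFin //.
  - apply: eq_integral => x _; rewrite patchE EFinM -muleA indicE.
    by case: ifP => _; rewrite ?mul1e ?mul0e.
  - by move=> x _; rewrite patchE; case: ifP => _; rewrite ?lee_fin.
  - apply/(measurable_restrictT _ _).1; last exact: measurable_funTS.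
    by rewrite -[X in measurable X]setTI; exact: measurable_funP.
have hcv x : ((h n x)%:E @[n --> \oo] --> f x)%E by exact: cvg_nnsfun_approx.
have hnd x : {homo (fun n => h n x) : a b / (a <= b)%N >-> a <= b}.
  by move=> a b ab; exact: (lefP _ _ (nd_nnsfun_approx measurableT mf ab)).
have c1 : (\int[nu]_x (h n x)%:E @[n --> \oo] --> \int[nu]_x f x)%E.
  rewrite (_ : \int[nu]_x f x = \int[nu]_x limn (fun n => (h n x)%:E))%E; last first.
    by apply: eq_integral => x _; rewrite (cvg_lim (@ereal_hausdorff R) (hcv x)).
  apply: cvg_monotone_convergence => //.
  - by move=> n; exact/measurable_EFinP.
  - by move=> n x _; rewrite lee_fin.
  - by move=> x _ a b ab; rewrite lee_fin hnd.
have c2 : (\int[rho]_x ((h n x)%:E * (g x)%:E) @[n --> \oo] --> \int[rho]_x (f x * (g x)%:E))%E.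
  rewrite (_ : \int[rho]_x (f x * (g x)%:E) = \int[rho]_x limn (fun n => (h n x)%:E * (g x)%:E))%E; last first.
    apply: eq_integral => x _; apply/esym/(cvg_lim (@ereal_hausdorff R)).
    by apply: cvgeZr => //; exact: hcv.
  apply: cvg_monotone_convergence => //.
  - by move=> n; apply: emeasurable_funM => //; exact/measurable_EFinP.
  - by move=> n x _; rewrite mule_ge0 ?lee_fin.
  - by move=> x _ a b ab; rewrite lee_wpmul2r ?lee_fin // hnd.
have E : (fun n => \int[nu]_x (h n x)%:E)%E = (fun n => \int[rho]_x ((h n x)%:E * (g x)%:E))%E.
  by apply/funext => n; exact: simp.
by rewrite E in c1; exact: (cvg_unique (@ereal_hausdorff R) c1 c2).
Qed.
End Density.

(** * Inequalities between differences of numbers and of their powers *)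

Section PowR.
Variable R : realType.
Implicit Types a b r q : R.

(** For [t] in (0, 1] the power [t ^ r] is at least [t]; this is applied to [a / (a + b)] and
    [b / (a + b)], whose sum is 1. *)
Lemma powR_subadd r a b : 0 < r -> r <= 1 -> 0 <= a -> 0 <= b ->
  (a + b) `^ r <= a `^ r + b `^ r.
Proof.
move=> r0 r1 a0 b0.
have [ab0|ab0] := eqVneq (a + b) 0.
  by rewrite ab0 powR0 ?gt_eqF// addr_ge0 ?powR_ge0.
have abp : 0 < a + b by rewrite lt_neqAle eq_sym ab0 addr_ge0.
have H c : 0 <= c -> c <= a + b -> c / (a + b) <= (c / (a + b)) `^ r.
  move=> c0 cab; have [->|cn0] := eqVneq c 0; first by rewrite mul0r powR_ge0.
  apply: ger1_powR => //; rewrite divr_gt0 ?ler_pdivrMr ?mul1r// lt_neqAle eq_sym cn0.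
  exact: c0.
have h1 : a / (a + b) <= (a / (a + b)) `^ r by apply: H; rewrite ?lerDl.
have h2 : b / (a + b) <= (b / (a + b)) `^ r by apply: H; rewrite ?lerDr.
have e c : 0 <= c -> c `^ r = (c / (a + b)) `^ r * (a + b) `^ r.
  by move=> c0; rewrite -powRM ?divfK// ?divr_ge0 // ltW.
rewrite (e a) // (e b) // -mulrDl -[leLHS]mul1r ler_wpM2r ?powR_ge0//.
by apply: le_trans (lerD h1 h2); rewrite -mulrDl divff.
Qed.

Lemma powR_dist r a b : 0 < r -> r <= 1 -> 0 <= a -> 0 <= b ->
  `|a `^ r - b `^ r| <= `|a - b| `^ r.
Proof.
move=> r0 r1; wlog ab : a b / b <= a => [W a0 b0|a0 b0].
  have /orP[ab|ba] := le_total b a; first exact: W.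
  by rewrite distrC (distrC a); exact: W.
rewrite (ger0_norm (_ : 0 <= a - b)) ?subr_ge0// ger0_norm; last first.
  by rewrite subr_ge0 ge0_ler_powR // ?nnegrE // ltW.
rewrite lerBlDr -{1}(subrK b a) powR_subadd // subr_ge0 //.
Qed.

Lemma powRrK r a : 0 < r -> 0 <= a -> (a `^ r) `^ r^-1 = a.
Proof. by move=> r0 a0; rewrite -powRrM divff ?powRr1// gt_eqF. Qed.

Lemma powRVK r a : 0 < r -> 0 <= a -> (a `^ r^-1) `^ r = a.
Proof. by move=> r0 a0; rewrite -powRrM mulVf ?powRr1// gt_eqF. Qed.

Lemma powR_add_le q a b : 0 < q -> 0 <= a -> 0 <= b ->
  (a + b) `^ q <= 2 `^ q * (a `^ q + b `^ q).
Proof.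
move=> q0; wlog ab : a b / b <= a => [W a0 b0|a0 b0].
  have /orP[ab|ba] := le_total b a; first exact: W.
  by rewrite addrC (addrC (a `^ q)); exact: W.
apply: (@le_trans _ _ ((2 * a) `^ q)).
  apply: ge0_ler_powR; rewrite ?nnegrE ?addr_ge0 ?mulr_ge0 // ?(ltW q0) //.
  by rewrite mulr2n mulrDl mul1r lerD2l.
by rewrite powRM // ler_wpM2l ?powR_ge0 // lerDl powR_ge0.
Qed.

(** For [r < 1] the r-th power shrinks differences of large numbers, whence the extra multiple of
    [a]. With [m <= M] the two r-th powers, either [M <= (1 + k) m], and [k] is chosen so that this
    costs the factor [1 + eta] after taking the power 1/r, or [M] is at most a constant times
    [M - m]. *)
Lemma powR_dist_inv r (eta : R) : 0 < r -> r <= 1 -> 0 < eta -> exists2 C : R, 0 < C &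
  forall a b, 0 <= a -> 0 <= b ->
    `|a - b| <= eta * a + C * `|a `^ r - b `^ r| `^ r^-1.
Proof.
move=> r0 r1 eta0.
have q0 : 0 < r^-1 by rewrite invr_gt0.
have [k k0 kE] : exists2 k : R, 0 < k & (1 + k) `^ r^-1 = 1 + eta.
  exists ((1 + eta) `^ r - 1); last by rewrite addrC subrK powRrK // addr_ge0 // ltW.
  rewrite subr_gt0 -[X in X < _](powRr0 (1 + eta)).
  rewrite /powR !gt_eqF ?addr_gt0 // mul0r ltr_expR mulr_gt0 // ln_gt0 //.
  by rewrite ltrDl.
pose C := (1 + k^-1) `^ r^-1.
have C0 : 0 < C by rewrite powR_gt0 // addr_gt0 // invr_gt0.
exists C => //.
suff H m M : 0 <= m -> m <= M -> M `^ r^-1 - m `^ r^-1 <= eta * m `^ r^-1 + C * (M - m) `^ r^-1.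
  move=> a b a0 b0; have [ab|ba] := leP b a.
    have := H (b `^ r) (a `^ r) (powR_ge0 _ _); rewrite !powRrK //.
    rewrite ge0_ler_powR ?nnegrE ?(ltW r0) // => /(_ isT).
    rewrite ger0_norm ?subr_ge0 // ger0_norm ?subr_ge0 ?ge0_ler_powR ?nnegrE ?(ltW r0)//.
    move=> h; apply: (le_trans h); rewrite lerD2r ler_pM2l //.
  have := H (a `^ r) (b `^ r) (powR_ge0 _ _); rewrite !powRrK //.
  rewrite ge0_ler_powR ?nnegrE ?(ltW r0) ?(ltW ba)// => /(_ isT).
  rewrite distrC gtr0_norm ?subr_gt0 // [`|a `^ r - _|]distrC.
  by rewrite ger0_norm ?subr_ge0 ?ge0_ler_powR ?nnegrE ?(ltW r0) ?(ltW ba).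
move=> m0 mM; have M0 := le_trans m0 mM.
have [h|h] := leP (M - m) (k * m).
  have : M `^ r^-1 <= (1 + eta) * m `^ r^-1.
    rewrite -kE -powRM //; last by rewrite addr_ge0 // ltW.
    apply: ge0_ler_powR; rewrite ?nnegrE ?(ltW q0) ?mulr_ge0 ?addr_ge0 ?(ltW k0) //.
    by rewrite mulrDl mul1r -lerBlDl.
  have : 0 <= C * (M - m) `^ r^-1 by rewrite mulr_ge0 ?powR_ge0 ?(ltW C0).
  lra.
have : M `^ r^-1 <= C * (M - m) `^ r^-1.
  have k1 : 0 <= 1 + k^-1 by rewrite addr_ge0 // invr_ge0 ltW.
  rewrite /C -powRM ?subr_ge0 //.
  apply: ge0_ler_powR; [exact: ltW q0|exact: M0|by rewrite nnegrE mulr_ge0 // subr_ge0|].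
  have : m <= k^-1 * (M - m) by rewrite mulrC ler_pdivlMr // mulrC ltW.
  by rewrite mulrDl mul1r -lerBlDl; have -> : M - (M - m) = m by ring.
have := powR_ge0 m r^-1.
have : 0 <= eta * m `^ r^-1 by rewrite mulr_ge0 ?powR_ge0 ?(ltW eta0).
lra.
Qed.

End PowR.

(** * Total variation distance against distance in S^r *)

Section L1close.
Context d (T : measurableType d) (R : realType).
Implicit Types (mu nu xi rho : {measure set T -> \bar R}) (f g h phi psi : T -> R).

Lemma bounded_integrable mu phi (M : R) : (mu [set: T] < +oo)%E ->
  measurable_fun [set: T] phi -> (forall x, `|phi x| <= M) ->
  mu.-integrable [set: T] (EFin \o phi).
Proof.
move=> muT mphi phiM; apply: measurable_bounded_integrable => //.
exists M; split; first exact: num_real.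
by move=> N MN x _ /=; exact: le_trans (phiM x) (ltW MN).
Qed.

Lemma density_integrable rho mu f : (mu [set: T] < +oo)%E -> is_density rho f mu ->
  rho.-integrable [set: T] (EFin \o f).
Proof.
move=> muT [mf [f0 df]]; apply/integrableP; split; first exact/measurable_EFinP.
by under eq_integral do rewrite /= ger0_norm //; rewrite -df.
Qed.

Lemma integrable_density rho mu f phi : is_density rho f mu ->
  mu.-integrable [set: T] (EFin \o phi) ->
  rho.-integrable [set: T] (EFin \o (fun x => phi x * f x)).
Proof.
move=> df; have [mf [f0 _]] := df; move=> /integrableP[/measurable_EFinP mphi iphi].
apply/integrableP; split; first by apply/measurable_EFinP; exact: measurable_funM.
rewrite (ge0_integral_density df) in iphi => //; last first.
  by apply: measurableT_comp => //; exact/measurable_EFinP.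
apply: le_lt_trans iphi; rewrite le_eqVlt; apply/orP; left; apply/eqP.
by apply: eq_integral => x _ /=; rewrite normrM EFinM (ger0_norm (f0 x)).
Qed.

Lemma Rintegral_density rho mu f phi : is_density rho f mu ->
  mu.-integrable [set: T] (EFin \o phi) ->
  \int[mu]_x phi x = \int[rho]_x (phi x * f x).
Proof.
move=> df iphi; have [mf [f0 _]] := df; have miphi := measurable_int _ iphi.
have scale (y z : R) : 0 <= z -> (maxe (y * z)%:E 0 = maxe y%:E 0 * z%:E)%E.
  by move=> z0; rewrite maxe_pMl ?lee_fin // mul0e EFinM.
rewrite /Rintegral; congr fine; rewrite integralE [RHS]integralE; congr (_ - _)%E.
  rewrite (ge0_integral_density df) //; last exact: measurable_funepos.
  by apply: eq_integral => x _; rewrite !funeposE /= -scale.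
rewrite (ge0_integral_density df) //; last exact: measurable_funeneg.
by apply: eq_integral => x _; rewrite !funenegE /= -scale // mulNr.
Qed.

Lemma ge0_integral_lincomb mu (a b : R) f g : 0 <= a -> 0 <= b ->
  (forall x, 0 <= f x) -> (forall x, 0 <= g x) ->
  measurable_fun [set: T] f -> measurable_fun [set: T] g ->
  (\int[mu]_x (a * f x + b * g x)%:E =
   a%:E * \int[mu]_x (f x)%:E + b%:E * \int[mu]_x (g x)%:E)%E.
Proof.
move=> a0 b0 f0 g0 mf mg.
under eq_integral do rewrite EFinD !EFinM.
rewrite ge0_integralD //.
- by rewrite !ge0_integralZl_EFin //; try (exact/measurable_EFinP);
    move=> x _; rewrite lee_fin.
- by move=> x _; rewrite -EFinM lee_fin mulr_ge0.
- by apply: measurable_funeM; exact/measurable_EFinP.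
- by move=> x _; rewrite -EFinM lee_fin mulr_ge0.
- by apply: measurable_funeM; exact/measurable_EFinP.
Qed.

(** The norm distance of the two measures, written with a dominating measure as in [Sr_close], so
    that integrands can be compared pointwise. *)
Definition L1close mu nu (e : R) : Prop :=
  exists (rho : {finite_measure set T -> \bar R}) f g,
    [/\ is_density rho f mu, is_density rho g nu &
       (\int[rho]_x (`|f x - g x|)%:E <= e%:E)%E].

Section RootExponent.
Variable r : R.
Hypotheses (r0 : 0 < r) (r1 : r <= 1).

(** Integrating [powR_dist_inv] bounds the L1 distance of the densities by [eta] times the mass of
    [mu], plus a constant times the S^r distance to the power 1/r; [eta] is fitted to that mass.
    Together with the converse below, [M^r] carries the topology of total variation. *)
Lemma Mr_close_L1close mu (e : R) : (mu [set: T] < +oo)%E -> 0 < e ->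
  exists2 delta : R, 0 < delta &
    forall nu, Mr_close r mu nu delta -> L1close mu nu e.
Proof.
move=> muT e0; pose m := fine (mu [set: T]).
have muE : mu [set: T] = m%:E by rewrite /m fineK // ge0_fin_numE.
have m0 : 0 <= m by rewrite fine_ge0.
have eta0 : 0 < e / (2 * (m + 1)) by rewrite divr_gt0 // mulr_gt0 // ltr_wpDl.
have [C C0 HC] := powR_dist_inv r0 r1 eta0.
exists ((e / 2 / C) `^ r); first by rewrite powR_gt0 // !divr_gt0.
move=> nu [rho [f [g [df [dg]]]]].
rewrite powRrK ?divr_ge0 ?(ltW C0) ?(ltW e0) // => H.
exists rho, f, g; split => //.
have [mf [f0 df']] := df; have [mg [g0 _]] := dg.
set I := (\int[rho]_x _)%E in H.
have mI : measurable_fun [set: T] (fun x => `|f x `^ r - g x `^ r| `^ r^-1).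
  apply: (measurableT_comp (@measurable_powR R _)); apply: measurableT_comp => //.
  by apply: measurable_funB; exact: (measurableT_comp (@measurable_powR R _)).
have H' : (\int[rho]_x (`|f x `^ r - g x `^ r| `^ r^-1)%:E < (e / 2 / C)%:E)%E.
  by apply: le_lt_trans H; rewrite le_eqVlt /I; under [in X in _ == X]eq_integral do rewrite !mul1r; rewrite eqxx.
apply: (@le_trans _ _ (\int[rho]_x (e / (2 * (m + 1)) * f x +
    C * `|f x `^ r - g x `^ r| `^ r^-1)%:E)%E).
  apply: ge0_le_integral => //.
  - by apply/measurable_EFinP; apply: measurableT_comp => //; exact: measurable_funB.
  - by apply/measurable_EFinP; apply: measurable_funD; apply: measurable_funM.
  - by move=> x _; rewrite lee_fin; exact: HC.
rewrite ge0_integral_lincomb ?(ltW eta0) ?(ltW C0) //.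
rewrite -df' // muE.
apply: (@le_trans _ _ ((e / 2)%:E + (e / 2)%:E)%E); last first.
  by rewrite -EFinD -splitr.
apply: leeD.
  have m1 : 0 < m + 1 by rewrite ltr_wpDl.
  rewrite -EFinM lee_fin (_ : _ * m = e / 2 * (m / (m + 1))); last by field; rewrite gt_eqF.
  by rewrite ler_piMr ?divr_ge0 ?(ltW e0) // ler_pdivrMr // mul1r lerDl.
apply: (@le_trans _ _ (C%:E * (e / 2 / C)%:E)%E).
  by apply: lee_wpmul2l; [rewrite lee_fin ltW|exact: ltW].
by rewrite -EFinM lee_fin mulrC divfK // gt_eqF.
Qed.

Lemma L1close_Mr_close mu nu (e delta : R) : L1close mu nu e -> e < delta `^ r^-1 ->
  Mr_close r mu nu delta.
Proof.
move=> [rho [f [g [df dg H]]]] ed; exists rho, f, g; split => //; split => //.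
have [mf [f0 _]] := df; have [mg [g0 _]] := dg.
apply: (@le_lt_trans _ _ e%:E); last by rewrite lte_fin.
apply: le_trans H; apply: ge0_le_integral => //.
- apply/measurable_EFinP; apply: (measurableT_comp (@measurable_powR R _)).
  apply: measurableT_comp => //; under eq_fun do rewrite !mul1r.
  by apply: measurable_funB; exact: (measurableT_comp (@measurable_powR R _)).
- by apply/measurable_EFinP; apply: measurableT_comp => //; exact: measurable_funB.
move=> x _; rewrite lee_fin !mul1r -[leRHS](powRrK r0) //.
by apply: ge0_ler_powR; rewrite ?nnegrE ?invr_ge0 ?(ltW r0) ?powR_ge0 ?powR_dist.
Qed.

Lemma L1close_Rintegral mu nu (e M : R) psi : (mu [set: T] < +oo)%E ->
  (nu [set: T] < +oo)%E -> L1close mu nu e -> measurable_fun [set: T] psi ->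
  0 <= M -> (forall x, `|psi x| <= M) ->
  `|\int[mu]_x psi x - \int[nu]_x psi x| <= M * e.
Proof.
move=> muT nuT [rho [f [g [df dg H]]]] mpsi M0 psiM.
have [mf [f0 _]] := df; have [mg [g0 _]] := dg.
have imu := bounded_integrable muT mpsi psiM.
have inu := bounded_integrable nuT mpsi psiM.
rewrite (Rintegral_density df imu) (Rintegral_density dg inu).
have i1 := integrable_density df imu; have i2 := integrable_density dg inu.
rewrite -RintegralB //.
have i3 : rho.-integrable [set: T] (EFin \o (fun x => psi x * f x - psi x * g x)).
  by have := integrableB measurableT i1 i2; apply: eq_integrable.
apply: (le_trans (le_normr_Rintegral _ i3)) => //.
have iabs : rho.-integrable [set: T] (EFin \o (fun x => `|f x - g x|)).
  have := integrableB measurableT (density_integrable muT df) (density_integrable nuT dg).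
  by move=> /integrable_abse; apply: eq_integrable.
apply: (@le_trans _ _ (\int[rho]_x (M * `|f x - g x|))).
  apply: le_Rintegral => //.
  - by have := integrable_abse i3; apply: eq_integrable.
  - by have := integrableZl measurableT M iabs; apply: eq_integrable.
  - by move=> x _; rewrite -mulrBr normrM ler_wpM2r.
rewrite RintegralZl // ler_wpM2l // -lee_fin fineK //.
exact: integrable_fin_num.
Qed.

Lemma L1close_set mu nu (e : R) A : (mu [set: T] < +oo)%E ->
  (nu [set: T] < +oo)%E -> L1close mu nu e -> measurable A ->
  `|fine (mu A) - fine (nu A)| <= e.
Proof.
move=> muT nuT H mA.
have := @L1close_Rintegral mu nu e 1 (\1_A) muT nuT H _ ler01.
rewrite /Rintegral !integral_indic // setIT mul1r; apply; first exact: measurable_indic.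
by move=> x; rewrite indicE; case: (_ \in _); rewrite ?normr1 ?normr0.
Qed.

(** A number attached to the two measures alone, without a choice of dominating measure, so that
    fields can be defined by means of it. It lies between half the norm of [mu - nu] and that
    norm. *)
Definition tv mu nu : R := sup [set `|fine (mu A) - fine (nu A)| | A in measurable].

Lemma fine_le_measure mu A : (mu [set: T] < +oo)%E -> measurable A ->
  0 <= fine (mu A) <= fine (mu [set: T]).
Proof.
move=> muT mA.
have h : (mu A <= mu [set: T])%E by apply: le_measure; rewrite ?inE.
rewrite fine_ge0 //= fine_le // ge0_fin_numE //.
exact: le_lt_trans muT.
Qed.

Lemma tv_ub mu nu A : (mu [set: T] < +oo)%E -> (nu [set: T] < +oo)%E ->
  measurable A -> `|fine (mu A) - fine (nu A)| <= tv mu nu.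
Proof.
move=> muT nuT mA; apply: ub_le_sup; last by exists A.
exists (fine (mu [set: T]) + fine (nu [set: T])) => _ [B mB <-].
have /andP[a1 a2] := fine_le_measure muT mB.
have /andP[b1 b2] := fine_le_measure nuT mB.
by rewrite ler_norml; apply/andP; split; lra.
Qed.

Lemma tv_le mu nu (e : R) :
  (forall A, measurable A -> `|fine (mu A) - fine (nu A)| <= e) -> tv mu nu <= e.
Proof.
move=> H; apply: ge_sup; first by exists `|fine (mu set0) - fine (nu set0)|, set0.
by move=> _ [A mA <-]; exact: H.
Qed.

Lemma tv_ge0 mu nu : (mu [set: T] < +oo)%E -> (nu [set: T] < +oo)%E -> 0 <= tv mu nu.
Proof. by move=> muT nuT; apply: le_trans (tv_ub muT nuT measurable0). Qed.

Lemma tv_dist mu nu xi : (mu [set: T] < +oo)%E -> (nu [set: T] < +oo)%E ->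
  (xi [set: T] < +oo)%E -> `|tv mu nu - tv mu xi| <= tv nu xi.
Proof.
move=> muT nuT xiT; rewrite ler_distl; apply/andP; split.
  rewrite lerBlDr; apply: tv_le => A mA.
  have := tv_ub muT nuT mA; have := tv_ub nuT xiT mA.
  have := ler_normD (fine (mu A) - fine (nu A)) (fine (nu A) - fine (xi A)).
  by rewrite addrA subrK; lra.
apply: tv_le => A mA.
have := tv_ub muT xiT mA; have := tv_ub nuT xiT mA.
have := ler_normD (fine (mu A) - fine (xi A)) (fine (xi A) - fine (nu A)).
rewrite addrA subrK (distrC (fine (xi A))); lra.
Qed.

Lemma L1close_tv mu nu (e : R) : (mu [set: T] < +oo)%E ->
  (nu [set: T] < +oo)%E -> L1close mu nu e -> tv mu nu <= e.
Proof. by move=> muT nuT H; apply: tv_le => A; exact: L1close_set. Qed.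

(** On the set where [g <= f], and on its complement, the integral of [|f - g|] is the difference of
    the two measures on that set up to sign, hence at most [tv]; this accounts for the factor 2. *)
Lemma L1close_min mu nu (e : R) : (mu [set: T] < +oo)%E -> (nu [set: T] < +oo)%E ->
  L1close mu nu e -> L1close mu nu (2 * tv mu nu).
Proof.
move=> muT nuT [rho [f [g [df dg H]]]]; exists rho, f, g; split => //.
have [mf [f0 df']] := df; have [mg [g0 dg']] := dg.
pose A := [set x | g x <= f x].
have mA : measurable A by rewrite -[A]setTI; exact: measurable_fun_le.
have i3 : rho.-integrable [set: T] (EFin \o (fun x => f x - g x)).
  have := integrableB measurableT (density_integrable muT df) (density_integrable nuT dg).
  by apply: eq_integrable.
have H2 B : measurable B -> (\int[rho]_(x in B) (f x - g x)%:E <= (tv mu nu)%:E)%E /\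
   (- (\int[rho]_(x in B) (f x - g x)%:E) <= (tv mu nu)%:E)%E.
  move=> mB; have iB : rho.-integrable B (EFin \o f).
    by apply: integrableS (density_integrable muT df).
  have iB' : rho.-integrable B (EFin \o g).
    by apply: integrableS (density_integrable nuT dg).
  have := tv_ub muT nuT mB.
  under eq_integral do rewrite EFinB.
  rewrite integralB_EFin // -df' // -dg' // ler_norml => /andP[h1 h2].
  have muB : mu B \is a fin_num.
    rewrite ge0_fin_numE //; apply: le_lt_trans muT; apply: le_measure; rewrite ?inE //.
  have nuB : nu B \is a fin_num.
    rewrite ge0_fin_numE //; apply: le_lt_trans nuT; apply: le_measure; rewrite ?inE //.
  rewrite -(fineK muB) -(fineK nuB) -EFinB -EFinN !lee_fin; split; lra.
have mabs : measurable_fun (A `|` ~` A) (fun x => (`|f x - g x|)%:E).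
  by rewrite setUv; apply/measurable_EFinP; apply: measurableT_comp => //; exact: measurable_funB.
have dA : [disjoint A & ~` A] by apply/disj_setPS; rewrite setICr.
rewrite -(setUv A) (@ge0_integral_setU _ _ _ rho A (~` A) mA (measurableC mA) _ mabs _ dA) //.
rewrite (_ : 2 * tv mu nu = tv mu nu + tv mu nu) ?EFinD; last by ring.
apply: leeD.
  rewrite (eq_integral (fun x => (f x - g x)%:E)); first by have [] := H2 A mA.
  by move=> x; rewrite inE /A /= => h; rewrite ger0_norm // subr_ge0.
rewrite (eq_integral (fun x => (- (f x - g x)%:E))%E); last first.
  move=> x; rewrite inE /A /= => /negP; rewrite -ltNge => h.
  by rewrite ltr0_norm // subr_lt0.
rewrite integralN; last first.
  apply: integrable_add_def; first exact: measurableC.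
  by apply: (integrableS measurableT (measurableC mA) (@subsetT _ _) i3).
by have [] := H2 (~` A) (measurableC mA).
Qed.

(** Write [phi0 f^r - phi g^r] as [(phi0 - phi) f^r + phi (f^r - g^r)]. The first summand is
    measured in L^(1/r)(mu), the second by total variation; the bound [M] is imposed on [phi], the
    vector at the varying point, while [phi0] may be unbounded. *)
Lemma L1close_Sr_close mu nu (e M A eps : R) phi0 phi : L1close mu nu e ->
  measurable_fun [set: T] phi0 -> measurable_fun [set: T] phi ->
  0 <= M -> (forall x, `|phi x| <= M) ->
  (\int[mu]_x (`|phi0 x - phi x| `^ r^-1)%:E <= A%:E)%E ->
  2 `^ r^-1 * (A + M `^ r^-1 * e) < eps `^ r^-1 -> Sr_close r mu phi0 nu phi eps.
Proof.
move=> [rho [f [g [df dg H]]]] m0 m1 M0 phiM HA He; exists rho, f, g; split => //; split => //.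
have [mf [f0 _]] := df; have [mg [g0 _]] := dg.
apply: (@le_lt_trans _ _ (2 `^ r^-1 * (A + M `^ r^-1 * e))%:E); last by rewrite lte_fin.
have q0 : 0 < r^-1 by rewrite invr_gt0.
have md : measurable_fun [set: T] (fun x => `|phi0 x - phi x| `^ r^-1).
  apply: (measurableT_comp (@measurable_powR R _)); apply: measurableT_comp => //.
  exact: measurable_funB.
have mabs : measurable_fun [set: T] (fun x => `|f x - g x|).
  by apply: measurableT_comp => //; exact: measurable_funB.
apply: (@le_trans _ _ (\int[rho]_x (2 `^ r^-1 * (`|phi0 x - phi x| `^ r^-1 * f x) +
   (2 `^ r^-1 * M `^ r^-1) * `|f x - g x|)%:E)%E).
  apply: ge0_le_integral => //.
  - apply/measurable_EFinP; apply: (measurableT_comp (@measurable_powR R _)).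
    apply: measurableT_comp => //; apply: measurable_funB; apply: measurable_funM => //;
    exact: (measurableT_comp (@measurable_powR R _)).
  - apply/measurable_EFinP; apply: measurable_funD; apply: measurable_funM => //.
    exact: measurable_funM.
  move=> x _; rewrite lee_fin -mulrA -mulrDr.
  apply: (@le_trans _ _ ((`|phi0 x - phi x| * f x `^ r + M * `|f x - g x| `^ r) `^ r^-1)).
    apply: ge0_ler_powR; rewrite ?nnegrE ?(ltW q0) //.
      by rewrite addr_ge0 // mulr_ge0 ?powR_ge0.
    rewrite (_ : _ - _ = (phi0 x - phi x) * f x `^ r + phi x * (f x `^ r - g x `^ r)); last by ring.
    apply: (le_trans (ler_normD _ _)); rewrite !normrM (ger0_norm (powR_ge0 _ _)).
    by rewrite lerD2l ler_pM // powR_dist.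
  apply: (le_trans (powR_add_le q0 _ _)); rewrite ?mulr_ge0 ?powR_ge0 //.
  by rewrite !powRM ?powR_ge0 // !powRrK.
rewrite ge0_integral_lincomb ?mulr_ge0 ?powR_ge0 //; last 2 first.
- by move=> x; rewrite mulr_ge0 ?powR_ge0.
- exact: measurable_funM.
rewrite mulrDr EFinD mulrA; apply: leeD.
  rewrite EFinM lee_pmul2l ?lte_fin ?powR_gt0 //.
  apply: le_trans HA; rewrite (@ge0_integral_density _ _ _ rho mu f (fun x => (`|phi0 x - phi x| `^ r^-1)%:E)) //.
  exact/measurable_EFinP.
by rewrite [leRHS]EFinM lee_wpmul2l // lee_fin mulr_ge0 ?powR_ge0.
Qed.

Lemma L1close_Sr_close0 mu nu (e eps : R) phi : L1close mu nu e ->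
  measurable_fun [set: T] phi ->
  (\int[nu]_x (`|phi x| `^ r^-1)%:E < (eps `^ r^-1)%:E)%E ->
  Sr_close r mu (fun=> 0) nu phi eps.
Proof.
move=> [rho [f [g [df dg H]]]] m1 He; exists rho, f, g; split => //; split => //.
have [mg [g0 _]] := dg.
apply: le_lt_trans He; rewrite (ge0_integral_density dg); last 2 first.
- by move=> x; rewrite lee_fin powR_ge0.
- apply/measurable_EFinP; apply: (measurableT_comp (@measurable_powR R _)).
  exact: measurableT_comp.
rewrite le_eqVlt; apply/orP; left; apply/eqP; apply: eq_integral => x _.
by rewrite mul0r sub0r normrN normrM powRM // (ger0_norm (powR_ge0 _ _)) powRrK.
Qed.

Lemma Mr_close_le mu nu (e e' : R) : 0 <= e -> e <= e' ->
  Mr_close r mu nu e -> Mr_close r mu nu e'.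
Proof.
move=> e0 ee' [rho [f [g [df [dg H]]]]]; exists rho, f, g; split => //; split => //.
apply: lt_le_trans H _; rewrite lee_fin ge0_ler_powR ?nnegrE ?invr_ge0 ?(ltW r0) //.
exact: le_trans ee'.
Qed.

End RootExponent.
End L1close.

Section LrFacts.
Context d (T : measurableType d) (R : realType).
Variable r : R.
Hypotheses (r0 : 0 < r) (r1 : r <= 1).
Implicit Types (mu nu : {measure set T -> \bar R}) (phi psi : T -> R).

Lemma rV_gt0 : 0 < r^-1. Proof. by rewrite invr_gt0. Qed.

Lemma rV_ge1 : 1 <= r^-1. Proof. by rewrite invf_ge1. Qed.

Lemma norm_le_powR (y q : R) : 1 <= q -> `|y| <= 1 + `|y| `^ q.
Proof.
move=> q1; have [y1|y1] := leP `|y| 1; first by rewrite (le_trans y1) // lerDl powR_ge0.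
by rewrite (le_trans (le1r_powR (ltW y1) q1)) // lerDr.
Qed.

Lemma measurable_norm_powR phi (q : R) : measurable_fun [set: T] phi ->
  measurable_fun [set: T] (fun x => `|phi x| `^ q).
Proof.
by move=> mphi; apply: (measurableT_comp (@measurable_powR R _)); exact: measurableT_comp.
Qed.

Lemma Lr_powR_integrable mu phi : Lr r mu phi ->
  mu.-integrable [set: T] (EFin \o (fun x => `|phi x| `^ r^-1)).
Proof.
move=> [mphi H]; apply/integrableP; split.
  by apply/measurable_EFinP; exact: measurable_norm_powR.
by under eq_integral do rewrite /= ger0_norm ?powR_ge0 //.
Qed.

Lemma Lr_integrable mu phi : (mu [set: T] < +oo)%E -> Lr r mu phi ->
  mu.-integrable [set: T] (EFin \o phi).
Proof.
move=> muT H; have [mphi _] := H.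
have i1 : mu.-integrable [set: T] (EFin \o (fun=> 1 : R)).
  by apply: (@bounded_integrable _ _ _ _ _ 1) => // x; rewrite normr1.
have := integrableD measurableT i1 (Lr_powR_integrable H).
apply: le_integrable => //; first exact/measurable_EFinP.
move=> x _ /=; rewrite lee_fin [leRHS]ger0_norm ?addr_ge0 ?powR_ge0 //.
exact: norm_le_powR rV_ge1.
Qed.

Lemma Lr_dominated mu phi psi : measurable_fun [set: T] psi ->
  (forall x, `|psi x| <= `|phi x|) -> Lr r mu phi -> Lr r mu psi.
Proof.
move=> mpsi le [mphi H]; split; first exact: mpsi.
refine (le_lt_trans _ H).
apply: ge0_le_integral => //; try (apply/measurable_EFinP; exact: measurable_norm_powR).
move=> x _; rewrite lee_fin; apply: ge0_ler_powR; rewrite ?nnegrE // ltW //.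
exact: rV_gt0.
Qed.

Lemma Lr_bounded mu phi (M : R) : (mu [set: T] < +oo)%E -> measurable_fun [set: T] phi ->
  (forall x, `|phi x| <= M) -> Lr r mu phi.
Proof.
move=> muT mphi phiM; split => //.
apply: (@le_lt_trans _ _ (\int[mu]_x (M `^ r^-1)%:E)%E).
  apply: ge0_le_integral => //; first by apply/measurable_EFinP; exact: measurable_norm_powR.
  move=> x _; rewrite lee_fin; apply: ge0_ler_powR; rewrite ?nnegrE ?(ltW rV_gt0) //.
  by rewrite (le_trans _ (phiM x)).
by rewrite integral_cst // lte_mul_pinfty // lee_fin powR_ge0.
Qed.

Lemma LrB mu phi psi : Lr r mu phi -> Lr r mu psi -> Lr r mu (fun x => phi x - psi x).
Proof.
move=> [mphi H] [mpsi H']; split; first exact: measurable_funB.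
have q0 := rV_gt0.
apply: (@le_lt_trans _ _ (\int[mu]_x (2 `^ r^-1 * `|phi x| `^ r^-1 + 2 `^ r^-1 * `|psi x| `^ r^-1)%:E)%E).
  apply: ge0_le_integral => //.
  - by apply/measurable_EFinP; apply: measurable_norm_powR; exact: measurable_funB.
  - by apply/measurable_EFinP; apply: measurable_funD; apply: measurable_funM => //; exact: measurable_norm_powR.
  - move=> x _; rewrite lee_fin -mulrDr; apply: le_trans (powR_add_le q0 _ _) => //.
    apply: ge0_ler_powR; rewrite ?nnegrE ?(ltW q0) ?addr_ge0 //.
    by rewrite (le_trans (ler_normB _ _)).
rewrite ge0_integral_lincomb ?powR_ge0 //; try exact: measurable_norm_powR.
apply: lte_add_pinfty; apply: lte_mul_pinfty; rewrite ?lee_fin ?powR_ge0; [exact: isT|exact: isT|exact: H|exact: isT|exact: isT|exact: H'].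
Qed.

End LrFacts.

(** * Continuity of tensor fields along fields of tangent vectors *)

Section TensorField.
Context d (T : measurableType d) (R : realType).
Variables (r : R) (n : nat).
Hypotheses (r0 : 0 < r) (r1 : r <= 1).
(* [cen] is false for M^r, and true for P^r, where tangent vectors have mean 0. *)
Variables (Pt : Type) (pt : Pt -> {measure set T -> \bar R}).
Variables (tang : Pt -> (T -> R) -> Prop) (cen : bool).
Hypothesis ptfin : forall p, (pt p [set: T] < +oo)%E.
Hypothesis pt1 : cen -> forall p, fine (pt p [set: T]) = 1.
Hypothesis tangE : forall p phi,
  tang p phi <-> Lr r (pt p) phi /\ (cen -> \int[pt p]_x phi x = 0).
Implicit Types (phi psi : T -> R) (X : Pt -> T -> R).

Definition mean p phi : R := if cen then \int[pt p]_x phi x else 0.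
(** The projection of L^(1/r) onto the tangent space: the identity for [M^r], subtraction of the
    mean for [P^r]. *)
Definition ctr p phi : T -> R := fun x => phi x - mean p phi.

Lemma Lr_cst p (c : R) : Lr r (pt p) (fun=> c).
Proof. exact: (@Lr_bounded _ _ _ _ r0 _ _ `|c|). Qed.

Lemma tang_ctr p phi : Lr r (pt p) phi -> tang p (ctr p phi).
Proof.
move=> H; apply/tangE; split; first exact: LrB (Lr_cst _ _).
move=> c1; rewrite /ctr /mean c1 RintegralB //.
- by rewrite Rintegral_cst // pt1 // mulr1 subrr.
- exact: Lr_integrable H.
- exact: Lr_integrable (Lr_cst _ _).
Qed.

Lemma ctr_tang p phi : tang p phi -> ctr p phi = phi.
Proof.
move=> /tangE[_ H]; apply/funext => x; rewrite /ctr /mean.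
by case: ifP => [/H ->|_]; rewrite subr0.
Qed.

Lemma mean_le p phi (M : R) : 0 <= M -> measurable_fun [set: T] phi ->
  (forall x, `|phi x| <= M) -> `|mean p phi| <= M.
Proof.
move=> M0 mphi phiM; rewrite /mean; case: ifP => c1; last by rewrite normr0.
have i := bounded_integrable (ptfin p) mphi phiM.
apply: (le_trans (le_normr_Rintegral _ i)) => //.
rewrite -[leRHS]mulr1 -(pt1 c1 p) -Rintegral_cst //; apply: le_Rintegral => //.
- exact: integrable_norm.
- by apply: (bounded_integrable (ptfin p)) => // x; rewrite ger0_norm.
Qed.

Definition Lcvg (p_ : nat -> Pt) p0 :=
  forall e : R, 0 < e -> \forall k \near \oo, L1close (pt p0) (pt (p_ k)) e.

Definition field_cvg X (p_ : nat -> Pt) p0 :=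
  forall eps : R, 0 < eps -> \forall k \near \oo,
    Sr_close r (pt p0) (X p0) (pt (p_ k)) (X (p_ k)) eps.

Lemma Lcvg_fine p_ p0 A : Lcvg p_ p0 -> measurable A ->
  fine (pt (p_ k) A) @[k --> \oo] --> fine (pt p0 A).
Proof.
move=> H mA; apply/cvgrPdist_le => e e0; near=> k.
by apply: L1close_set => //; near: k; exact: H.
Unshelve. all: by end_near.
Qed.

Lemma field_cvg_unif (Y : Pt -> T -> R) (M : R) p_ p0 : Lcvg p_ p0 ->
  (forall p, measurable_fun [set: T] (Y p)) -> (forall x, `|Y p0 x| <= M) ->
  (forall e : R, 0 < e -> \forall k \near \oo, forall x, `|Y (p_ k) x - Y p0 x| <= e) ->
  field_cvg (fun p => ctr p (Y p)) p_ p0.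
Proof.
move=> pp mY YM Yu eps eps0.
have M0 : 0 <= M := le_trans (normr_ge0 _) (YM point).
have q0 := rV_gt0 r0; have q1 := rV_ge1 r0 r1.
pose m := fine (pt p0 [set: T]); have m0 : 0 <= m by rewrite fine_ge0.
(* The coefficients move by at most [e] and their means by at most [e + M * e], in all [e * c]; the
   centred coefficients are bounded by [2 * (M + 1)]. *)
pose c := 2 + M; have c0 : 0 < c by rewrite /c ltr_pwDl.
pose K := (2 * (M + 1)) `^ r^-1; have K0 : 0 <= K by exact: powR_ge0.
pose D := 2 `^ r^-1 * (c * m + K) + 1.
have D0 : 0 < D by rewrite ltr_wpDl // mulr_ge0 ?powR_ge0 // addr_ge0 // mulr_ge0 // ltW.
pose e := Num.min 1 (Num.min c^-1 (eps `^ r^-1 / D)).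
have e0 : 0 < e by rewrite !lt_min ltr01 invr_gt0 c0 divr_gt0 // powR_gt0.
have e1 : e <= 1 by rewrite ge_min lexx.
have ec : e * c <= 1 by rewrite -ler_pdivlMr // mul1r !ge_min lexx orbT.
have eD : e * D <= eps `^ r^-1 by rewrite -ler_pdivlMr // !ge_min lexx !orbT.
near=> k.
have L1 : L1close (pt p0) (pt (p_ k)) e by near: k; exact: pp.
have Yk : forall x, `|Y (p_ k) x - Y p0 x| <= e by near: k; exact: Yu.
have YkM x : `|Y (p_ k) x| <= M + 1.
  have := ler_normD (Y (p_ k) x - Y p0 x) (Y p0 x); rewrite subrK.
  move=> /le_trans; apply; rewrite addrC lerD //; exact: le_trans (Yk x) e1.
have M10 : 0 <= M + 1 by rewrite addr_ge0.
have mk : `|mean p0 (Y p0) - mean (p_ k) (Y (p_ k))| <= e + M * e.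
  rewrite /mean; case: ifP => c1; last first.
    by rewrite subrr normr0 addr_ge0 ?mulr_ge0 ?(ltW e0).
  have i1 := bounded_integrable (ptfin (p_ k)) (mY p0) YM.
  have i2 := bounded_integrable (ptfin (p_ k)) (mY (p_ k)) YkM.
  rewrite (_ : _ - _ = (\int[pt p0]_x Y p0 x - \int[pt (p_ k)]_x Y p0 x) - (\int[pt (p_ k)]_x Y (p_ k) x - \int[pt (p_ k)]_x Y p0 x)); last by ring.
  apply: (le_trans (ler_normB _ _)); rewrite addrC; apply: lerD; last first.
    exact: L1close_Rintegral L1 _ _ _.
  rewrite -RintegralB //.
  have -> : \int[pt (p_ k)]_x (Y (p_ k) x - Y p0 x) = mean (p_ k) (fun x => Y (p_ k) x - Y p0 x).
    by rewrite /mean c1.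
  by apply: mean_le => //; [exact: ltW|exact: measurable_funB].
have mc p : measurable_fun [set: T] (ctr p (Y p)) by apply: measurable_funB.
apply: (@L1close_Sr_close _ _ _ _ r0 r1 _ _ e (2 * (M + 1)) (e * c * m) eps _ _ L1) => //.
- by rewrite mulr_ge0.
- move=> x; apply: (le_trans (ler_normB _ _)).
  have := mean_le (p_ k) M10 (mY (p_ k)) YkM; have := YkM x; lra.
- apply: (@le_trans _ _ (\int[pt p0]_x (e * c)%:E)%E); last first.
    by rewrite integral_cst // [leRHS]EFinM /m fineK // ge0_fin_numE.
  apply: ge0_le_integral => //.
    by apply/measurable_EFinP; apply: measurable_norm_powR; exact: measurable_funB.
  move=> x _; rewrite lee_fin.
  have b1 : `|ctr p0 (Y p0) x - ctr (p_ k) (Y (p_ k)) x| <= e * c.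
    rewrite /ctr (_ : _ - _ = (- (Y (p_ k) x - Y p0 x)) - (mean p0 (Y p0) - mean (p_ k) (Y (p_ k)))); last by ring.
    apply: (le_trans (ler_normB _ _)); rewrite normrN.
    have := Yk x; move: mk; rewrite /c; lra.
  apply: (@le_trans _ _ ((e * c) `^ r^-1)).
    by apply: ge0_ler_powR; rewrite ?nnegrE ?(ltW q0) // mulr_ge0 // ltW.
  by apply: ge1r_powR => //; rewrite mulr_gt0.
- apply: lt_le_trans eD; rewrite /D -/K.
  rewrite (_ : 2 `^ r^-1 * _ = e * (2 `^ r^-1 * (c * m + K))); last by ring.
  by rewrite ltr_pM2l // ltrDl.
Unshelve. all: by end_near.
Qed.

Variable Theta : Pt -> ('I_n -> T -> R) -> R.
Hypothesis tf : is_tensor_field r pt tang Theta.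

(** Tensor fields ask for continuity of the vector fields in epsilon-delta form. If that failed for
    some epsilon, the radii 1/(k+1) would yield a sequence converging in total variation along which
    the field does not converge; so sequences suffice. *)
Lemma tensor_seq (X : 'I_n -> Pt -> T -> R) :
  (forall j p, tang p (X j p)) ->
  (forall j p0 p_, Lcvg p_ p0 -> field_cvg (X j) p_ p0) ->
  forall p0 p_, Lcvg p_ p0 ->
    Theta (p_ k) (fun j => X j (p_ k)) @[k --> \oo] --> Theta p0 (fun j => X j p0).
Proof.
move=> tX cX p0 p_ pp.
have [_ _ cont] := tf.
have H : forall j q0 eps, 0 < eps -> exists2 delta, 0 < delta &
    forall p, Mr_close r (pt q0) (pt p) delta ->
      Sr_close r (pt q0) (X j q0) (pt p) (X j p) eps.
  move=> j q0 eps eps0; apply: contrapT => /forall2NP N.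
  have N' (k : nat) : exists p, Mr_close r (pt q0) (pt p) k.+1%:R^-1 /\
      ~ Sr_close r (pt q0) (X j q0) (pt p) (X j p) eps.
    have [|/existsNP[p /not_implyP[h1 h2]]] := N k.+1%:R^-1; first by rewrite invr_gt0.
    by exists p.
  have [p' p'H] := choice N'.
  have L : Lcvg p' q0.
    move=> e e0; have [delta delta0 Hd] := Mr_close_L1close r0 r1 (ptfin q0) e0.
    near=> k; apply: Hd; have [h _] := p'H k; apply: Mr_close_le h => //.
    rewrite -[leRHS]invrK lef_pV2 ?posrE ?invr_gt0 //.
    near: k; exists (Num.truncn delta^-1) => // k /= hk.
    by apply: le_trans (ltW (truncnS_gt _)) _; rewrite ler_nat ltnS.
  have [N0 _ HN] := cX j q0 p' L eps eps0.
  by have [_] := p'H N0; apply; apply: HN => /=.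
apply/cvgrPdist_lt => eps eps0.
have [delta delta0 Hd] := cont X tX H p0 eps eps0.
near=> k; rewrite distrC; apply: Hd.
apply: (@L1close_Mr_close _ _ _ r r0 r1 _ _ (delta `^ r^-1 / 2)).
  by near: k; apply: pp; rewrite divr_gt0 // powR_gt0.
by rewrite ltr_pdivrMr // ltr_pMr ?powR_gt0 // ltr1n.
Unshelve. all: by end_near.
Qed.

(** Extends [Theta] from tangent vectors to all of L^(1/r), so that functions with nonzero mean can
    be inserted in the case of [P^r] as well. *)
Definition Thetac p (f : 'I_n -> T -> R) : R := Theta p (fun j => ctr p (f j)).

Lemma Thetac_tang p f : (forall j, tang p (f j)) -> Thetac p f = Theta p f.
Proof. by move=> tf'; congr Theta; apply/funext => j; exact: ctr_tang. Qed.

Lemma Thetac_cvg (f : 'I_n -> T -> R) (M : R) p0 p_ : Lcvg p_ p0 ->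
  (forall j, measurable_fun [set: T] (f j)) -> (forall j x, `|f j x| <= M) ->
  Thetac (p_ k) f @[k --> \oo] --> Thetac p0 f.
Proof.
move=> pp mf fM; apply: (tensor_seq (X := fun j p => ctr p (f j))) => //.
  by move=> j p; apply: tang_ctr; apply: Lr_bounded (fM j).
move=> j q0 q_ qq; apply: (@field_cvg_unif (fun=> f j) M) => //.
move=> e e0; near=> k => x; by rewrite subrr normr0 ltW.
Unshelve. all: by end_near.
Qed.

End TensorField.

Lemma cvg_powR_pos (R : realType) (s a : R) (u_ : nat -> R) : 0 < a ->
  u_ k @[k --> \oo] --> a -> u_ k `^ s @[k --> \oo] --> a `^ s.
Proof.
move=> a0 ua.
have D : derivable (fun x : R => x `^ s) a 1.
  by apply: derivable_powR; rewrite in_itv /= a0.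
have c : {for a, continuous (fun x : R => x `^ s)}.
  exact/differentiable_continuous/derivable1_diffP.
exact: (@cvg_comp _ _ _ u_ (fun x : R => x `^ s) _ _ _ ua c).
Qed.

(** * A continuous field that is unbounded on a shrinking set *)

Section BlowUpField.
Context d (T : measurableType d) (R : realType).
Variable r : R.
Hypotheses (r0 : 0 < r) (r1 : r <= 1).
Variables (Pt : Type) (pt : Pt -> {measure set T -> \bar R}).
Variable cen : bool.
Hypothesis ptfin : forall p, (pt p [set: T] < +oo)%E.
Hypothesis pt1 : cen -> forall p, fine (pt p [set: T]) = 1.
Variables (A : set T) (u : T -> R) (Mu s : R).
Hypotheses (mA : measurable A) (mu_ : measurable_fun [set: T] u).
Hypothesis uM : forall x, `|u x| <= Mu.
Hypothesis uA : forall x, ~ A x -> u x = 0.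
Hypotheses (s0 : 0 < s) (sr : s < r).

(* The value 0 `^ (- s) is 0, so the field vanishes where A has no mass. *)
Definition blowup (p : Pt) : T -> R := fun x => fine (pt p A) `^ (- s) * u x.

Lemma measurable_blowup p : measurable_fun [set: T] (blowup p).
Proof. exact: measurable_funM. Qed.

Let Mu0 : 0 <= Mu := le_trans (normr_ge0 _) (uM point).

Lemma blowup_le p x : `|blowup p x| <= fine (pt p A) `^ (- s) * Mu.
Proof. by rewrite normrM (ger0_norm (powR_ge0 _ _)) ler_wpM2l ?powR_ge0. Qed.

Lemma blowup_null p : fine (pt p A) = 0 -> ctr pt cen p (blowup p) = fun=> 0.
Proof.
move=> q0; have b0 : blowup p = fun=> 0.
  by apply/funext => x; rewrite /blowup q0 powR0 ?mul0r // oppr_eq0 gt_eqF.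
by apply/funext => x; rewrite /ctr b0 /mean Rintegral_cst // mul0r if_same subr0.
Qed.

(** The field is at most [q^(-s) Mu] on [A], a set of mass [q], and 0 elsewhere, which gives the
    exponent [1 - s / r], positive because [s < r]. The mean is of order [q^(1 - s)], and its power
    1/r is at most of order [q^(1 - s / r)] because [q <= 1]. *)
Lemma blowup_small p : fine (pt p A) <= 1 ->
  (\int[pt p]_x (`|ctr pt cen p (blowup p) x| `^ r^-1)%:E <=
   (2 `^ r^-1 * 2 * Mu `^ r^-1 * fine (pt p A) `^ (1 - s / r))%:E)%E.
Proof.
set q := fine (pt p A) => q1.
have q0 : 0 <= q by rewrite fine_ge0.
have rV := rV_gt0 r0.
have sr' : 0 < 1 - s / r by rewrite subr_gt0 ltr_pdivrMr // mul1r.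
have [qz|qp] := eqVneq q 0.
  rewrite blowup_null // normr0 powR0 ?gt_eqF // integral0.
  by rewrite lee_fin !mulr_ge0 ?powR_ge0.
have qpos : 0 < q by rewrite lt_neqAle eq_sym qp.
have [mb bb] := (measurable_blowup p, blowup_le p).
have pAE : pt p A = q%:E.
  rewrite /q fineK // ge0_fin_numE //; apply: le_lt_trans (ptfin p).
  by apply: le_measure; rewrite ?inE.
have bA x : `|blowup p x| <= q `^ (- s) * Mu * \1_A x.
  have [xA|xA] := pselect (A x); first by rewrite indicE mem_set // mulr1.
  by rewrite /blowup uA // mulr0 normr0 indicE memNset // mulr0.
have i1 : (\int[pt p]_x (`|blowup p x| `^ r^-1)%:E <= (Mu `^ r^-1 * q `^ (1 - s / r))%:E)%E.
  apply: (@le_trans _ _ (\int[pt p]_x (((q `^ (- s) * Mu) `^ r^-1)%:E * (\1_A x)%:E))%E).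
    apply: ge0_le_integral => //.
    - by apply/measurable_EFinP; exact: measurable_norm_powR.
    - by apply: measurable_funeM; exact/measurable_EFinP.
    move=> x _; rewrite -EFinM lee_fin.
    apply: (@le_trans _ _ ((q `^ (- s) * Mu * \1_A x) `^ r^-1)).
      by apply: ge0_ler_powR; rewrite ?nnegrE ?(ltW rV) ?mulr_ge0 ?powR_ge0.
    rewrite [leLHS]powRM ?mulr_ge0 ?powR_ge0 // ler_wpM2l ?powR_ge0 //.
    by rewrite indicE; case: (x \in A); rewrite ?powR1 // powR0 // gt_eqF.
  rewrite ge0_integralZl_EFin ?powR_ge0 //; last exact/measurable_EFinP.
  rewrite integral_indic // setIT pAE -EFinM lee_fin powRM ?powR_ge0 //.
  rewrite -powRrM mulrAC [leLHS]mulrC -[X in _ * (_ * X)]powRr1 //.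
  rewrite -powRD; last by rewrite qp implybT.
  by rewrite mulNr addrC.
have i2 : (\int[pt p]_x (`|mean pt cen p (blowup p)| `^ r^-1)%:E <= (Mu `^ r^-1 * q `^ (1 - s / r))%:E)%E.
  rewrite integral_cst // /mean; case: ifP => c1; last first.
    by rewrite normr0 powR0 ?gt_eqF // mul0e lee_fin mulr_ge0 ?powR_ge0.
  rewrite -[pt p [set: T]]fineK ?ge0_fin_numE // pt1 // mule1 lee_fin.
  have ib := bounded_integrable (ptfin p) mb bb.
  have b1 : `|\int[pt p]_x blowup p x| <= Mu * q `^ (1 - s).
    apply: (le_trans (le_normr_Rintegral _ ib)) => //.
    apply: (@le_trans _ _ (\int[pt p]_x (q `^ (- s) * Mu * \1_A x))).
      apply: le_Rintegral => //; first exact: integrable_norm.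
      apply: (@bounded_integrable _ _ _ _ _ (q `^ (- s) * Mu)) => //.
        by apply: measurable_funM.
      move=> x; rewrite indicE; case: (x \in A).
        by rewrite mulr1 ger0_norm // mulr_ge0 ?powR_ge0.
      by rewrite mulr0 normr0 mulr_ge0 ?powR_ge0.
    rewrite RintegralZl //; last first.
      apply: (@bounded_integrable _ _ _ _ _ 1) => // x.
      by rewrite indicE; case: (x \in A); rewrite ?normr1 ?normr0.
    rewrite /Rintegral integral_indic // setIT -/q mulrAC [leLHS]mulrC.
    rewrite -[X in _ * (_ * X)]powRr1 // -powRD; last by rewrite qp implybT.
    by rewrite addrC.
  apply: (@le_trans _ _ ((Mu * q `^ (1 - s)) `^ r^-1)).
    by apply: ge0_ler_powR; rewrite ?nnegrE ?(ltW rV) ?mulr_ge0 ?powR_ge0.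
  rewrite powRM ?powR_ge0 // ler_wpM2l ?powR_ge0 // -powRrM.
  apply: ger_powR; first by rewrite qpos q1.
  by rewrite mulrBl mul1r lerD2r rV_ge1.
apply: (@le_trans _ _ (\int[pt p]_x (2 `^ r^-1 * `|blowup p x| `^ r^-1 +
   2 `^ r^-1 * `|mean pt cen p (blowup p)| `^ r^-1)%:E)%E).
  apply: ge0_le_integral => //.
  - by apply/measurable_EFinP; apply: measurable_norm_powR; exact: measurable_funB.
  - apply/measurable_EFinP; apply: measurable_funD => //; apply: measurable_funM => //.
    exact: measurable_norm_powR.
  move=> x _; rewrite lee_fin -mulrDr; apply: le_trans (powR_add_le rV _ _) => //.
  apply: ge0_ler_powR; rewrite ?nnegrE ?(ltW rV) ?addr_ge0 //.
  by rewrite (le_trans (ler_normB _ _)).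
rewrite ge0_integral_lincomb ?powR_ge0 //; last exact: measurable_norm_powR.
rewrite (_ : _ * _ * _ * _ = 2 `^ r^-1 * (Mu `^ r^-1 * q `^ (1 - s / r)) +
  2 `^ r^-1 * (Mu `^ r^-1 * q `^ (1 - s / r))); last by ring.
rewrite [leRHS]EFinD !(EFinM (2 `^ r^-1) (_ * _)).
apply: leeD; apply: lee_wpmul2l;
  [by rewrite lee_fin powR_ge0|exact: i1|by rewrite lee_fin powR_ge0|exact: i2].
Qed.

(** Continuity is required at all points. Where [A] is null the field tends to 0 by the bound above;
    where [A] has mass, the factor [q^(-s)] is continuous and the field converges uniformly. *)
Lemma blowup_cvg p0 p_ : Lcvg pt p_ p0 ->
  field_cvg r pt (fun p => ctr pt cen p (blowup p)) p_ p0.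
Proof.
move=> pp; have qq := Lcvg_fine ptfin pp mA.
have [qz|qp] := eqVneq (fine (pt p0 A)) 0; last first.
  have qpos : 0 < fine (pt p0 A) by rewrite lt_neqAle eq_sym qp fine_ge0.
  apply: (@field_cvg_unif _ _ _ _ r0 r1 _ _ _ ptfin pt1 blowup _ _ _ pp measurable_blowup (blowup_le p0)).
  move=> e e0; have /cvgrPdist_le := cvg_powR_pos (s := - s) qpos qq.
  move=> /(_ (e / (Mu + 1))); rewrite divr_gt0 ?ltr_wpDl // => /(_ isT).
  apply: filterS => k hk x; rewrite /blowup -mulrBl normrM distrC.
  apply: (@le_trans _ _ (e / (Mu + 1) * (Mu + 1))); last by rewrite divfK // gt_eqF // ltr_wpDl.
  by apply: ler_pM => //; rewrite (le_trans (uM x)) // lerDl.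
move=> eps eps0.
have rV := rV_gt0 r0.
have sr' : 0 < 1 - s / r by rewrite subr_gt0 ltr_pdivrMr // mul1r.
pose K := 2 `^ r^-1 * 2 * Mu `^ r^-1 + 1.
have K0 : 0 < K by rewrite ltr_wpDl // !mulr_ge0 ?powR_ge0.
pose t := Num.min 1 ((eps `^ r^-1 / K) `^ (1 - s / r)^-1).
have t0 : 0 < t by rewrite lt_min ltr01 powR_gt0 // divr_gt0 // powR_gt0.
near=> k.
have qt : fine (pt (p_ k) A) < t.
  near: k; move/cvgrPdist_lt: qq => /(_ t t0); apply: filterS => k.
  by rewrite qz sub0r normrN ger0_norm // fine_ge0.
have L1 : L1close (pt p0) (pt (p_ k)) 1 by near: k; exact: pp.
rewrite (blowup_null qz).
apply: (L1close_Sr_close0 r0 L1); first by apply: measurable_funB => //; exact: measurable_blowup.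
apply: (le_lt_trans (blowup_small _)).
  by apply: ltW (lt_le_trans qt _); rewrite ge_min lexx.
have qb : fine (pt (p_ k) A) `^ (1 - s / r) <= eps `^ r^-1 / K.
  rewrite -[leRHS](powRVK sr') ?divr_ge0 ?powR_ge0 ?(ltW K0) //.
  apply: ge0_ler_powR; rewrite ?nnegrE ?(ltW sr') ?powR_ge0 ?fine_ge0 //.
  by apply: ltW (lt_le_trans qt _); rewrite ge_min lexx orbT.
rewrite lte_fin; apply: (@le_lt_trans _ _ (2 `^ r^-1 * 2 * Mu `^ r^-1 * (eps `^ r^-1 / K))).
  by rewrite ler_wpM2l // !mulr_ge0 ?powR_ge0.
rewrite mulrA ltr_pdivrMr // mulrC ltr_pM2l ?powR_gt0 // /K ltrDl //.
Unshelve. all: by end_near.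
Qed.

End BlowUpField.

(* A finite type with all its subsets measurable; the point x0 is only there
   because measurable types are pointed. *)
Definition disc (I : finType) (x0 : I) : Type := I.

Section Disc.
Variables (I : finType) (x0 : I).
HB.instance Definition _ := Finite.on (disc x0).
HB.instance Definition _ := isPointed.Build (disc x0) x0.
HB.instance Definition _ := @isMeasurable.Build default_measure_display
  (disc x0) discrete_measurable discrete_measurable0
  discrete_measurableC discrete_measurableU.

Lemma disc_finite_discrete : finite_discrete (disc x0).
Proof. by split=> //; exact: (@finite_finset I). Qed.

Lemma measurable_fun_disc d' (T' : measurableType d') (f : T' -> disc x0) :
  (forall i, measurable (f @^-1` [set i])) -> measurable_fun [set: T'] f.
Proof.
move=> mf _ A _; rewrite setTI.
have -> : f @^-1` A = \big[setU/set0]_(i <- enum I | i \in A) (f @^-1` [set i]).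
  rewrite -bigcup_seq_cond; apply/seteqP; split => x /=.
    by move=> Ax; exists (f x) => //=; apply/andP; split; [rewrite mem_enum|exact/mem_set].
  by move=> [i /= /andP[_ /set_mem iA] ->].
by apply: bigsetU_measurable.
Qed.

Variable R : realType.

Lemma disc_Rintegral (m : {measure set (disc x0) -> \bar R}) (g : I -> R) (A : set (disc x0)) :
  (m [set: disc x0] < +oo)%E ->
  (\int[m]_(x in A) (g x)%:E)%E = (\sum_(x : I | (x : disc x0) \in A) g x * fine (m [set (x : disc x0)]))%:E.
Proof.
move=> mT; rewrite integral_mkcond.
have fin x : m [set x] \is a fin_num.
  by rewrite ge0_fin_numE //; apply: le_lt_trans mT; apply: le_measure; rewrite ?inE.
rewrite (eq_integral (fun x => \sum_(y : I | (y : disc x0) \in A) (g y)%:E * (\1_[set (y : disc x0)] x)%:E)%E); last first.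
  move=> x _; rewrite patchE; case: ifPn => xA; last first.
    rewrite big1 // => y yA; rewrite indicE memNset ?mule0 // => xy.
    by move: xA; rewrite xy yA.
  rewrite (bigD1 (x : I)) //= indicE mem_set // mule1 big1 ?adde0 // => y /andP[_ yx].
  by rewrite indicE memNset ?mule0 //= => xy; rewrite xy eqxx in yx.
have ii (y : disc x0) : m.-integrable [set: disc x0] (EFin \o \1_[set y]).
  apply: (@bounded_integrable _ _ _ _ _ 1) => // x.
  by rewrite indicE; case: (_ \in _); rewrite ?normr1 ?normr0.
rewrite integral_sum //; last by move=> y; apply: integrableZl => //; exact: ii.
rewrite -sumEFin; apply: eq_bigr => y _.
by rewrite integralZl ?integral_indic ?setIT ?EFinM ?fineK //; exact: ii.
Qed.

End Disc.

(** * Conditioning on the fibres of a map to a finite set *)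

Section FibreKernel.
Context d (T : measurableType d) (R : realType) (mu : {measure set T -> \bar R}).
Variables (I : finType) (x0 : I) (kappa : T -> disc x0).
Hypothesis muT : (mu [set: T] < +oo)%E.
Hypothesis mk : measurable_fun [set: T] kappa.
Hypothesis pos : forall i, 0 < fine (mu (kappa @^-1` [set i])).

Let mfib i : measurable (kappa @^-1` [set i]).
Proof. by rewrite -[X in measurable X]setTI; apply: mk. Qed.

(** The conditional distribution of [mu] given [kappa = i]. It is carried by the fibre over [i], so
    [kappa] itself shows that the kernel is congruent. *)
Definition fibre_kernel (i : disc x0) : {measure set T -> \bar R} :=
  mscale (NngNum (ltW (eqbRL (invr_gt0 _) (pos i)))) (mrestr mu (mfib i)).

Let mfibre U : measurable U -> measurable_fun [set: disc x0] (fibre_kernel ^~ U).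
Proof. by []. Qed.

HB.instance Definition _ := isKernel.Build _ _ (disc x0) T R fibre_kernel mfibre.

Lemma fibre_kernelE i A : measurable A ->
  fibre_kernel i A = (fine (mu (A `&` kappa @^-1` [set i])) / fine (mu (kappa @^-1` [set i])))%:E.
Proof.
move=> mA; rewrite /fibre_kernel /= /mscale /mrestr /= mulrC EFinM fineK //.
rewrite ge0_fin_numE //; apply: le_lt_trans muT; apply: le_measure; rewrite ?inE //.
exact: measurableI.
Qed.

Let fibre1 i : fibre_kernel i [set: T] = 1%E.
Proof. by rewrite fibre_kernelE // setTI divff // gt_eqF. Qed.

HB.instance Definition _ :=
  Kernel_isProbability.Build _ _ (disc x0) T R fibre_kernel fibre1.

Lemma fibre_kernel_congruent : congruent (fibre_kernel : R.-pker (disc x0) ~> T).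
Proof.
exists kappa; split => // w A mA /=.
rewrite fibre_kernelE; last by rewrite -[X in measurable X]setTI; exact: mk.
have [wA|wA] := pselect (A w).
  rewrite diracE mem_set // (_ : _ `&` _ = kappa @^-1` [set w]) ?divff ?gt_eqF //.
  by apply/seteqP; split => [x [] //|x /= xw]; split => //=; rewrite xw.
rewrite diracE memNset // (_ : _ `&` _ = set0) ?measure0 ?mul0r //.
by apply/seteqP; split => [x /= [Ax xw]|//]; apply: wA; rewrite -xw.
Qed.

Lemma fibre_kernel_exists : exists2 K : R.-pker (disc x0) ~> T, congruent K &
  forall i A, measurable A -> K i A =
    (fine (mu (A `&` kappa @^-1` [set i])) / fine (mu (kappa @^-1` [set i])))%:E.
Proof.
by exists fibre_kernel; [exact: fibre_kernel_congruent|exact: fibre_kernelE].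
Qed.

Lemma sum_fibres (g : I -> R) A : measurable A ->
  (\int[mu]_(x in A) (g (kappa x))%:E =
   (\sum_i g i * fine (mu (A `&` kappa @^-1` [set i])))%:E)%E.
Proof.
move=> mA; rewrite integral_mkcond.
have fin i : mu (A `&` kappa @^-1` [set i]) \is a fin_num.
  rewrite ge0_fin_numE //; apply: le_lt_trans muT; apply: le_measure; rewrite ?inE //.
  exact: measurableI.
have mAi i : measurable (A `&` kappa @^-1` [set i]) by exact: measurableI.
rewrite (eq_integral (fun x => \sum_i (g i)%:E * (\1_(A `&` kappa @^-1` [set i]) x)%:E)%E); last first.
  move=> x _; rewrite patchE; case: ifPn => [/set_mem xA|xA]; last first.
    rewrite big1 // => y _; rewrite indicE memNset ?mule0 // => -[xA' _].
    by rewrite mem_set in xA.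
  rewrite (bigD1 (kappa x : I)) //= indicE mem_set // mule1 big1 ?adde0 // => y yx.
  by rewrite indicE memNset ?mule0 //= => -[_ xy]; rewrite xy eqxx in yx.
have ii i : mu.-integrable [set: T] (EFin \o \1_(A `&` kappa @^-1` [set i])).
  apply: (@bounded_integrable _ _ _ _ _ 1) => // x.
  by rewrite indicE; case: (_ \in _); rewrite ?normr1 ?normr0.
rewrite integral_sum //; last by move=> y; apply: integrableZl => //; exact: ii.
rewrite -sumEFin; apply: eq_bigr => y _.
by rewrite integralZl ?integral_indic ?setIT ?EFinM ?fineK //; exact: ii.
Qed.

End FibreKernel.

Section DiscMeasure.
Variables (R : realType) (I : finType) (x0 : I).

(** The absolute values make this a measure for every [p]; for nonnegative weights they change
    nothing. *)
Definition disc_measure (p : I -> R) : {measure set (disc x0) -> \bar R} :=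
  msum (fun k => mscale (NngNum (normr_ge0 (p (nth x0 (enum I) k))))
                        (\d_(nth x0 (enum I) k : disc x0))) #|I|.

Lemma disc_measureE p A : (forall x, 0 <= p x) ->
  disc_measure p A = (\sum_(x : I | (x : disc x0) \in A) p x)%:E.
Proof.
move=> p0.
have -> : disc_measure p A = (\sum_(k < #|I|) (p (nth x0 (enum I) k) *
    ((nth x0 (enum I) k : disc x0) \in A)%:R)%:E)%E.
  apply: eq_bigr => k _ /=; rewrite /mscale /= diracE -[X in _ = (X * _)%:E]ger0_norm //.
rewrite sumEFin; congr EFin; rewrite [RHS]big_mkcond /=.
rewrite [RHS](reindex (@enum_val I I)) /=; last exact: onW_bij (enum_val_bij I).
apply: eq_bigr => k _; rewrite (enum_val_nth x0).
by case: ifPn => h; [rewrite mulr1|rewrite mulr0].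
Qed.

Lemma disc_measure1 p x : (forall x, 0 <= p x) -> disc_measure p [set x] = (p x)%:E.
Proof.
move=> p0; rewrite disc_measureE //; congr EFin; rewrite (big_pred1 (x : I)) // => y.
by apply/idP/eqP => [/set_mem //|->]; exact/mem_set.
Qed.

Lemma disc_measureT p : (forall x, 0 <= p x) ->
  disc_measure p [set: disc x0] = (\sum_x p x)%:E.
Proof. by move=> p0; rewrite disc_measureE //; congr EFin; apply: eq_bigl => x; rewrite in_setT. Qed.

End DiscMeasure.

(** A separate name for [m], to which the structure of finite measure obtained from [mT] can be
    attached. *)
Definition finite_copy d (T : measurableType d) (R : realType)
  (m : {measure set T -> \bar R}) (mT : (m [set: T] < +oo)%E) : set T -> \bar R := m.

Section FiniteCopy.
Context d (T : measurableType d) (R : realType).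
Variables (m : {measure set T -> \bar R}) (mT : (m [set: T] < +oo)%E).
Let finm : fin_num_fun (finite_copy mT).
Proof.
move=> A mA; rewrite ge0_fin_numE ?measure_ge0 //; apply: le_lt_trans mT.
by apply: le_measure; rewrite ?inE.
Qed.
HB.instance Definition _ := Measure.on (finite_copy mT).
HB.instance Definition _ := @Measure_isFinite.Build _ T _ (finite_copy mT) finm.

Lemma finite_measure_of :
  exists m' : {finite_measure set T -> \bar R}, forall A, m' A = m A.
Proof. by exists (finite_copy mT). Qed.
End FiniteCopy.

(** * Approximation by simple functions *)

Section Simple.
Context d (T : measurableType d) (R : realType).
Implicit Types (f g : T -> R).

Definition fvals f := exists s : seq R, forall x, f x \in s.
Definition simple f := measurable_fun [set: T] f /\ fvals f.

Lemma fvals_cst (c : R) : fvals (fun=> c).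
Proof. by exists [:: c] => x; rewrite inE. Qed.

Lemma fvals_bool (b : T -> bool) : fvals (fun x => (b x)%:R).
Proof. by exists [:: 0; 1] => x; case: (b x); rewrite !inE eqxx ?orbT. Qed.

Lemma measurable_fun_bool_natr (b : T -> bool) : measurable [set x | b x] ->
  measurable_fun [set: T] (fun x => (b x)%:R : R).
Proof.
move=> mb; rewrite (_ : (fun x => _) = \1_[set x | b x]); first exact: measurable_indic.
apply/funext => x; rewrite indicE; have -> // : (x \in [set x | b x]) = b x.
by apply/idP/idP => [/set_mem //|h]; exact/mem_set.
Qed.

Lemma fvals_op (op : R -> R -> R) f g : fvals f -> fvals g -> fvals (fun x => op (f x) (g x)).
Proof.
by move=> [s fs] [t gt]; exists [seq op a b | a <- s, b <- t] => x; exact: allpairs_f.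
Qed.

Lemma fvals_sum (N : nat) (F : nat -> T -> R) :
  (forall i, fvals (F i)) -> fvals (fun x => \sum_(i < N) F i x).
Proof.
move=> HF; elim: N => [|N IH].
  by under eq_fun do rewrite big_ord0; exact: fvals_cst.
under eq_fun do rewrite big_ord_recr /=.
exact: (fvals_op (fun a b => a + b) IH).
Qed.

(** Each [x] is mapped to the tuple of indices of the values [psi j x] in their lists. The lists are
    cleared of duplicates, so index and value determine each other and the fibres are finite
    intersections of preimages of values. *)
Lemma simple_factor (n : nat) (psi : 'I_n -> T -> R) : (forall j, simple (psi j)) ->
  exists (I : finType) (x0 : I) (kappa : T -> disc x0) (f : 'I_n -> I -> R),
    measurable_fun [set: T] kappa /\ psi = (fun j x => f j (kappa x)).
Proof.
move=> sp.
have [s0 s0P] := choice (fun j => (sp j).2).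
pose s j := undup (s0 j).
have sP j x : psi j x \in s j by rewrite mem_undup.
pose M := (\sum_j size (s j))%N.
have sM j : (size (s j) <= M)%N by rewrite /M (bigD1 j) //= leq_addr.
pose I : finType := {ffun 'I_n -> 'I_M.+1}.
pose x0 : I := [ffun=> ord0].
pose kj j x : 'I_M.+1 := inord (index (psi j x) (s j)).
have kjE j x : kj j x = index (psi j x) (s j) :> nat.
  by rewrite inordK // ltnS (leq_trans _ (sM j)) // ltnW // index_mem.
pose kappa x : disc x0 := [ffun j => kj j x] : I.
exists I, x0, kappa, (fun j (b : I) => nth 0 (s j) (b j)); split; last first.
  by apply/funext => j; apply/funext => x; rewrite ffunE kjE nth_index.
apply: measurable_fun_disc => b.
have -> : kappa @^-1` [set b] = \big[setI/setT]_(j <- enum 'I_n) (kj j @^-1` [set (b : I) j]).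
  apply/seteqP; split => x /=.
    by move=> <-; rewrite -bigcap_seq => j _ /=; rewrite ffunE.
  by rewrite -bigcap_seq => H; apply/ffunP => j; rewrite ffunE; apply: H; rewrite /= mem_enum.
apply: bigsetI_measurable => j _.
have [bs|bs] := ltnP ((b : I) j) (size (s j)); last first.
  rewrite (_ : _ @^-1` _ = set0) //; apply/seteqP; split => x //= xb.
  by move: bs; rewrite -xb kjE leqNgt index_mem sP.
have -> : kj j @^-1` [set (b : I) j] = psi j @^-1` [set nth 0 (s j) ((b : I) j)].
  apply/seteqP; split => x /= h.
    by rewrite -h kjE nth_index.
  by apply: ord_inj; rewrite kjE h index_uniq // undup_uniq.
by rewrite -[X in measurable X]setTI; exact: (sp j).1.
Qed.

End Simple.

(** * Rounding to simple functions, with a level that varies continuously *)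

Section Rounding.
Context d (T : measurableType d) (R : realType).
Variable phi : T -> R.
Hypothesis mphi : measurable_fun [set: T] phi.

(** [phi x] rounded towards 0 to a multiple of [1/k] and cut off at absolute value [k]. Written as a
    sum of indicators of level sets, it is visibly measurable with finitely many values. *)
Definition rnd (k : nat) (x : T) : R :=
  k%:R^-1 * \sum_(i < k * k) ((i.+1%:R <= k%:R * phi x)%R%:R - (i.+1%:R <= - (k%:R * phi x))%R%:R).

Lemma sum_le_truncn (N : nat) (z : R) :
  \sum_(i < N) (i.+1%:R <= z)%R%:R = (minn N (Num.truncn z))%:R :> R.
Proof.
elim: N => [|N IH]; first by rewrite big_ord0 min0n.
rewrite big_ord_recr /= IH -truncn_gt_nat -natrD; congr (_%:R).
have [h|] := boolP (N < Num.truncn z)%N; first by rewrite (minn_idPl (ltnW h)) (minn_idPl h) addn1.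
by rewrite -leqNgt => h; rewrite (minn_idPr h) addn0 (minn_idPr (leqW h)).
Qed.

Lemma rnd_pos k x : 0 <= phi x ->
  rnd k x = (minn (k * k) (Num.truncn (k%:R * phi x)))%:R / k%:R.
Proof.
move=> p0; rewrite /rnd mulrC; congr (_ / _).
rewrite (eq_bigr (fun i : 'I_(k * k) => (i.+1%:R <= k%:R * phi x)%R%:R)).
  exact: sum_le_truncn.
move=> i _; rewrite [X in _ - X](_ : _ = 0) ?subr0 //.
rewrite leNgt (@le_lt_trans _ _ 0) ?ltr0n // oppr_le0 mulr_ge0 //.
Qed.

Lemma rnd_neg k x : phi x <= 0 ->
  rnd k x = - ((minn (k * k) (Num.truncn (k%:R * - phi x)))%:R / k%:R).
Proof.
move=> p0; rewrite /rnd [LHS]mulrC -[RHS]mulNr; congr (_ / _).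
rewrite -sum_le_truncn -sumrN; apply: eq_bigr => i _.
rewrite [X in X - _](_ : _ = 0) ?sub0r ?mulrN //.
by rewrite leNgt (@le_lt_trans _ _ 0) ?ltr0n // mulr_ge0_le0.
Qed.

Lemma rnd_core (k : nat) (y : R) : 0 <= y ->
  [/\ 0 <= (minn (k * k) (Num.truncn (k%:R * y)))%:R / k%:R :> R,
      (minn (k * k) (Num.truncn (k%:R * y)))%:R / k%:R <= k%:R :> R,
      (minn (k * k) (Num.truncn (k%:R * y)))%:R / k%:R <= y &
      y <= k%:R -> (0 < k)%N -> y - (minn (k * k) (Num.truncn (k%:R * y)))%:R / k%:R <= k%:R^-1].
Proof.
move=> y0; have ky0 : 0 <= k%:R * y by rewrite mulr_ge0.
have /andP[t1 t2] := truncn_itv ky0.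
case: (posnP k) => [->|kp]; first by rewrite !mul0n min0n mul0r.
have k0 : 0 < k%:R :> R by rewrite ltr0n.
split.
- by rewrite divr_ge0.
- by rewrite ler_pdivrMr // -natrM ler_nat geq_minl.
- rewrite ler_pdivrMr // [leRHS]mulrC; apply: le_trans t1; by rewrite ler_nat geq_minr.
move=> yk _.
have -> : minn (k * k) (Num.truncn (k%:R * y)) = Num.truncn (k%:R * y).
  apply/minn_idPr; rewrite -(ler_nat R); apply: (le_trans t1).
  by rewrite natrM ler_wpM2l.
have : y <= (Num.truncn (k%:R * y) + 1)%:R / k%:R.
  by rewrite ler_pdivlMr // [leLHS]mulrC addn1 ltW.
by rewrite natrD mulrDl mul1r lerBlDl.
Qed.

Lemma rnd_le_nat k x : `|rnd k x| <= k%:R.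
Proof.
have [p0|/ltW p0] := leP 0 (phi x).
  by rewrite rnd_pos //; have [h1 h2 _ _] := rnd_core k p0; rewrite ger0_norm.
have p0' : 0 <= - phi x by rewrite oppr_ge0.
by rewrite rnd_neg // normrN; have [h1 h2 _ _] := rnd_core k p0'; rewrite ger0_norm.
Qed.

Lemma rnd_le k x : `|rnd k x| <= `|phi x|.
Proof.
have [p0|/ltW p0] := leP 0 (phi x).
  by rewrite rnd_pos //; have [h1 _ h2 _] := rnd_core k p0; rewrite !ger0_norm.
have p0' : 0 <= - phi x by rewrite oppr_ge0.
rewrite rnd_neg // normrN; have [h1 _ h2 _] := rnd_core k p0'.
by rewrite ger0_norm // ler0_norm.
Qed.

Lemma rnd_dist k x : `|phi x| <= k%:R -> (0 < k)%N -> `|phi x - rnd k x| <= k%:R^-1.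
Proof.
have [p0|/ltW p0] := leP 0 (phi x).
  rewrite (ger0_norm p0) => pk k0; rewrite rnd_pos //; have [_ _ h1 h2] := rnd_core k p0.
  by rewrite ger0_norm ?h2 // subr_ge0.
have p0' : 0 <= - phi x by rewrite oppr_ge0.
rewrite (ler0_norm p0) => pk k0; rewrite rnd_neg // opprK.
have [_ _ h1 h2] := rnd_core k p0'; rewrite ler0_norm; last by rewrite -subr_ge0 sub0r opprD subr_ge0.
by rewrite opprD h2.
Qed.

Lemma rnd0 x : rnd 0 x = 0.
Proof.
have h : `|rnd 0 x| <= 0 := rnd_le_nat 0 x.
by apply/eqP; rewrite -normr_le0.
Qed.

Lemma measurable_rnd k : measurable_fun [set: T] (rnd k).
Proof.
apply: measurable_funM => //; apply: measurable_sum => i; apply: measurable_funB.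
  apply: measurable_fun_bool_natr; rewrite -[X in measurable X]setTI.
  by apply: measurable_fun_le => //; exact: measurable_funM.
apply: measurable_fun_bool_natr; rewrite -[X in measurable X]setTI.
by apply: measurable_fun_le => //; apply: measurableT_comp => //; exact: measurable_funM.
Qed.

Lemma fvals_rnd k : fvals (rnd k).
Proof.
apply: (fvals_op (fun a b => a * b) (fvals_cst _ _)).
apply: (@fvals_sum _ _ _ (k * k) (fun i x => (i.+1%:R <= k%:R * phi x)%R%:R - (i.+1%:R <= - (k%:R * phi x))%R%:R)) => i.
have H1 := fvals_bool R (fun x => i.+1%:R <= k%:R * phi x).
have H2 := fvals_bool R (fun x => i.+1%:R <= - (k%:R * phi x)).
exact: (fvals_op (fun a b => a - b) H1 H2).
Qed.

Definition clip (t : R) : R := Num.min 1 (Num.max 0 t).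

Lemma clip_le0 t : t <= 0 -> clip t = 0.
Proof. by move=> t0; rewrite /clip max_l // min_r. Qed.

Lemma clip_ge1 t : 1 <= t -> clip t = 1.
Proof. by move=> t1; rewrite /clip max_r ?min_l // (le_trans _ t1). Qed.

Lemma clip_id t : 0 <= t -> t <= 1 -> clip t = t.
Proof. by move=> t0 t1; rewrite /clip max_r // min_r. Qed.

Lemma clip_lip a b : `|clip a - clip b| <= `|a - b|.
Proof.
have cE t : [\/ t <= 0 /\ clip t = 0, (0 <= t <= 1) /\ clip t = t | 1 <= t /\ clip t = 1].
  have [t0|/ltW t0] := leP t 0; first by apply: Or31; rewrite clip_le0.
  have [t1|/ltW t1] := leP t 1; first by apply: Or32; rewrite clip_id // t0.
  by apply: Or33; rewrite clip_ge1.
have := ler_norm (a - b); have := ler_norm (- (a - b)); rewrite normrN ler_norml.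
by case: (cE a) => -[ha ->]; case: (cE b) => -[hb ->] => h1 h2; apply/andP; split; lra.
Qed.

(** A telescoping sum whose increments are switched on one after the other as [t] grows. For
    [N >= t] it does not depend on [N], and a fixed [N] makes the dependence on [t] Lipschitz. *)
Definition interp (N : nat) (t : R) (x : T) : R :=
  \sum_(k < N) clip (t - k%:R) * (rnd k.+1 x - rnd k x).

(* [rint k] is [rnd k] for natural [k], interpolated so as to be Lipschitz in [t]
   uniformly in [x]. *)
Definition rint (t : R) : T -> R := interp (Num.truncn t).+1 t.

Lemma interp_widen (N M : nat) t x : t <= N%:R -> (N <= M)%N -> interp M t x = interp N t x.
Proof.
move=> tN NM; rewrite /interp -!(big_mkord xpredT (fun k => clip (t - k%:R) * (rnd k.+1 x - rnd k x))).
rewrite (big_cat_nat (n := N)) //= [X in _ + X]big_nat_cond [X in _ + X]big1 ?addr0 // => k.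
rewrite andbT => /andP[Nk _]; rewrite clip_le0 ?mul0r // subr_le0 (le_trans tN) // ler_nat //.
Qed.

Lemma rintE (N : nat) t x : 0 <= t -> t <= N%:R -> rint t x = interp N t x.
Proof.
move=> t0 tN; have /andP[_ t2] := truncn_itv t0.
have [h|h] := leqP N (Num.truncn t).+1.
  by rewrite /rint (interp_widen x tN h).
by rewrite /rint -(interp_widen x (ltW t2) (ltnW h)).
Qed.

Lemma rint_convex t x : 0 <= t ->
  rint t x = rnd (Num.truncn t) x + (t - (Num.truncn t)%:R) * (rnd (Num.truncn t).+1 x - rnd (Num.truncn t) x).
Proof.
move=> t0; have /andP[t1 t2] := truncn_itv t0.
set m := Num.truncn t in t1 t2 *.
rewrite /rint -/m /interp big_ord_recr /= clip_id ?subr_ge0 //; last first.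
  by rewrite lerBlDr addrC natr1 ltW.
congr (_ + _); rewrite (eq_bigr (fun k : 'I_m => rnd k.+1 x - rnd k x)); last first.
  move=> k _; rewrite clip_ge1 ?mul1r // lerBrDr addrC natr1 (le_trans _ t1) // ler_nat //.
by rewrite -(big_mkord xpredT (fun k => rnd k.+1 x - rnd k x)) telescope_sumr // rnd0 subr0.
Qed.

Lemma convex_norm_le (u v th M : R) : 0 <= th -> th <= 1 -> `|u| <= M -> `|v| <= M ->
  `|u + th * (v - u)| <= M.
Proof.
move=> th0 th1; rewrite !ler_norml => /andP[u1 u2] /andP[v1 v2]; apply/andP; split; nra.
Qed.

Lemma truncn_frac (t : R) : 0 <= t -> 0 <= t - (Num.truncn t)%:R /\ t - (Num.truncn t)%:R <= 1.
Proof.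
move=> t0; have /andP[t1 t2] := truncn_itv t0; rewrite subr_ge0 t1; split => //.
by rewrite lerBlDr addrC natr1 ltW.
Qed.

Lemma rint_le t x : 0 <= t -> `|rint t x| <= `|phi x|.
Proof.
move=> t0; rewrite rint_convex //; have [h1 h2] := truncn_frac t0.
by apply: convex_norm_le => //; exact: rnd_le.
Qed.

Lemma rint_bound t x : 0 <= t -> `|rint t x| <= t + 1.
Proof.
move=> t0; rewrite rint_convex //; have [h1 h2] := truncn_frac t0.
have /andP[t1 t2] := truncn_itv t0.
apply: convex_norm_le => //; apply: (le_trans (rnd_le_nat _ _)).
  by rewrite (le_trans t1) // lerDl.
by rewrite -natr1 lerD2r.
Qed.

Lemma rint_dist t x : `|phi x| + 1 <= t -> `|phi x - rint t x| <= (Num.truncn t)%:R^-1.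
Proof.
move=> pt; have t0 : 0 <= t by rewrite (le_trans _ pt) // addr_ge0.
have [h1 h2] := truncn_frac t0; have /andP[t1 t2] := truncn_itv t0.
have m0 : (0 < Num.truncn t)%N.
  by rewrite truncn_gt0 (le_trans _ pt) // lerDr.
have pm : `|phi x| <= (Num.truncn t)%:R by move: t2; rewrite -natr1; lra.
rewrite rint_convex // distrC.
rewrite (_ : _ - phi x = (rnd (Num.truncn t) x - phi x) + (t - (Num.truncn t)%:R) *
   ((rnd (Num.truncn t).+1 x - phi x) - (rnd (Num.truncn t) x - phi x))); last by ring.
apply: convex_norm_le => //; rewrite distrC.
  exact: rnd_dist.
apply: (le_trans (rnd_dist _ _)) => //; first by rewrite (le_trans pm) // ler_nat.
by rewrite lef_pV2 ?posrE ?ltr0n // ler_nat.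
Qed.

Lemma rint_lip (N : nat) t t' x : 0 <= t -> t <= N%:R -> 0 <= t' -> t' <= N%:R ->
  `|rint t x - rint t' x| <= `|t - t'| * \sum_(k < N) (2 * k.+1%:R).
Proof.
move=> t0 tN t'0 t'N; rewrite !(rintE (N := N)) // /interp -sumrB mulr_sumr.
apply: (le_trans (ler_norm_sum _ _ _)); apply: ler_sum => k _.
rewrite -mulrBl normrM; apply: ler_pM => //.
  apply: (le_trans (clip_lip _ _)); have -> // : t - k%:R - (t' - k%:R) = t - t' by ring.
apply: (le_trans (ler_normB _ _)); have := rnd_le_nat k.+1 x; have := rnd_le_nat k x.
have : k%:R <= k.+1%:R :> R by rewrite ler_nat.
lra.
Qed.

Lemma simple_rint t : simple (rint t).
Proof.
split.
  apply: measurable_sum => k; apply: measurable_funM => //.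
  by apply: measurable_funB; exact: measurable_rnd.
apply: (@fvals_sum _ _ _ _ (fun k x => clip (t - k%:R) * (rnd k.+1 x - rnd k x))) => k.
apply: (fvals_op (fun a b => a * b) (fvals_cst _ _)).
exact: (fvals_op (fun a b => a - b) (fvals_rnd _) (fvals_rnd _)).
Qed.

Lemma rint_cvg (t_ : nat -> R) x : t_ k @[k --> \oo] --> +oo ->
  rint (t_ k) x @[k --> \oo] --> phi x.
Proof.
move=> /cvgryPge tcv; apply/cvgrPdist_le => e e0.
near=> k.
have tk : `|phi x| + 1 + e^-1 <= t_ k by near: k; exact: tcv.
have e1 : 0 < e^-1 by rewrite invr_gt0.
have tk1 : `|phi x| + 1 <= t_ k by move: tk e1; lra.
apply: (le_trans (rint_dist tk1)).
have t0 : 0 <= t_ k by rewrite (le_trans _ tk1) // addr_ge0.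
have /andP[t1 t2] := truncn_itv t0.
have em : e^-1 <= (Num.truncn (t_ k))%:R.
  by move: t2 tk (normr_ge0 (phi x)); rewrite -natr1; lra.
by rewrite -[leRHS]invrK lef_pV2 ?posrE // (lt_le_trans e1).
Unshelve. all: by end_near.
Qed.

Lemma cvg_powR0 (q : R) (y_ : nat -> R) : 0 < q -> (forall k, 0 <= y_ k) ->
  y_ k @[k --> \oo] --> 0 -> y_ k `^ q @[k --> \oo] --> 0.
Proof.
move=> q0 y0 ycv; apply/cvgrPdist_le => e e0.
move/cvgrPdist_le: ycv => /(_ (e `^ q^-1)); rewrite powR_gt0 // => /(_ isT).
apply: filterS => k; rewrite !sub0r !normrN (ger0_norm (y0 k)) (ger0_norm (powR_ge0 _ _)) => h.
rewrite -[leRHS](powRVK q0) ?(ltW e0) //; apply: ge0_ler_powR; rewrite ?nnegrE ?powR_ge0 ?(ltW q0) //.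
Qed.

Lemma rint_powR_cvg (mu : {measure set T -> \bar R}) (q : R) (t_ : nat -> R) :
  0 < q -> mu.-integrable [set: T] (EFin \o (fun x => `|phi x| `^ q)) ->
  (forall k, 0 <= t_ k) -> t_ k @[k --> \oo] --> +oo ->
  (\int[mu]_x (`|phi x - rint (t_ k) x| `^ q)%:E @[k --> \oo] --> 0)%E.
Proof.
move=> q0 iphi t0 tcv.
have md k : measurable_fun [set: T] (fun x => `|phi x - rint (t_ k) x| `^ q).
  by apply: measurable_norm_powR; apply: measurable_funB => //; exact: (simple_rint _).1.
have ig : mu.-integrable [set: T] (EFin \o (fun x => 2 `^ q * `|phi x| `^ q)).
  by have := integrableZl measurableT (2 `^ q) iphi; apply: eq_integrable.
have := @dominated_convergence _ _ _ mu setT measurableT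
  (fun k x => (`|phi x - rint (t_ k) x| `^ q)%:E) (fun=> 0%E) (EFin \o (fun x => 2 `^ q * `|phi x| `^ q)).
case => //.
- by move=> k; apply/measurable_EFinP.
- apply/aeW => x _; apply: cvg_EFin.
    by near=> k.
  apply: cvg_powR0 => //.
  have h := @rint_cvg t_ x tcv.
  rewrite -(normr0 R) -(subrr (phi x)); apply: cvg_norm; apply: cvgB => //; exact: cvg_cst.
- apply/aeW => x k _; rewrite /= lee_fin ger0_norm ?powR_ge0 // -powRM //.
  apply: ge0_ler_powR; rewrite ?nnegrE ?mulr_ge0 ?(ltW q0) //.
  apply: (le_trans (ler_normB _ _)); have := rint_le x (t0 k); lra.
by move=> _ _; rewrite integral0.
Unshelve. all: by end_near.
Qed.

End Rounding.

(** Distance 0 makes the two densities equal almost everywhere, so the integrand vanishes even where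
    [phi] is unbounded. *)
Lemma L1close0_Sr_close d (T : measurableType d) (R : realType) (r : R)
    (mu nu : {measure set T -> \bar R}) (phi : T -> R) (eps : R) :
  0 < r -> L1close mu nu 0 -> measurable_fun [set: T] phi -> 0 < eps ->
  Sr_close r mu phi nu phi eps.
Proof.
move=> r0 [rho [f [g [df dg H]]]] mphi eps0; exists rho, f, g; split => //; split => //.
have [mf [f0 _]] := df; have [mg [g0 _]] := dg.
have mfg : measurable_fun [set: T] (fun x => (f x - g x)%:E).
  by apply/measurable_EFinP; exact: measurable_funB.
have I0 : (\int[rho]_x `|(f x - g x)%:E| = 0)%E.
  by apply/eqP; rewrite eq_le H integral_ge0.
have /(ae_eq_integral_abs rho measurableT mfg) ae0 := I0.
rewrite (ge0_ae_eq_integral (g := fun=> 0%E)) //.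
- by rewrite integral0 lte_fin powR_gt0.
- apply/measurable_EFinP; apply: measurable_norm_powR; apply: measurable_funB;
    apply: measurable_funM => //; exact: (measurableT_comp (@measurable_powR R _)).
- apply: filterS ae0 => x /(_ I) /= [] /eqP; rewrite subr_eq0 => /eqP -> _.
  by rewrite subrr normr0 powR0 // invr_eq0 gt_eqF.
Qed.

Lemma cvg_powRN_pinfty (R : realType) (s : R) (y_ : nat -> R) : 0 < s ->
  (forall k, 0 < y_ k) -> y_ k @[k --> \oo] --> 0 -> y_ k `^ (- s) @[k --> \oo] --> +oo.
Proof.
move=> s0 y0 ycv; apply/cvgryPge => M.
pose M' := Num.max M 1; have M'0 : 0 < M' by rewrite lt_max ltr01 orbT.
have h : 0 < M'^-1 `^ s^-1 by rewrite powR_gt0 // invr_gt0.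
near=> k; apply: (@le_trans _ _ M'); first by rewrite le_max lexx.
have : y_ k <= M'^-1 `^ s^-1.
  near: k; move/cvgrPdist_le: ycv => /(_ _ h); apply: filterS => k.
  by rewrite sub0r normrN gtr0_norm.
move=> yk; rewrite powRN -[M']invrK lef_pV2 ?posrE ?powR_gt0 ?invr_gt0 //.
rewrite -[leRHS](powRVK s0) ?invr_ge0 ?(ltW M'0) //.
by apply: ge0_ler_powR; rewrite ?nnegrE ?powR_ge0 ?(ltW s0) ?(ltW (y0 k)).
Unshelve. all: by end_near.
Qed.

(** * A continuous field through a given tangent vector *)

Section RoundField.
Context d (T : measurableType d) (R : realType).
Variable r : R.
Hypotheses (r0 : 0 < r) (r1 : r <= 1).
Variables (Pt : Type) (pt : Pt -> {measure set T -> \bar R}).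
Variables (tang : Pt -> (T -> R) -> Prop) (cen : bool).
Hypothesis ptfin : forall p, (pt p [set: T] < +oo)%E.
Hypothesis pt1 : cen -> forall p, fine (pt p [set: T]) = 1.
Hypothesis tangE : forall p phi,
  tang p phi <-> Lr r (pt p) phi /\ (cen -> \int[pt p]_x phi x = 0).
Variables (p0 : Pt) (phi : T -> R).
Hypothesis Lphi : Lr r (pt p0) phi.
Let mphi : measurable_fun [set: T] phi := Lphi.1.

Definition tvd p : R := tv (pt p0) (pt p).
(* The exponent is chosen so that [lev p `^ r^-1 * tvd p] tends to 0 with [tvd p]. *)
Definition lev p : R := tvd p `^ (- (r / 2)).
(** [phi] is in L^(1/r) of [p0] but in general not of nearby points. At every other measure it is
    replaced by a bounded rounding, whose level grows to infinity as [p] approaches [p0]. *)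
Definition roundf p : T -> R := if tvd p == 0 then phi else rint phi (lev p).

Lemma tvd_ge0 p : 0 <= tvd p.
Proof. exact: tv_ge0. Qed.

Lemma tvd0_eq p A : tvd p = 0 -> measurable A -> pt p A = pt p0 A.
Proof.
move=> d0 mA; have := tv_ub (ptfin p0) (ptfin p) mA; rewrite -/(tvd p) d0 normr_le0 subr_eq0.
have fin q : pt q A \is a fin_num.
  rewrite ge0_fin_numE //; apply: le_lt_trans (ptfin q).
  by apply: le_measure; rewrite ?inE.
by move=> /eqP E; rewrite -(fineK (fin p)) -E fineK.
Qed.

Lemma tvd0_integral p (f : T -> \bar R) : tvd p = 0 ->
  (\int[pt p]_x f x = \int[pt p0]_x f x)%E.
Proof. by move=> d0; apply: eq_measure_integral => A mA _; exact: tvd0_eq. Qed.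

Lemma tvd_self : tvd p0 = 0.
Proof.
apply/eqP; rewrite eq_le tvd_ge0 andbT; apply: tv_le => A mA.
by rewrite subrr normr0.
Qed.

Lemma measurable_roundf p : measurable_fun [set: T] (roundf p).
Proof. by rewrite /roundf; case: ifP => _ //; exact: (simple_rint mphi _).1. Qed.

Lemma Lr_roundf p : Lr r (pt p) (roundf p).
Proof.
rewrite /roundf; case: eqP => [dz|_].
  by split => //; rewrite tvd0_integral //; exact: Lphi.2.
apply: (@Lr_bounded _ _ _ _ r0 _ _ (lev p + 1)) => //; first exact: (simple_rint mphi _).1.
by move=> x; apply: rint_bound; exact: powR_ge0.
Qed.

Lemma tang_roundf p : tang p (ctr pt cen p (roundf p)).
Proof. exact: (tang_ctr r0 r1 ptfin pt1 tangE (Lr_roundf p)). Qed.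

(** Dominated convergence gives limits along sequences of levels; a sequence of bad levels turns
    this into one threshold valid for all larger levels. *)
Lemma rint_powR_small (q : R) (mu : {measure set T -> \bar R}) :
  0 < q -> mu.-integrable [set: T] (EFin \o (fun x => `|phi x| `^ q)) ->
  forall e : R, 0 < e -> exists2 t0 : R, 0 <= t0 & forall t, t0 <= t ->
    (\int[mu]_x (`|phi x - rint phi t x| `^ q)%:E <= e%:E)%E.
Proof.
move=> q0 iphi e e0; apply: contrapT => /forall2NP N.
have N' (k : nat) : exists t : R, k%:R <= t /\
    ~ (\int[mu]_x (`|phi x - rint phi t x| `^ q)%:E <= e%:E)%E.
  have [//|/existsNP[t /not_implyP[h1 h2]]] := N k%:R.
  by exists t.
have [t_ tP] := choice N'.
have t0 k : 0 <= t_ k by rewrite (le_trans _ (tP k).1).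
have tcv : t_ k @[k --> \oo] --> +oo.
  apply/cvgryPge => M; exists (Num.truncn M).+1 => // k /= hk.
  apply: le_trans (tP k).1; apply: (le_trans (ltW (truncnS_gt M))); by rewrite ler_nat.
have /fine_cvgP[fn] := rint_powR_cvg mphi q0 iphi t0 tcv.
move=> /cvgrPdist_le /(_ e e0) /= [K2 _ HK2]; have [K1 _ HK1] := fn.
have [] := tP (maxn K1 K2) => _; apply.
have /= := HK2 (maxn K1 K2) (leq_maxr _ _); rewrite sub0r normrN.
have /= fnK := HK1 (maxn K1 K2) (leq_maxl _ _).
by move=> h; rewrite -[leLHS]fineK // lee_fin (le_trans (ler_norm _)).
Qed.

(** At positive distance from [p0] the level is continuous in the point, and [rint] is Lipschitz in
    the level uniformly in [x]. *)
Lemma roundf_cvg_pos p1 p_ : tvd p1 != 0 -> Lcvg pt p_ p1 ->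
  field_cvg r pt (fun p => ctr pt cen p (roundf p)) p_ p1.
Proof.
move=> d1 pp.
have d1pos : 0 < tvd p1 by rewrite lt_neqAle eq_sym d1 tvd_ge0.
have tvdcv : tvd (p_ k) @[k --> \oo] --> tvd p1.
  apply/cvgrPdist_le => e e0; have := pp e e0; apply: filterS => k L1.
  by apply: (le_trans (tv_dist _ _ _)) => //; exact: L1close_tv.
have levcv : lev (p_ k) @[k --> \oo] --> lev p1 by exact: cvg_powR_pos tvdcv.
have lev0 p : 0 <= lev p by exact: powR_ge0.
apply: (field_cvg_unif r0 r1 ptfin pt1 (M := lev p1 + 1)) => //.
- exact: measurable_roundf.
- by move=> x; rewrite /roundf (negbTE d1); exact: rint_bound.
move=> e e0.
(* Also bounds the levels of the nearby points, which differ from [lev p1] by at most 1. *)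
pose N := (Num.truncn (lev p1 + 1)).+1.
have NP : lev p1 + 1 <= N%:R by exact: ltW (truncnS_gt _).
pose C : R := \sum_(k < N) (2 * k.+1%:R).
have C0 : 0 <= C by apply: sumr_ge0 => k _; rewrite mulr_ge0.
have del0 : 0 < Num.min 1 (e / (C + 1)) by rewrite lt_min ltr01 divr_gt0 // ltr_wpDl.
near=> k => x.
have tk : `|lev p1 - lev (p_ k)| <= Num.min 1 (e / (C + 1)).
  by near: k; move/cvgrPdist_le: levcv => /(_ _ del0).
have dk : 0 < tvd (p_ k).
  near: k; move/cvgrPdist_lt: tvdcv => /(_ _ d1pos); apply: filterS => k.
  by move=> /(le_lt_trans (ler_norm _)); lra.
rewrite /roundf (gt_eqF dk) (negbTE d1).
have [tk1 tk2] : `|lev p1 - lev (p_ k)| <= 1 /\ `|lev p1 - lev (p_ k)| <= e / (C + 1).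
  by move: tk; rewrite le_min => /andP.
have tkN : lev (p_ k) <= N%:R.
  by move: tk1; rewrite ler_norml => /andP[h _]; refine (le_trans _ NP); rewrite -lerBlDl -lerN2 opprB.
have t1N : lev p1 <= N%:R by refine (le_trans _ NP); rewrite lerDl.
apply: (le_trans (@rint_lip _ _ _ phi N _ _ x (lev0 (p_ k)) tkN (lev0 p1) t1N)).
rewrite -/C distrC; apply: (@le_trans _ _ (e / (C + 1) * (C + 1))).
  by apply: ler_pM => //; rewrite lerDl.
by rewrite divfK // gt_eqF // ltr_wpDl.
Unshelve. all: by end_near.
Qed.

(** Two errors compete. Rounding at level [t] costs an L^(1/r) distance that tends to 0 as [t]
    grows; passing from one measure to the other costs about [t^(1/r)] times their distance [x].
    With [t = x^(-r/2)] the second error is of order [sqrt x]. *)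
Lemma roundf_cvg0 p1 p_ : tvd p1 = 0 -> Lcvg pt p_ p1 ->
  field_cvg r pt (fun p => ctr pt cen p (roundf p)) p_ p1.
Proof.
move=> d1 pp eps eps0.
have q0 := rV_gt0 r0; have q1 := rV_ge1 r0 r1.
have Lphi1 : Lr r (pt p1) phi by split => //; rewrite tvd0_integral //; exact: Lphi.2.
have iphi1 := Lr_integrable r0 r1 (ptfin p1) Lphi1.
have r1E : roundf p1 = phi by rewrite /roundf d1 eqxx.
have tvdE p : tv (pt p1) (pt p) = tvd p.
  by rewrite /tvd /tv; congr (sup _); apply: eq_imagel => A mA; rewrite (tvd0_eq d1).
pose m := fine (pt p1 [set: T]); have m0 : 0 <= m by exact: fine_ge0.
(* [K] collects the errors in units of a small [h]: [h] from rounding, [(5 * h) ^ q] from the means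
   ([h] by rounding and [4 * h] by the change of measure), and [4 ^ q * 2 * h] from the change of
   measure; the factors [2 ^ q] come from splitting sums. *)
pose q := r^-1; pose K : R := 2 `^ q * (2 `^ q * (1 + 5 `^ q * m) + 4 `^ q * 2).
have K0 : 0 < K.
  rewrite mulr_gt0 ?powR_gt0 // addr_gt0 ?mulr_gt0 ?powR_gt0 //.
  by rewrite ltr_pwDl // mulr_ge0 ?powR_ge0.
pose h := Num.min 1 (eps `^ q / (2 * K)).
have h0 : 0 < h by rewrite lt_min ltr01 divr_gt0 ?powR_gt0 // mulr_gt0.
have h1 : h <= 1 by rewrite ge_min lexx.
have hK : h * K < eps `^ q.
  apply: (@le_lt_trans _ _ (eps `^ q / (2 * K) * K)).
    by rewrite ler_wpM2r ?(ltW K0) // ge_min lexx orbT.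
  rewrite (_ : _ * K = eps `^ q / 2); last by field; rewrite gt_eqF.
  by rewrite ltr_pdivrMr // ltr_pMr ?powR_gt0 // ltr1n.
have [ta ta0 Hta] := rint_powR_small q0 (Lr_powR_integrable Lphi1) h0.
have i1 : (pt p1).-integrable [set: T] (EFin \o (fun x => `|phi x| `^ 1)).
  have := integrable_norm iphi1; apply: eq_integrable => // x _ /=.
  by rewrite powRr1.
have [tb tb0 Htb] := rint_powR_small ltr01 i1 h0.
pose t0 := Num.max (Num.max ta tb) 1.
have t00 : 0 < t0 by rewrite lt_max ltr01 orbT.
(* Small enough for [sqrt x <= h] and for the level [x^(-r/2)] to reach [t0]. *)
pose xx := Num.min (Num.min 1 (h ^+ 2)) (t0^-1 `^ (r / 2)^-1).
have r2 : 0 < r / 2 by rewrite divr_gt0.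
have xx0 : 0 < xx by rewrite !lt_min ltr01 exprn_gt0 // powR_gt0 // invr_gt0.
near=> k.
have Lk : L1close (pt p1) (pt (p_ k)) (xx / 2).
  by near: k; apply: pp; rewrite divr_gt0.
have Lm := L1close_min (ptfin p1) (ptfin (p_ k)) Lk; rewrite tvdE in Lm.
have xk : tvd (p_ k) <= xx / 2 by rewrite -tvdE; exact: L1close_tv Lk.
(* A point with the measure of [p0] keeps the unrounded [phi], so the field takes the same value
   there as at [p1]. *)
have [dz|dnz] := eqVneq (tvd (p_ k)) 0.
  have -> : ctr pt cen (p_ k) (roundf (p_ k)) = ctr pt cen p1 (roundf p1).
    rewrite r1E /roundf dz eqxx /ctr /mean; apply/funext => x; congr (_ - _).
    by case: ifP => // _; rewrite /Rintegral (tvd0_integral _ dz) (tvd0_integral _ d1).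
  apply: L1close0_Sr_close => //; first by rewrite dz mulr0 in Lm.
  by apply: measurable_funB => //; exact: measurable_roundf.
have xpos : 0 < tvd (p_ k) by rewrite lt_neqAle eq_sym dnz tvd_ge0.
set x := tvd (p_ k) in Lm xk dnz xpos.
have xxx : x <= xx by apply: (le_trans xk); rewrite ler_pdivrMr // ler_pMr // ler1n.
have x1 : x <= 1 by apply: (le_trans xxx); rewrite !ge_min lexx.
have xh : x `^ 2^-1 <= h.
  have xh2 : x <= h ^+ 2 by apply: (le_trans xxx); rewrite !ge_min lexx orbT.
  rewrite powR12_sqrt ?(ltW xpos) // -[leRHS]ger0_norm ?(ltW h0) // -sqrtr_sqr.
  by rewrite ler_sqrt // exprn_ge0 // ltW.
have tge : t0 <= lev (p_ k).
  have xt : x <= t0^-1 `^ (r / 2)^-1 by apply: (le_trans xxx); rewrite ge_min lexx orbT.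
  rewrite /lev -/x powRN -[t0]invrK lef_pV2 ?posrE ?powR_gt0 ?invr_gt0 //.
  rewrite -[leRHS](powRVK r2) ?invr_ge0 ?(ltW t00) //.
  by apply: ge0_ler_powR; rewrite ?nnegrE ?powR_ge0 ?(ltW r2) ?(ltW xpos).
set t := lev (p_ k) in tge *.
have t1 : 1 <= t by apply: le_trans tge; rewrite le_max lexx orbT.
have tpos : 0 <= t by rewrite (le_trans _ t1).
have HA := Hta t (le_trans _ tge); have HB := Htb t (le_trans _ tge).
have {}HA := HA ltac:(by rewrite !le_max lexx).
have {}HB := HB ltac:(by rewrite !le_max lexx orbT).
have mr := (simple_rint mphi t).1.
have rb y : `|rint phi t y| <= t + 1 by exact: rint_bound.
have rkE : roundf (p_ k) = rint phi t by rewrite /roundf -/x (negbTE dnz).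
(* t^(1/r) * x = sqrt x *)
have tqx : t `^ q * x = x `^ 2^-1.
  rewrite /t /lev -/x -powRrM -[X in _ * X]powRr1 ?(ltW xpos) // -powRD; last by rewrite dnz implybT.
  by congr (_ `^ _); rewrite /q; field; rewrite gt_eqF.
have tx : t * x <= x `^ 2^-1.
  rewrite -tqx ler_wpM2r ?(ltW xpos) //; exact: le1r_powR.
have mb : `|mean pt cen p1 phi - mean pt cen (p_ k) (rint phi t)| <= 5 * h.
  rewrite /mean; case: ifP => c1; last by rewrite subrr normr0 mulr_ge0 // ltW.
  have ir : (pt p1).-integrable [set: T] (EFin \o rint phi t).
    exact: bounded_integrable rb.
  rewrite (_ : _ - _ = (\int[pt p1]_y phi y - \int[pt p1]_y rint phi t y) +
    (\int[pt p1]_y rint phi t y - \int[pt (p_ k)]_y rint phi t y)); last by ring.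
  apply: (le_trans (ler_normD _ _)).
  have b1 : `|\int[pt p1]_y phi y - \int[pt p1]_y rint phi t y| <= h.
    rewrite -RintegralB //.
    have idf : (pt p1).-integrable [set: T] (EFin \o (fun y => phi y - rint phi t y)).
      by have := integrableB measurableT iphi1 ir; apply: eq_integrable.
    apply: (le_trans (le_normr_Rintegral _ idf)) => //.
    rewrite -lee_fin /Rintegral fineK; last first.
      by apply: integrable_fin_num => //; exact: (integrable_norm idf).
    apply: le_trans HB; rewrite le_eqVlt; apply/orP; left; apply/eqP.
    by apply: eq_integral => y _; rewrite powRr1.
  have b2 : `|\int[pt p1]_y rint phi t y - \int[pt (p_ k)]_y rint phi t y| <= (t + 1) * (2 * x).
    by apply: (L1close_Rintegral (ptfin p1) (ptfin (p_ k)) Lm) => //; rewrite addr_ge0.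
  have b3 : (t + 1) * (2 * x) <= 4 * h.
    apply: (@le_trans _ _ (4 * (t * x))); last by rewrite ler_pM2l // (le_trans tx).
    have : x <= t * x by rewrite ler_peMl // ltW.
    rewrite (_ : (t + 1) * (2 * x) = 2 * (t * x) + 2 * x); last by ring.
    lra.
  by move: b1 b2 b3; lra.
set dl := mean pt cen p1 phi - mean pt cen (p_ k) (rint phi t) in mb.
have md : measurable_fun [set: T] (fun y => phi y - rint phi t y) by exact: measurable_funB.
have mc p : measurable_fun [set: T] (ctr pt cen p (roundf p)).
  by apply: measurable_funB => //; exact: measurable_roundf.
apply: (@L1close_Sr_close _ _ _ _ r0 r1 _ _ (2 * x) (2 * (t + 1)) (2 `^ q * (h + 5 `^ q * h * m)) eps _ _ Lm) => //.
- by rewrite mulr_ge0 // addr_ge0.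
- rewrite rkE => y; apply: (le_trans (ler_normB _ _)).
  have t10 : 0 <= t + 1 by rewrite addr_ge0.
  have := mean_le ptfin pt1 (p_ k) t10 mr rb; have := rb y; lra.
- rewrite r1E rkE.
  apply: (@le_trans _ _ (\int[pt p1]_y (2 `^ q * `|phi y - rint phi t y| `^ q + 2 `^ q * `|dl| `^ q)%:E)%E).
    apply: ge0_le_integral => //.
    - apply/measurable_EFinP; apply: measurable_norm_powR.
      by have := measurable_funB (mc p1) (mc (p_ k)); rewrite r1E rkE.
    - apply/measurable_EFinP; apply: measurable_funD => //; apply: measurable_funM => //.
      exact: measurable_norm_powR.
    move=> y _; rewrite lee_fin -mulrDr; apply: le_trans (powR_add_le q0 _ _) => //.
    apply: ge0_ler_powR; rewrite ?nnegrE ?(ltW q0) ?addr_ge0 //.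
    rewrite /ctr (_ : _ - _ - _ = (phi y - rint phi t y) - dl); last by rewrite /dl; ring.
    exact: ler_normB.
  rewrite ge0_integral_lincomb ?powR_ge0 //; last exact: measurable_norm_powR.
  rewrite integral_cst // mulrDr EFinD; apply: leeD.
    by rewrite EFinM; apply: lee_wpmul2l; [rewrite lee_fin powR_ge0|exact: HA].
  rewrite -[pt p1 _]fineK ?ge0_fin_numE // -/m -!EFinM lee_fin.
  rewrite ler_wpM2l ?powR_ge0 // ler_wpM2r //.
  apply: (@le_trans _ _ ((5 * h) `^ q)).
    by apply: ge0_ler_powR; rewrite ?nnegrE ?(ltW q0) // mulr_ge0 // ltW.
  rewrite powRM ?(ltW h0) // ler_wpM2l ?powR_ge0 //.
  by apply: ge1r_powR => //; rewrite h0 h1.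
- apply: le_lt_trans hK.
  have b : (2 * (t + 1)) `^ q * (2 * x) <= 4 `^ q * 2 * h.
    apply: (@le_trans _ _ ((4 * t) `^ q * (2 * x))).
      rewrite ler_wpM2r ?mulr_ge0 ?(ltW xpos) //; apply: ge0_ler_powR; rewrite ?nnegrE ?(ltW q0) //.
      - by rewrite mulr_ge0 // addr_ge0.
      - by rewrite mulr_ge0.
      - move: t1; lra.
    rewrite powRM // (_ : _ * (2 * x) = 4 `^ q * 2 * (t `^ q * x)); last by ring.
    by rewrite tqx ler_wpM2l // mulr_ge0 ?powR_ge0.
  rewrite -/q /K [leRHS]mulrCA ler_wpM2l ?powR_ge0 //.
  rewrite (_ : h * _ = 2 `^ q * (h + 5 `^ q * h * m) + 4 `^ q * 2 * h); last by ring.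
  by rewrite lerD2l.
Unshelve. all: by end_near.
Qed.

Lemma roundf_cvg p1 p_ : Lcvg pt p_ p1 ->
  field_cvg r pt (fun p => ctr pt cen p (roundf p)) p_ p1.
Proof.
by have [d0|d0] := eqVneq (tvd p1) 0; [exact: roundf_cvg0|exact: roundf_cvg_pos].
Qed.

End RoundField.

(** * Convergence of integrals of products *)

Section ProductLimit.
Context d (T : measurableType d) (R : realType).
Variables (r : R) (n : nat).
Hypotheses (r0 : 0 < r) (r1 : r <= 1).
Implicit Types mu : {measure set T -> \bar R}.

(** With [S] the sum on the right, each [|y j|] is at most [(1 + S)^r]; the product is at most
    [(1 + S)^(r #|B|)], and [r #|B| <= 1]. This takes the place of Hoelder's inequality. *)
Lemma prod_le_sum_powR (B : {set 'I_n}) (y : 'I_n -> R) : #|B|%:R <= r^-1 ->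
  \prod_(j in B) `|y j| <= 1 + \sum_j `|y j| `^ r^-1.
Proof.
move=> Br; set S := \sum_j _; have S0 : 0 <= S by apply: sumr_ge0 => j _; exact: powR_ge0.
have S1 : 1 <= 1 + S by rewrite lerDl.
have S10 : 0 <= 1 + S by rewrite addr_ge0.
have yS j : `|y j| <= (1 + S) `^ r.
  rewrite -[leLHS](powRVK r0) //; apply: ge0_ler_powR; rewrite ?nnegrE ?powR_ge0 ?(ltW r0) //.
  rewrite /S (bigD1 j) //= addrCA lerDl addr_ge0 // sumr_ge0 // => i _; exact: powR_ge0.
apply: (@le_trans _ _ (\prod_(j in B) (1 + S) `^ r)).
  by apply: ler_prod => j _; rewrite normr_ge0 yS.
rewrite prodr_const -powR_mulrn ?powR_ge0 // -powRrM -[leRHS]powRr1 //.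
by apply: ler_powR => //; rewrite mulrC -ler_pdivlMr // mul1r.
Qed.

Lemma measurable_set_prod (B : {set 'I_n}) (f : 'I_n -> T -> R) :
  (forall j, measurable_fun [set: T] (f j)) ->
  measurable_fun [set: T] (fun x => \prod_(j in B) f j x).
Proof.
move=> mf; under eq_fun do rewrite big_mkcond /=.
elim: (index_enum _) => [|j s IH]; first by under eq_fun do rewrite big_nil; exact: measurable_cst.
under eq_fun do rewrite big_cons.
by apply: measurable_funM => //; case: (j \in B).
Qed.

Lemma integrable_prod mu (B : {set 'I_n}) (f : 'I_n -> T -> R) :
  (mu [set: T] < +oo)%E -> #|B|%:R <= r^-1 -> (forall j, Lr r mu (f j)) ->
  mu.-integrable [set: T] (EFin \o (fun x => \prod_(j in B) f j x)).
Proof.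
move=> muT Br Lf.
have i1 : mu.-integrable [set: T] (EFin \o (fun=> 1 : R)).
  by apply: (@bounded_integrable _ _ _ _ _ 1) => // x; rewrite normr1.
have i2 : mu.-integrable [set: T] (EFin \o (fun x => \sum_j `|f j x| `^ r^-1)).
  have := @integrable_sum _ _ _ mu _ measurableT _ (index_enum 'I_n) xpredT
    (fun j x => (`|f j x| `^ r^-1)%:E) (fun j _ => Lr_powR_integrable (Lf j)).
  by apply: eq_integrable => // x _; rewrite /= sumEFin.
have := integrableD measurableT i1 i2; apply: le_integrable => //.
  by apply/measurable_EFinP; apply: measurable_set_prod => j; exact: (Lf j).1.
move=> x _ /=; rewrite lee_fin normr_prod [leRHS]ger0_norm.
  exact: prod_le_sum_powR.
by rewrite addr_ge0 // sumr_ge0 // => j _; exact: powR_ge0.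
Qed.

(** Dominated convergence, with [C] times the product of the [|H j|] as bound. The [w_ k] are meant
    as densities of varying measures with respect to the fixed [mu], so that moments at varying
    points are compared under one integral. *)
Lemma prod_cvg mu (B : {set 'I_n}) (X_ : nat -> 'I_n -> T -> R) (psi H : 'I_n -> T -> R)
    (w_ : nat -> T -> R) (C : R) :
  (mu [set: T] < +oo)%E -> #|B|%:R <= r^-1 -> (forall j, Lr r mu (H j)) ->
  (forall k j, measurable_fun [set: T] (X_ k j)) ->
  (forall j, measurable_fun [set: T] (psi j)) ->
  (forall k, measurable_fun [set: T] (w_ k)) ->
  (forall k x, `|w_ k x| <= C) -> (forall x, w_ k x @[k --> \oo] --> (1 : R)) ->
  (forall k j x, `|X_ k j x| <= `|H j x|) ->
  (forall j x, X_ k j x @[k --> \oo] --> psi j x) ->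
  \int[mu]_x (\prod_(j in B) X_ k j x * w_ k x) @[k --> \oo] -->
  \int[mu]_x \prod_(j in B) psi j x.
Proof.
move=> muT Br LH mX mpsi mw wC wcv XH Xcv.
have C0 : 0 <= C := le_trans (normr_ge0 _) (wC 0%N point).
have iH : mu.-integrable [set: T] (EFin \o (fun x => \prod_(j in B) H j x)) by exact: integrable_prod.
have ig : mu.-integrable [set: T] (EFin \o (fun x => C * \prod_(j in B) `|H j x|)).
  have := integrableZl measurableT C (integrable_norm iH); apply: eq_integrable => // x _ /=.
  by rewrite normr_prod.
have := @dominated_convergence _ _ _ mu setT measurableT
  (fun k x => (\prod_(j in B) X_ k j x * w_ k x)%:E) (fun x => (\prod_(j in B) psi j x)%:E)
  (EFin \o (fun x => C * \prod_(j in B) `|H j x|)).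
case => //.
- by move=> k; apply/measurable_EFinP; apply: measurable_funM => //; exact: measurable_set_prod.
- by apply/measurable_EFinP; exact: measurable_set_prod.
- apply/aeW => x _; apply: cvg_EFin; first by near=> k.
  rewrite -[X in _ --> X]mulr1; apply: cvgM => //.
  by apply: cvg_big => [|j _]; [exact: mul_continuous|exact: Xcv].
- apply/aeW => x k _; rewrite /= lee_fin normrM mulrC normr_prod.
  by apply: ler_pM => //; [apply: prodr_ge0|apply: ler_prod => j _; rewrite normr_ge0 XH].
move=> ipsi _ h; have fn := integrable_fin_num measurableT ipsi.
by apply: fine_cvg; rewrite /Rintegral fineK.
Unshelve. all: by end_near.
Qed.

End ProductLimit.

Section TestCoefficients.
Variables (R : realType) (cen : bool).

(* Of the power sums of (2, -1, -1) only the first one vanishes. *)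
Definition ucoef (k : 'I_3) : R := if cen then (if k == ord0 then 2 else -1) else 1.

Lemma ucoef_le k : `|ucoef k| <= 2.
Proof.
rewrite /ucoef; case: cen; last by rewrite normr1 ler1n.
by case: eqP => _; rewrite ?normrN1 ?ler1n // ger0_norm.
Qed.

Lemma sum_ucoef m : \sum_k ucoef k ^+ m = if cen then 2 ^+ m + 2 * (-1) ^+ m else 3.
Proof.
rewrite /ucoef; case: cen; last by under eq_bigr do rewrite expr1n; rewrite sumr_const card_ord.
by rewrite !big_ord_recl big_ord0 /= addr0 mulrDl !mul1r.
Qed.

Lemma sum_ucoef1 : cen -> \sum_k ucoef k = 0.
Proof.
move=> c; under eq_bigr do rewrite -[ucoef _]expr1.
by rewrite sum_ucoef c !expr1 mulrN1 subrr.
Qed.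

Lemma sum_ucoef_neq0 m : (cen -> (1 < m)%N) -> \sum_k ucoef k ^+ m != 0.
Proof.
rewrite sum_ucoef; case: cen => [/(_ isT) m1|_]; last by rewrite pnatr_eq0.
rewrite gt_eqF //.
have : 2 ^+ 2 <= 2 ^+ m :> R by rewrite ler_eXn2l // ltr1n.
have : -1 <= (-1) ^+ m :> R.
  by rewrite -signr_odd; case: (odd m); rewrite ?expr1 ?expr0 // lerN10.
lra.
Qed.

End TestCoefficients.

Definition mom (R : realType) n d (T : measurableType d) (m : {measure set T -> \bar R})
  (P : {set {set 'I_n}}) (phi : 'I_n -> T -> R) : R :=
  \prod_(B in P) \int[m]_x \prod_(j in B) phi j x.

Lemma tauP_mom (R : realType) (r : R) n d (T : measurableType d)
    (mu : {measure set T -> \bar R}) (P : {set {set 'I_n}}) phi :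
  ispart P -> tauP r mu P phi = r^-1 ^+ n * mom mu P phi.
Proof.
move=> pP; rewrite /tauP big_split /=; congr (_ * _).
rewrite -expr_sum -(card_partition pP) cardsT card_ord //.
Qed.

(** * Congruent families *)

Section Family.
Variables (R : realType) (r : R) (n : nat) (lam : R) (cen : bool).
Hypotheses (r0 : 0 < r) (r1 : r <= 1) (lam0 : 0 < lam).
(** The common setting of both cases: [M^r] is treated one mass [lam] at a time, [P^r] with
    [lam = 1]. *)
Variable Pt : forall d (T : measurableType d), Type.
Variable pt : forall d (T : measurableType d), Pt T -> {measure set T -> \bar R}.
Variable tang : forall d (T : measurableType d), Pt T -> (T -> R) -> Prop.
Variable Theta : forall d (T : measurableType d), Pt T -> ('I_n -> T -> R) -> R.
Arguments pt {d T} _.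
Arguments tang {d T} _ _.
Arguments Theta {d T} _ _.
Local Notation meanp := (mean (@pt _ _) cen).
Local Notation ctrp := (ctr (@pt _ _) cen).
Local Notation Thc := (Thetac (@pt _ _) cen (@Theta _ _)).
Local Notation tdisc := (disc (None : testspace n)).
Hypothesis ptfin : forall d (T : measurableType d) (p : Pt T), (pt p [set: T] < +oo)%E.
Hypothesis pt1 : forall d (T : measurableType d), cen ->
  forall p : Pt T, fine (pt p [set: T]) = 1.
Hypothesis tangE : forall d (T : measurableType d) (p : Pt T) phi,
  tang p phi <-> Lr r (pt p) phi /\ (cen -> \int[pt p]_x phi x = 0).
Hypothesis tf : forall d (T : measurableType d),
  is_tensor_field r (@pt d T) (@tang d T) (@Theta d T).
Hypothesis mkPt : forall d (T : measurableType d) (m : {measure set T -> \bar R}),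
  m [set: T] = lam%:E -> exists p : Pt T, forall A, measurable A -> pt p A = m A.
Hypothesis congr2 : forall (I : finType) (x0 : I) d (T : measurableType d)
    (K : R.-pker (disc x0) ~> T), congruent K ->
  forall (p : Pt (disc x0)) (p' : Pt T),
    (forall A, measurable A -> pt p' A = push_dens K (pt p) (fun=> 1) A) ->
  forall phi psi, (forall j, tang p (phi j)) ->
    (forall j, is_signed_density (pt p') (psi j) (push_dens K (pt p) (phi j))) ->
    Theta p' psi = Theta p phi.

Let tang_ctrp d (T : measurableType d) (p : Pt T) phi :
  Lr r (pt p) phi -> tang p (ctrp p phi).
Proof. exact: (tang_ctr r0 r1 (@ptfin _ _) (@pt1 _ _) (@tangE _ _)). Qed.

Lemma pt_fin_num d (T : measurableType d) (p : Pt T) A : measurable A ->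
  pt p A \is a fin_num.
Proof.
move=> mA; rewrite ge0_fin_numE //; apply: le_lt_trans (ptfin p).
by apply: le_measure; rewrite ?inE.
Qed.

(** The conditional distributions on the fibres of [kappa] form a congruent kernel from the finite
    space. It carries [p'] to [p], and the vector with coefficient [g] to the one with coefficient
    [g] composed with [kappa]. *)
Lemma Thetac_fibres_pos d (T : measurableType d) (p : Pt T) (I : finType) (x0 : I)
    (kappa : T -> disc x0) (p' : Pt (disc x0)) :
  measurable_fun [set: T] kappa ->
  (forall i, 0 < fine (pt p (kappa @^-1` [set i]))) ->
  (forall i, pt p' [set i] = pt p (kappa @^-1` [set i])) ->
  forall f : 'I_n -> I -> R,
    Thc p (fun j x => f j (kappa x)) =
    Thc p' f.
Proof.
move=> mk pos pp f.
have [K cK KP] := fibre_kernel_exists (ptfin p) mk pos.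
have KE (phi : I -> R) A : measurable A ->
    push_dens K (pt p') phi A = (\int[pt p]_(x in A) (phi (kappa x))%:E)%E.
  move=> mA; rewrite sum_fibres ?ptfin // /push_dens.
  rewrite (eq_integral (fun i => (fine (pt p (A `&` kappa @^-1` [set i])) / fine (pt p (kappa @^-1` [set i])) * phi i)%:E)); last first.
    by move=> i _; rewrite KP // -EFinM.
  rewrite disc_Rintegral ?ptfin //; congr EFin; apply: eq_big => [i|i _]; first by rewrite in_setT.
  by rewrite pp; field; rewrite gt_eqF.
have mkI (i : I) : measurable (kappa @^-1` [set (i : disc x0)]).
  by rewrite -[X in measurable X]setTI; apply: mk.
have meanE j : meanp p (fun x => f j (kappa x)) = meanp p' (f j).
  rewrite /mean; case: ifP => // _; rewrite /Rintegral sum_fibres ?ptfin // disc_Rintegral ?ptfin //=.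
  apply: eq_big => [i|i _]; first by rewrite in_setT.
  by rewrite setTI pp.
rewrite /Thetac; apply: (congr2 (K := K)).
- exact: cK.
- move=> A mA; rewrite (KE (fun=> 1)) // integral_cst // mul1e //.
- move=> j; apply: tang_ctrp.
  apply: (@Lr_bounded _ _ _ _ r0 _ _ (\sum_i `|f j i|)) => // x.
  by rewrite (bigD1 (x : I)) //= lerDl sumr_ge0.
- move=> j; pose g i := f j i - meanp p' (f j).
  have -> : ctrp p (fun x => f j (kappa x)) = fun x => g (kappa x).
    by apply/funext => x; rewrite /ctr meanE.
  have mg : measurable_fun [set: T] (fun x => g (kappa x)).
    exact: (measurableT_comp (f := g : disc x0 -> R)).
  split => //; split; last by move=> A mA; rewrite KE.
  apply: (@bounded_integrable _ _ _ _ _ (\sum_i `|g i|)) => // x.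
  by rewrite (bigD1 (kappa x : I)) //= lerDl sumr_ge0.
Qed.

Lemma Thetac_ae d (T : measurableType d) (p : Pt T) (f g : 'I_n -> T -> R) :
  (forall j, Lr r (pt p) (f j)) -> (forall j, Lr r (pt p) (g j)) ->
  (forall j, {ae pt p, forall x, f j x = g j x}) ->
  Thc p f = Thc p g.
Proof.
move=> Lf Lg fg; have [wd _ _] := @tf d T; apply: wd.
- by move=> j; apply: tang_ctrp.
- by move=> j; apply: tang_ctrp.
move=> j.
have -> : ctrp p (g j) = fun x => g j x - meanp p (f j).
  apply/funext => x; rewrite /ctr; congr (_ - _); rewrite /mean; case: ifP => // _.
  congr fine; apply: ae_eq_integral => //.
  - by apply/measurable_EFinP; have [] := Lg j.
  - by apply/measurable_EFinP; have [] := Lf j.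
  - by apply: filterS (fg j) => y ->.
by apply: filterS (fg j) => x; rewrite /ctr => ->.
Qed.

(** Fibres of mass 0 have no conditional distribution. They are merged with a fibre of positive
    mass, which alters the functions on a null set only, and both spaces are compared with the space
    of atoms of positive mass. *)
Lemma Thetac_fibres d (T : measurableType d) (p : Pt T) (I : finType) (x0 : I)
    (kappa : T -> disc x0) (p' : Pt (disc x0)) :
  measurable_fun [set: T] kappa -> pt p [set: T] = lam%:E ->
  (forall i, pt p' [set i] = pt p (kappa @^-1` [set i])) ->
  forall f : 'I_n -> I -> R,
    Thc p (fun j x => f j (kappa x)) =
    Thc p' f.
Proof.
move=> mk ptT pp f.
have mkI (i : I) : measurable (kappa @^-1` [set (i : disc x0)]).
  by rewrite -[X in measurable X]setTI; apply: mk.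
pose b (i : I) := 0 < fine (pt p (kappa @^-1` [set (i : disc x0)])).
have sumb : \sum_(i : I) fine (pt p (kappa @^-1` [set (i : disc x0)])) = lam.
  have := @sum_fibres _ _ _ (pt p) _ _ kappa (ptfin p) mk (fun=> 1) setT measurableT.
  rewrite integral_cst // mul1e ptT => -[->]; apply: eq_bigr => i _.
  by rewrite setTI mul1r.
have [i0 bi0] : exists i, b i.
  apply/existsP; apply: contraT => /existsPn nb.
  have : \sum_(i : I) fine (pt p (kappa @^-1` [set (i : disc x0)])) = 0.
    apply: big1 => i _; apply/eqP; rewrite eq_le fine_ge0 // andbT leNgt; exact: nb.
  by rewrite sumb => /eqP; rewrite gt_eqF.
pose J : finType := {i : I | b i}.
pose j0 : J := Sub i0 bi0.
pose rho (i : I) : disc j0 := insubd j0 i.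
have rhoV (j : J) : rho (val j) = j by exact: valKd.
have nullb (i : I) : ~~ b i -> fine (pt p (kappa @^-1` [set (i : disc x0)])) = 0.
  by rewrite /b -leNgt => h; apply/eqP; rewrite eq_le h fine_ge0.
pose q (j : J) := \sum_(i | rho i == j) fine (pt p (kappa @^-1` [set (i : disc x0)])).
have q0 j : 0 <= q j by apply: sumr_ge0 => i _; exact: fine_ge0.
have qE (j : J) : q j = fine (pt p (kappa @^-1` [set (val j : disc x0)])).
  rewrite /q (bigD1 (val j)) /= ?rhoV // big1 ?addr0 // => i /andP[/eqP ij ni].
  apply: nullb; apply/negP => bi; move/eqP: ni; apply; rewrite -ij /rho.
  by rewrite -[in LHS](SubK J bi) val_insubd bi.
have [p'' p''E] : exists p'' : Pt (disc j0), forall A, measurable A -> pt p'' A = disc_measure j0 q A.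
  apply: mkPt; rewrite disc_measureT //; congr EFin.
  by rewrite /q -sumb [RHS](partition_big rho predT).
have p''1 (j : disc j0) : pt p'' [set j] = (q j)%:E by rewrite p''E // disc_measure1.
(* both (T, p) and (disc x0, p') are split over the atoms of positive mass *)
have split d' (T' : measurableType d') (s : Pt T') (kap : T' -> disc x0) :
    measurable_fun [set: T'] kap ->
    (forall i, pt s (kap @^-1` [set i]) = pt p (kappa @^-1` [set i])) ->
    Thc s (fun j x => f j (kap x)) =
    Thc p'' (fun j x => f j (val (x : J))).
  move=> mkap sE.
  have mkapI (i : I) : measurable (kap @^-1` [set (i : disc x0)]).
    by rewrite -[X in measurable X]setTI; apply: mkap.
  have mr : measurable_fun [set: T'] (fun x => rho (kap x)).
    exact: (measurableT_comp (f := rho : disc x0 -> disc j0)).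
  have bdd (g : I -> R) : forall x, `|g (kap x)| <= \sum_i `|g i|.
    by move=> x; rewrite (bigD1 (kap x : I)) //= lerDl sumr_ge0.
  have mg (g : I -> R) : measurable_fun [set: T'] (fun x => g (kap x)).
    exact: (measurableT_comp (f := g : disc x0 -> R)).
  have Lg (g : I -> R) : Lr r (pt s) (fun x => g (kap x)).
    exact: (@Lr_bounded _ _ _ _ r0 _ _ (\sum_i `|g i|)).
  have preE (B : pred I) : measurable (kap @^-1` [set i | B i]) /\
      pt s (kap @^-1` [set i | B i]) = (\sum_(i | B i) fine (pt p (kappa @^-1` [set (i : disc x0)])))%:E.
    have mB : measurable (kap @^-1` [set i | B i]).
      by rewrite -[X in measurable X]setTI; apply: mkap.
    split => //.
    have := @sum_fibres _ _ _ (pt s) _ _ kap (ptfin s) mkap (fun i => (B i)%:R) setT measurableT.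
    rewrite (eq_integral (fun x => (\1_(kap @^-1` [set i | B i]) x)%:E)); last first.
      move=> x _; rewrite indicE; have -> // : (x \in kap @^-1` [set i | B i]) = B (kap x).
      by apply/idP/idP => [/set_mem //|h]; exact/mem_set.
    rewrite integral_indic // setIT => ->; congr EFin; rewrite [RHS]big_mkcond /=.
    by apply: eq_bigr => i _; rewrite setTI sE; case: ifP; rewrite ?mul1r ?mul0r.
  have fibE (j : disc j0) : pt s ((fun x => rho (kap x)) @^-1` [set j]) = (q j)%:E.
    have [_ <-] := preE (fun i => rho i == j); congr (pt s _).
    by apply/seteqP; split => x /= /eqP.
  transitivity (Thc s (fun j x => f j (val (rho (kap x) : J)))).
    apply: Thetac_ae => j.
    - exact: Lg.
    - exact: (Lg (fun i => f j (val (rho i : J)))).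
    have [mN N0] := preE (fun i => ~~ b i).
    exists (kap @^-1` [set i | ~~ b i]); split => //.
      by rewrite N0 big1 // => i; exact: nullb.
    move=> x /= nx; apply/negP => bx; apply: nx; congr (f j _).
    by rewrite /rho val_insubd bx.
  apply: (@Thetac_fibres_pos _ _ s _ _ (fun x => rho (kap x)) p'' mr _ _ (fun j x => f j (val (x : J)))).
    by move=> j; rewrite fibE /= qE; exact: (valP (j : J)).
  by move=> j; rewrite fibE p''1.
rewrite (split _ _ p kappa mk) //; symmetry.
exact: (split _ _ p' id).
Qed.

Lemma disc_bounded (I : finType) (x0 : I) (f : I -> R) (x : disc x0) :
  `|f x| <= \sum_i `|f i|.
Proof. by rewrite (bigD1 (x : I)) //= lerDl sumr_ge0. Qed.

Lemma disc_Lr (I : finType) (x0 : I) (p : Pt (disc x0)) (f : I -> R) : Lr r (pt p) f.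
Proof. exact: (@Lr_bounded _ _ _ _ r0 _ _ _ (ptfin p) _ (disc_bounded f)). Qed.

Lemma disc_point (I : finType) (x0 : I) (p : I -> R) : isdist lam p ->
  exists P : Pt (disc x0), forall x : I, pt P [set (x : disc x0)] = (p x)%:E.
Proof.
move=> [p0 pT]; have [P PE] : exists P : Pt (disc x0), forall A, measurable A -> pt P A = disc_measure x0 p A.
  by apply: mkPt; rewrite disc_measureT // pT.
by exists P => x; rewrite PE // disc_measure1.
Qed.

Lemma disc_pointT (I : finType) (x0 : I) (P : Pt (disc x0)) (p : I -> R) A :
  (forall x : I, pt P [set (x : disc x0)] = (p x)%:E) ->
  pt P A = (\sum_(x : I | (x : disc x0) \in A) p x)%:E.
Proof.
move=> PE; have := disc_Rintegral (fun=> 1) A (ptfin P).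
rewrite integral_cst // mul1e => ->; congr EFin; apply: eq_bigr => x _.
by rewrite PE mul1r.
Qed.

Lemma disc_point_mass (I : finType) (x0 : I) (P : Pt (disc x0)) (p : I -> R) :
  isdist lam p -> (forall x : I, pt P [set (x : disc x0)] = (p x)%:E) ->
  pt P [set: disc x0] = lam%:E.
Proof.
move=> [_ pT] PE; rewrite (disc_pointT _ PE) -pT; congr EFin.
by apply: eq_bigl => x; rewrite in_setT.
Qed.

(** A point with weights [p] is chosen, but by [discGE] the value does not depend on the choice. The
    value is 0 when [p] is not a distribution of mass [lam]. *)
Definition discG (I : finType) (x0 : I) (p : I -> R) (f : 'I_n -> I -> R) : R :=
  if pselect (isdist lam p) is left h then
    Thc (sval (cid (disc_point x0 h))) f
  else 0.

Lemma discGE d (T : measurableType d) (P : Pt T) (I : finType) (x0 : I)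
    (kappa : T -> disc x0) (p : I -> R) f :
  measurable_fun [set: T] kappa -> isdist lam p -> pt P [set: T] = lam%:E ->
  (forall x : I, pt P (kappa @^-1` [set (x : disc x0)]) = (p x)%:E) ->
  discG x0 p f = Thc P (fun j x => f j (kappa x)).
Proof.
move=> mk dp PT PE; rewrite /discG; case: pselect => // h.
case: cid => P' /= P'E; symmetry; apply: Thetac_fibres => // i.
by rewrite P'E PE.
Qed.

Lemma discGE1 (I : finType) (x0 : I) (P : Pt (disc x0)) (p : I -> R) f :
  isdist lam p -> (forall x : I, pt P [set (x : disc x0)] = (p x)%:E) ->
  discG x0 p f = Thc P f.
Proof.
move=> dp PE; apply: (@discGE _ _ P I x0 id) => //.
exact: disc_point_mass PE.
Qed.

Lemma mean_lin d (T : measurableType d) (p : Pt T) (c : R) (f g : T -> R) :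
  Lr r (pt p) f -> Lr r (pt p) g ->
  meanp p (fun x => c * f x + g x) =
  c * meanp p f + meanp p g.
Proof.
move=> Lf Lg; rewrite /mean; case: ifP => _; last by rewrite mulr0 addr0.
have fi := Lr_integrable r0 r1 (ptfin p) Lf; have gi := Lr_integrable r0 r1 (ptfin p) Lg.
rewrite RintegralD ?RintegralZl //.
by have := integrableZl measurableT c fi; apply: eq_integrable.
Qed.

Lemma discG_multilinear (I : finType) (x0 : I) p : isdist lam p -> multilinear (@discG I x0 p).
Proof.
move=> dp f j c g; have [P PE] := disc_point x0 dp.
rewrite !(discGE1 _ dp PE) /Thetac.
have [_ ml _] := @tf _ (disc x0).
have tg h : tang P (ctrp P h).
  by apply: tang_ctrp; exact: disc_Lr.
have := ml P (fun j => ctrp P (f j)) j c _ (fun i => tg (f i)) (tg g).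
move=> E; transitivity (c * Theta P (fun j => ctrp P (f j)) +
   Theta P (fun i => if i == j then ctrp P g else ctrp P (f i))).
  rewrite -E; congr (Theta P _); apply/funext => i; rewrite /setslot; case: eqP => // ->.
  apply/funext => x; rewrite /ctr mean_lin; [ring|exact: disc_Lr|exact: disc_Lr].
by congr (_ + Theta P _); apply/funext => i; rewrite /setslot; case: eqP.
Qed.

Lemma discG_push (I J : finType) (x0 : I) (y0 : J) (kappa : I -> J) p f :
  isdist lam p -> discG x0 p (fun j x => f j (kappa x)) = discG y0 (push kappa p) f.
Proof.
move=> dp; have [P PE] := disc_point x0 dp.
have dq : isdist lam (push kappa p).
  split=> [y|]; first by apply: sumr_ge0 => x _; exact: dp.1.
  have := sum_push kappa p (fun=> 1); under eq_bigr do rewrite mulr1.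
  by move=> ->; under eq_bigr do rewrite mulr1; exact: dp.2.
rewrite (discGE1 _ dp PE); symmetry; apply: (@discGE _ _ P J y0 kappa) => //.
  exact: disc_point_mass PE.
move=> y; rewrite (disc_pointT _ PE); congr EFin; apply: eq_bigl => x.
by apply/idP/eqP => [/set_mem //|h]; exact/mem_set.
Qed.

Lemma disc_Lcvg (I : finType) (x0 : I) (P_ : nat -> Pt (disc x0)) (P : Pt (disc x0))
    (p_ : nat -> I -> R) (p : I -> R) :
  (forall k x, 0 <= p_ k x) -> (forall x, 0 <= p x) ->
  (forall k (x : I), pt (P_ k) [set (x : disc x0)] = (p_ k x)%:E) ->
  (forall x : I, pt P [set (x : disc x0)] = (p x)%:E) ->
  (forall x, p_ k x @[k --> \oo] --> p x) -> Lcvg (@pt _ (disc x0)) P_ P.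
Proof.
move=> p_0 p0 P_E PE cvp e e0.
(* Counting measure dominates all the points, with the weights themselves as densities. *)
have sm : (disc_measure x0 (fun=> 1%R : R) [set: disc x0] < +oo)%E.
  by rewrite disc_measureT // ltry.
have [rho rhoE] := finite_measure_of sm.
have rhoT : (rho [set: disc x0] < +oo)%E by rewrite rhoE.
have rho1 (x : I) : fine (rho [set (x : disc x0)]) = 1 by rewrite rhoE disc_measure1.
have dens (Q : Pt (disc x0)) (q : I -> R) : (forall x, 0 <= q x) ->
    (forall x : I, pt Q [set (x : disc x0)] = (q x)%:E) -> is_density rho (q : disc x0 -> R) (pt Q).
  move=> q0 QE; split => //; split => // A mA.
  rewrite (disc_pointT _ QE) (disc_Rintegral q A rhoT); congr EFin; apply: eq_bigr => x _.
  by rewrite -[LHS]mulr1; congr (_ * _); rewrite -[LHS](rho1 x).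
have : \sum_x `|p x - p_ k x| @[k --> \oo] --> \sum_(x : I) (0 : R).
  apply: cvg_big => [|x _]; first exact: add_continuous.
  rewrite -(normr0 R) -(subrr (p x)); apply: cvg_norm; apply: cvgB => //; exact: cvg_cst.
rewrite big1 // => /cvgrPdist_le /(_ e e0); apply: filterS => k.
rewrite sub0r normrN ger0_norm ?sumr_ge0 // => hk.
exists rho, p, (p_ k); split; [exact: dens|exact: dens|].
rewrite (disc_Rintegral (fun x => `|p x - p_ k x|) setT rhoT) lee_fin; apply: le_trans hk.
rewrite le_eqVlt; apply/orP; left; apply/eqP; apply: eq_big => [x|x _]; first by rewrite in_setT.
by rewrite -[RHS]mulr1; congr (_ * _); exact: rho1.
Qed.

Lemma discG_cvg (I : finType) (x0 : I) (p_ : nat -> I -> R) p f :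
  (forall k, isdist lam (p_ k)) -> isdist lam p ->
  (forall x, p_ k x @[k --> \oo] --> p x) ->
  discG x0 (p_ k) f @[k --> \oo] --> discG x0 p f.
Proof.
move=> dp_ dp cvp; have [P PE] := disc_point x0 dp.
have [P_ P_E] := choice (fun k => disc_point x0 (dp_ k)).
rewrite (discGE1 _ dp PE); under eq_fun do rewrite (discGE1 _ (dp_ _) (P_E _)).
apply: (Thetac_cvg r0 r1 (@ptfin _ _) (@pt1 _ _) (@tangE _ _) (@tf _ _) (M := \sum_j \sum_i `|f j i|)) => //.
- by apply: disc_Lcvg cvp => //; [move=> k x; exact: (dp_ k).1|exact: dp.1].
- move=> j x; apply: (le_trans (disc_bounded (f j) x)).
  by rewrite [leRHS](bigD1 j) //= lerDl sumr_ge0 // => k _; exact: sumr_ge0.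
Qed.

Lemma Thetac_moments : exists a, forall d (T : measurableType d) (p : Pt T)
    (I : finType) (x0 : I) (kappa : T -> disc x0) (f : 'I_n -> I -> R),
  pt p [set: T] = lam%:E -> measurable_fun [set: T] kappa ->
  Thc p (fun j x => f j (kappa x)) =
  \sum_(P | ispart P) a P * mom (pt p) P (fun j x => f j (kappa x)).
Proof.
have [a Ha] := finite_moments lam0 discG_multilinear discG_push discG_cvg.
exists a => d T p I x0 kappa f pT mk.
have mkI (i : I) : measurable (kappa @^-1` [set (i : disc x0)]).
  by rewrite -[X in measurable X]setTI; apply: mk.
pose q (i : I) := fine (pt p (kappa @^-1` [set (i : disc x0)])).
have int (g : I -> R) : \int[pt p]_x g (kappa x) = \sum_i q i * g i.
  rewrite /Rintegral sum_fibres ?ptfin //=; apply: eq_bigr => i _.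
  by rewrite setTI mulrC.
have dq : isdist lam q.
  split=> [x|]; first exact: fine_ge0.
  have := int (fun=> 1); under eq_bigr do rewrite mulr1.
  by move=> <-; rewrite Rintegral_cst // mul1r pT.
rewrite -(@discGE _ _ p I x0 kappa q f) // ?(Ha _ x0) //.
  by apply: eq_bigr => P _; congr (_ * _); apply: eq_bigr => B _; rewrite (int (fun i => \prod_(j in B) f j i)).
by move=> x; rewrite /q fineK // pt_fin_num.
Qed.

Lemma mom_disc (I : finType) (x0 : I) (P : Pt (disc x0)) (p : I -> R)
    (f : 'I_n -> I -> R) Q :
  (forall x : I, pt P [set (x : disc x0)] = (p x)%:E) -> mom (pt P) Q f = smom p Q f.
Proof.
move=> PE; apply: eq_bigr => B _.
rewrite /Rintegral (disc_Rintegral (fun x => \prod_(j in B) f j x) setT (ptfin P)) /=.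
rewrite (eq_bigl predT) => [|x]; last by rewrite in_setT.
by apply: eq_bigr => x _; rewrite PE mulrC.
Qed.

Lemma Theta_slot0 d (T : measurableType d) (p : Pt T) (phi : 'I_n -> T -> R) j :
  (forall i, tang p (phi i)) -> phi j = (fun=> 0) -> Theta p phi = 0.
Proof.
move=> tphi z; have [_ ml _] := @tf d T.
have t0 : tang p (fun=> 0) by rewrite -z.
have E1 : (fun i => if i == j then (fun x => 1 * phi i x + 0) else phi i) = phi.
  apply/funext => i; case: eqP => // ->; apply/funext => x; by rewrite mul1r addr0.
have E2 : (fun i => if i == j then (fun=> 0) else phi i) = phi.
  by apply/funext => i; case: eqP => // ->; rewrite z.
have := ml p phi j 1 (fun=> 0) tphi t0.
rewrite E1 E2 mul1r => /eqP; rewrite -subr_eq0 opprD addNKr oppr_eq0.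
by move/eqP.
Qed.

(** * Vanishing of the coefficients with large blocks, and the formula for all tangent vectors *)

Section Coefficients.
Variable a : {set {set 'I_n}} -> R.
Hypothesis Ha : forall d (T : measurableType d) (p : Pt T)
    (I : finType) (x0 : I) (kappa : T -> disc x0) (f : 'I_n -> I -> R),
  pt p [set: T] = lam%:E -> measurable_fun [set: T] kappa ->
  Thc p (fun j x => f j (kappa x)) =
  \sum_(P | ispart P) a P * mom (pt p) P (fun j x => f j (kappa x)).
Local Notation pblock := finset.pblock.
Local Notation u := (ucoef R cen).

Lemma Thetac_disc (I : finType) (x0 : I) (P : Pt (disc x0)) (p : I -> R)
    (f : 'I_n -> I -> R) :
  isdist lam p -> (forall x : I, pt P [set (x : disc x0)] = (p x)%:E) ->
  Thc P f = @smomsum R n a I p f.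
Proof.
move=> dp PE; rewrite (@Ha _ _ P I x0 id) //; last exact: (disc_point_mass dp PE).
by apply: eq_bigr => Q _; rewrite (mom_disc _ _ PE).
Qed.

(** Induction from the finest partitions. The atoms of [B0] get mass [e] tending to 0 and the slots
    of [B0] carry [blowup]. The tensor is then a constant times [e^(-s m)] times the moment sum and
    tends to 0, so the moment sum is [o(e)]; by [blowup_limit] its coefficient of [e] is [a P] times
    a nonzero number. *)
Lemma coef_eq0_large (B0 : {set 'I_n}) : r^-1 < #|B0|%:R -> forall P, ispart P ->
  (cen -> forall B, B \in P -> (1 < #|B|)%N) -> B0 \in P -> a P = 0.
Proof.
move=> rB0; apply: (@ispart_ind _ (fun P => (cen -> forall B, B \in P -> (1 < #|B|)%N) -> B0 \in P -> a P = 0)).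
move=> P pP IH cP B0P.
have rV := rV_gt0 r0.
set m : R := #|B0|%:R in rB0.
have m0 : 0 < m by rewrite (lt_trans rV).
have mr : m^-1 < r by rewrite -[ltRHS]invrK ltf_pV2 ?posrE.
(* The midpoint of [1/m] and [r]: [s < r] makes the field continuous, [s * m > 1] makes the blow-up
   outweigh one power of the mass. *)
pose s := (m^-1 + r) / 2.
have s0 : 0 < s by rewrite divr_gt0 // addr_gt0 // invr_gt0.
have sr : s < r by rewrite /s ltr_pdivrMr // mulrDr mulr1 ltrD2r.
have sm : 1 < s * m.
  have : m^-1 < s by rewrite /s ltr_pdivlMr // mulrDr mulr1 ltrD2l.
  by rewrite -[X in _ -> X < _](mulVf (lt0r_neq0 m0)) ltr_pM2r.
pose S := ({set 'I_n} * 'I_3)%type.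
pose w := lam / #|{: S}|%:R.
have cS : 0 < #|{: S}|%:R :> R by rewrite ltr0n; apply/card_gt0P; exists (B0, ord0).
have w0 : 0 < w by rewrite divr_gt0.
pose q (e : R) (x : S) := if x.1 == B0 then e else w.
(* Only the atoms labelled [B0] shrink. [None] takes up what they lose, and [w] is chosen so that
   its mass is nonnegative. *)
pose peps (e : R) (z : testspace n) : R := if z is Some x then q e x else lam - \sum_x q e x.
have dpeps e : 0 <= e -> e <= w -> isdist lam (peps e).
  move=> e0 ew; split; last by rewrite (big_option (peps e)) /= subrK.
  case=> [x|] /=; first by rewrite /q; case: ifP => _ //; exact: ltW.
  rewrite subr_ge0; apply: (@le_trans _ _ (\sum_(x : S) w)).
    by apply: ler_sum => x _; rewrite /q; case: ifP.
  by rewrite sumr_const -[leLHS]mulr_natr /w divfK // gt_eqF.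
pose e_ (k : nat) : R := w / k.+1%:R.
have e_0 k : 0 < e_ k by rewrite divr_gt0.
have e_w k : e_ k <= w by rewrite ler_pdivrMr // ler_pMr // ler1n.
have e_cv : e_ k @[k --> \oo] --> 0.
  by rewrite -(mulr0 w); apply: cvgMr; exact: cvg_harmonic.
have [Q0 Q0E] := disc_point None (dpeps 0 (lexx 0) (ltW w0)).
have [Q_ Q_E] := choice (fun k => disc_point None (dpeps (e_ k) (ltW (e_0 k)) (e_w k))).
have QQ : Lcvg (@pt _ (tdisc)) Q_ Q0.
  apply: (disc_Lcvg _ _ Q_E Q0E).
  - by move=> k x; exact: (dpeps (e_ k) (ltW (e_0 k)) (e_w k)).1.
  - by move=> x; exact: (dpeps 0 (lexx 0) (ltW w0)).1.
  have qcv x : q (e_ k) x @[k --> \oo] --> q 0 x.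
    by rewrite /q; case: ifP => _; [exact: e_cv|exact: cvg_cst].
  case=> [x|] /=; first exact: qcv.
  apply: cvgB; first exact: cvg_cst.
  by apply: cvg_big => [|x _]; [exact: add_continuous|exact: qcv].
pose A : set (tdisc) :=
  [set z | if z is Some x then x.1 == B0 else false].
have massA (Q : Pt (tdisc)) e :
    (forall x : testspace n, pt Q [set (x : tdisc)] = (peps e x)%:E) ->
    fine (pt Q A) = #|[pred x : S | x.1 == B0]|%:R * e.
  move=> QE; rewrite (disc_pointT _ QE) /= big_mkcond /= (big_option (fun x => if _ then peps e x else 0)) /=.
  rewrite ifF ?add0r; last by apply/negP => /set_mem.
  rewrite -big_mkcond /= (eq_bigl (fun x : S => x.1 == B0)); last first.
    by move=> x; apply/idP/idP => [/set_mem //|h]; exact/mem_set.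
  rewrite (eq_bigr (fun=> e)); last by move=> x; rewrite /q => ->.
  by rewrite sumr_const mulr_natl.
pose c3 : R := #|[pred x : S | x.1 == B0]|%:R.
have c30 : 0 < c3 by rewrite ltr0n; apply/card_gt0P; exists (B0, ord0); rewrite inE.
pose tst j : tdisc -> R := testfun P u j.
have tstM j x : `|tst j x| <= 2.
  rewrite /tst; case: x => [x|] /=; last by rewrite normr0.
  by case: eqP => _; rewrite ?mul1r ?mul0r ?normr0 // ucoef_le.
have tstA j : j \in B0 -> forall x, ~ A x -> tst j x = 0.
  move=> jB0 [x|] //= nx; rewrite (ispart_def_pblock pP B0P jB0).
  by case: eqP => [E|]; rewrite ?mul0r //; case: nx; rewrite /A /= E.
pose Y j Q : tdisc -> R :=
  if j \in B0 then blowup (@pt _ _) A (tst j) s Q else tst j.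
pose X j Q := ctrp Q (Y j Q).
have tX j Q : tang Q (X j Q).
  by apply: tang_ctrp; exact: disc_Lr.
have cX j q0 q_ : Lcvg (@pt _ (tdisc)) q_ q0 -> field_cvg r (@pt _ _) (X j) q_ q0.
  move=> qq; rewrite /X /Y; case: (boolP (j \in B0)) => jB0.
    apply: (blowup_cvg r0 r1 (@ptfin _ _) (@pt1 _ _) (Mu := 2) (A := A) (u := tst j)) => //.
    exact: tstA.
  apply: (field_cvg_unif r0 r1 (@ptfin _ _) (@pt1 _ _) (Y := fun=> tst j) (M := 2)) => //.
  by move=> e e0; near=> k => x; rewrite subrr normr0 ltW.
have lim0 := tensor_seq r0 r1 (@ptfin _ _) (@tf _ _) tX cX QQ.
have [j0 j0B0] := ispart_nonempty pP B0P.
(* At the limit point [A] is null, so the slot [j0] vanishes there, and with it the tensor. *)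
rewrite (@Theta_slot0 _ _ Q0 (fun j => X j Q0) j0) in lim0 => //; last first.
  rewrite /X /Y j0B0; apply: blowup_null => //.
  by rewrite (massA Q0 0 Q0E) mulr0.
have ThE k : Theta (Q_ k) (fun j => X j (Q_ k)) =
    ((c3 * e_ k) `^ (- s)) ^+ #|B0| * smomsum a (peps (e_ k)) (testfun P u).
  pose sc j := if j \in B0 then (c3 * e_ k) `^ (- s) else 1.
  have -> : ((c3 * e_ k) `^ (- s)) ^+ #|B0| = \prod_j sc j.
    by rewrite /sc -big_mkcond /= prodr_const.
  rewrite -multilinear_scale; last exact: smomsum_multilinear.
  rewrite -(Thetac_disc _ (dpeps (e_ k) (ltW (e_0 k)) (e_w k)) (Q_E k)).
  congr (Theta _ _); apply/funext => j; congr (ctr _ _ _ _); apply/funext => x.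
  rewrite /Y /sc; case: ifP => _; last by rewrite mul1r.
  by rewrite /blowup (massA (Q_ k) (e_ k) (Q_E k)).
(* S(e) = o(e^(s m)) with s m > 1 forces the coefficient of e in S to vanish *)
have lim1 : (e_ k)^-1 * smomsum a (peps (e_ k)) (testfun P u) @[k --> \oo] --> 0.
  have c3e k : 0 < c3 * e_ k by rewrite mulr_gt0.
  have E k : (e_ k)^-1 * smomsum a (peps (e_ k)) (testfun P u) =
     c3 * (c3 * e_ k) `^ (s * m - 1) * Theta (Q_ k) (fun j => X j (Q_ k)).
    rewrite ThE mulrA; congr (_ * _).
    rewrite -powR_mulrn ?powR_ge0 // -powRrM mulNr -/m -mulrA -powRD; last first.
      by rewrite (lt0r_neq0 (c3e k)) implybT.
    rewrite addrAC subrr sub0r powRN powRr1 ?(ltW (c3e k)) //.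
    by field; rewrite (lt0r_neq0 c30) (lt0r_neq0 (e_0 k)).
  under eq_fun do rewrite E.
  apply: (@norm_cvg0 R R).
  have bd k : `|c3 * (c3 * e_ k) `^ (s * m - 1) * Theta (Q_ k) (fun j => X j (Q_ k))| <=
      c3 * (c3 * w) `^ (s * m - 1) * `|Theta (Q_ k) (fun j => X j (Q_ k))|.
    rewrite normrM ler_wpM2r // ger0_norm ?mulr_ge0 ?powR_ge0 ?(ltW c30) //.
    rewrite ler_wpM2l ?(ltW c30) //; apply: ge0_ler_powR.
    - by rewrite subr_ge0 ltW.
    - by rewrite nnegrE ltW.
    - by rewrite nnegrE mulr_ge0 // ltW.
    - by rewrite ler_wpM2l // ltW.
  apply: (@squeeze_cvgr _ _ _ _ (fun=> 0) (fun k => c3 * (c3 * w) `^ (s * m - 1) * `|Theta (Q_ k) (fun j => X j (Q_ k))|)).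
  - by near=> k; rewrite normr_ge0 bd.
  - exact: cvg_cst.
  - rewrite -(mulr0 (c3 * (c3 * w) `^ (s * m - 1))) -(normr0 R); apply: cvgMr.
    exact: cvg_norm lim0.
have lim2 := @blowup_limit R n a P B0 u w e_ (fun k => peps (e_ k)) pP B0P
   (fun k => lt0r_neq0 (e_0 k)) e_cv.
have {}lim2 := lim2 (fun k B i => erefl).
(* Such a [Q] has more blocks than [P]. Either the induction hypothesis applies, or, in the case of
   [P^r], [Q] has a singleton and the first power sum of [u] is 0. *)
have aQ Q : ispart Q -> refines Q P -> B0 \in Q -> Q != P ->
     a Q * \prod_(C in Q) \sum_i u i ^+ #|C| = 0.
  move=> pQ rQ B0Q QP.
  have PQ : (#|P| < #|Q|)%N.
    by rewrite ltnNge; apply: contra QP => QleP; apply/eqP; exact: refines_eq.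
  have [cc|] := pselect (cen -> forall B, B \in Q -> (1 < #|B|)%N).
    by rewrite (IH Q pQ PQ cc B0Q) mul0r.
  move=> /not_implyP[c1 /existsNP[B /not_implyP[BQ]]] /negP; rewrite -leqNgt => B1.
  rewrite (bigD1 B) //=.
  have -> : #|B| = 1%N.
    apply/eqP; rewrite eqn_leq B1 card_gt0; have [y yB] := ispart_nonempty pQ BQ.
    by apply/finset.set0Pn; exists y.
  by under eq_bigr do rewrite expr1; rewrite sum_ucoef1 // mul0r mulr0.
have {}lim2 := lim2 aQ.
have := cvg_lim (@Rhausdorff R) lim2; rewrite (cvg_lim (@Rhausdorff R) lim1) => h.
have /esym/eqP := h (@eventually_filter : ProperFilter \oo); rewrite mulf_eq0 => /orP[/eqP //|]; rewrite mulf_eq0 => /orP[|].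
  by rewrite (negbTE (sum_ucoef_neq0 _ _ )) // => c1; exact: cP.
rewrite prodf_seq_eq0 => /hasP[B _ /andP[/andP[BP _]]].
rewrite mulf_eq0 gt_eqF //= (negbTE (sum_ucoef_neq0 _ _ )) // => c1; exact: cP.
Unshelve. all: by end_near.
Qed.

Definition adm (P : {set {set 'I_n}}) := if cen then admissibleP r P else admissibleM r P.

Lemma adm_ispart P : adm P -> ispart P.
Proof. by rewrite /adm; case: cen => /andP[]. Qed.

Lemma adm_card P B : adm P -> B \in P -> #|B|%:R <= r^-1.
Proof.
by rewrite /adm; case: cen => /andP[_ /forall_inP H] /H => [/andP[]|].
Qed.

(** In the case of [P^r] a partition with a singleton contributes nothing, since tangent vectors
    have mean 0. Every other inadmissible partition has a block larger than 1/r, and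
    [coef_eq0_large] makes its coefficient vanish. *)
Lemma Theta_simple d (T : measurableType d) (p : Pt T) phi : pt p [set: T] = lam%:E ->
  (forall j, tang p (phi j)) -> (forall j, simple (phi j)) ->
  Theta p phi = \sum_(P | adm P) a P * mom (pt p) P phi.
Proof.
move=> pT tp sp; have [I [x0 [kappa [f [mk E]]]]] := simple_factor sp.
rewrite -(Thetac_tang (@tangE d T) (@Theta d T) tp) {1}E (Ha f pT mk) -E.
rewrite (bigID adm) /= [X in _ + X]big1 ?addr0.
  by apply: eq_bigl => P; case: (boolP (adm P)) => [/adm_ispart ->|]; rewrite ?andbF.
move=> P /andP[pP nadm].
have [[c1 [C CP C1]]|nsing] := pselect (cen /\ exists2 B, B \in P & (#|B| <= 1)%N).
  rewrite /mom (bigD1 C) //=.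
  have /cards1P[j ->] : #|C| == 1%N.
    rewrite eqn_leq C1 card_gt0; apply/finset.set0Pn.
    by have [y yC] := ispart_nonempty pP CP; exists y.
  under eq_Rintegral do rewrite finset.big_set1.
  by have /tangE[_ ->] := tp j; rewrite ?mul0r ?mulr0.
have big : exists2 B, B \in P & r^-1 < #|B|%:R.
  apply: contrapT => nb; move/negP: nadm; apply; rewrite /adm.
  have Hb B : B \in P -> #|B|%:R <= r^-1.
    by move=> BP; rewrite leNgt; apply/negP => h; apply: nb; exists B.
  case: (boolP cen) => c1; apply/andP; split => //; apply/forall_inP => B BP; last exact: Hb.
  rewrite Hb // andbT ltnNge; apply/negP => B1; apply: nsing; split => //; by exists B.
have [B BP rB] := big.
rewrite (coef_eq0_large rB pP) ?mul0r // => c1 C CP.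
by rewrite ltnNge; apply/negP => C1; apply: nsing; split => //; exists C.
Qed.

Lemma mom_ae d (T : measurableType d) (p : Pt T) P (phi psi : 'I_n -> T -> R) :
  (forall j, measurable_fun [set: T] (phi j)) -> (forall j, measurable_fun [set: T] (psi j)) ->
  (forall j, {ae pt p, forall x, phi j x = psi j x}) -> mom (pt p) P phi = mom (pt p) P psi.
Proof.
move=> m1 m2 E; apply: eq_bigr => B _; congr fine.
have all_ae : {ae pt p, forall x, forall j, phi j x = psi j x}.
  exact: filter_forall.
apply: ae_eq_integral => //; try (apply/measurable_EFinP; exact: measurable_set_prod).
apply: filterS all_ae => x h _; congr EFin; apply: eq_bigr => j _; exact: h.
Qed.

Lemma measurable_set_gt0 d (T : measurableType d) (f : T -> R) :
  measurable_fun [set: T] f -> measurable [set x | 0 < f x].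
Proof.
move=> mf; rewrite (_ : [set x | _] = [set: T] `&` f @^-1` `]0, +oo[%classic).
  exact: mf.
by rewrite setTI; apply/seteqP; split => x; rewrite /= in_itv /= andbT.
Qed.

(** If [f] has integral 0, the set where [f > 0] has mass 0 or [lam]. In the second case [f] equals
    [|f|] almost everywhere, so [f] is 0 almost everywhere and the set is null after all. This is
    applied to [phi - c] and to [c - phi]. *)
Lemma trivial_measure_cst d (T : measurableType d) (p : Pt T) (phi : T -> R) :
  pt p [set: T] = lam%:E -> Lr r (pt p) phi ->
  (forall A, measurable A -> fine (pt p A) = 0 \/ fine (pt p A) = lam) ->
  {ae pt p, forall x, phi x = \int[pt p]_x phi x / lam}.
Proof.
move=> pT Lphi triv; set c := _ / lam.
have ip := Lr_integrable r0 r1 (ptfin p) Lphi.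
have fn A : measurable A -> pt p A \is a fin_num by exact: pt_fin_num.
have ic : (pt p).-integrable [set: T] (EFin \o (fun=> c)).
  exact: (@bounded_integrable _ _ _ _ _ `|c|).
have idf : (pt p).-integrable [set: T] (EFin \o (fun x => phi x - c)).
  by have := integrableB measurableT ip ic; apply: eq_integrable.
have I0 : \int[pt p]_x (phi x - c) = 0.
  by rewrite RintegralB // Rintegral_cst // pT /= divfK ?subrr // gt_eqF.
have mdf : measurable_fun [set: T] (fun x => phi x - c).
  by apply: measurable_funB => //; exact: Lphi.1.
have half (f : T -> R) : (pt p).-integrable [set: T] (EFin \o f) ->
    \int[pt p]_x f x = 0 -> pt p [set x | 0 < f x] = 0%E.
  move=> fi f0; have mf : measurable_fun [set: T] f by apply/measurable_EFinP; exact: measurable_int fi.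
  have mA : measurable [set x | 0 < f x].
    exact: measurable_set_gt0.
  have [z|z] := triv _ mA; first by rewrite -[LHS]fineK ?z // fn.
  have nA : pt p (~` [set x | 0 < f x]) = 0%E.
    have : pt p [set: T] = (pt p [set x | (0 < f x)%R] + pt p (~` [set x | (0 < f x)%R]))%E.
      by rewrite -measureU ?setUv ?setICr //; exact: measurableC.
    rewrite pT -(fineK (fn _ mA)) z -(fineK (fn _ (measurableC mA))) -EFinD => -[E].
    by congr EFin; move: E; lra.
  have ae_pos : ae_eq (pt p) [set: T] (EFin \o f) (abse \o (EFin \o f)).
    exists (~` [set x | 0 < f x]); split => //; first exact: measurableC.
    by move=> x /= + /ltW h; apply => _; rewrite ger0_norm.
  have z0 : (\int[pt p]_x `|(f x)%:E| = 0)%E.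
    have <- : (\int[pt p]_x (f x)%:E = \int[pt p]_x `|(f x)%:E|)%E.
      apply: ae_eq_integral => //; first exact: measurable_int fi.
      by apply: measurableT_comp => //; exact: measurable_int fi.
    by rewrite -[LHS]fineK ?(integrable_fin_num _ fi) // -[fine _]/(Rintegral _ _ _) f0.
  have /(ae_eq_integral_abs (pt p) measurableT (measurable_int _ fi)) [N [mN N0 sub]] := z0.
  apply/eqP; rewrite eq_le measure_ge0 andbT -N0; apply: le_measure; rewrite ?inE //.
  move=> x /= fx; apply: sub => /= H; have [/eqP] := H I; by rewrite gt_eqF.
have h1 := half _ idf I0.
have h2 : pt p [set x | 0 < - (phi x - c)] = 0%E.
  apply: half; first by have := integrableN idf; apply: eq_integrable.
  have := RintegralZl (-1) measurableT idf; rewrite I0 mulr0 => <-.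
  by apply: eq_Rintegral => x _; rewrite mulN1r.
have mA1 : measurable [set x | 0 < phi x - c].
  exact: measurable_set_gt0.
have mA2 : measurable [set x | 0 < - (phi x - c)].
  by apply: measurable_set_gt0; exact: measurableT_comp.
exists ([set x | 0 < phi x - c] `|` [set x | 0 < - (phi x - c)]); split.
- exact: measurableU.
- by rewrite measureU0.
- move=> x /= ne; have [h|h|h] := ltgtP (phi x) c.
  + by right; rewrite oppr_gt0 subr_lt0.
  + by left; rewrite subr_gt0.
  + by case: ne.
Qed.

(** A fraction [e_ k] of the mass is moved onto [A]: take [(1 - e) p0] plus [e c] times [p0]
    restricted to [A], where [c] is such that the total remains [lam]. The measure of [A] grows by
    [e (lam - p0 A)], which is positive, and the density is at most [1 + c]. *)
Lemma perturbation d (T : measurableType d) (p0 : Pt T) A :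
  pt p0 [set: T] = lam%:E -> measurable A -> 0 < fine (pt p0 A) -> fine (pt p0 A) < lam ->
  exists (p_ : nat -> Pt T) (w_ : nat -> T -> R) (C : R),
   [/\ Lcvg (@pt d T) p_ p0, forall k, pt (p_ k) [set: T] = lam%:E,
       forall k, 0 < tv (pt p0) (pt (p_ k)),
       forall k, is_density (pt p0) (w_ k) (pt (p_ k)) &
       (forall k x, `|w_ k x| <= C) /\ (forall x, w_ k x @[k --> \oo] --> (1 : R))].
Proof.
move=> pT mA A0 Alam.
pose c := lam / fine (pt p0 A); have c0 : 0 < c by rewrite divr_gt0.
pose e_ (k : nat) : R := k.+1%:R^-1.
have e0 k : 0 < e_ k by rewrite invr_gt0.
have e1 k : e_ k <= 1 by rewrite invf_le1 // ler1n.
have ecv : e_ k @[k --> \oo] --> 0 by exact: cvg_harmonic.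
have fA B : measurable B -> pt p0 B \is a fin_num by exact: pt_fin_num.
have s1 k : 0 <= 1 - e_ k by rewrite subr_ge0.
have s2 k : 0 <= e_ k * c by rewrite mulr_ge0 // ltW.
pose nu k : {measure set T -> \bar R} :=
  measure_add (mscale (NngNum (s1 k)) (pt p0)) (mscale (NngNum (s2 k)) (mrestr (pt p0) mA)).
have nuE k B : nu k B = ((1 - e_ k)%:E * pt p0 B + (e_ k * c)%:E * pt p0 (B `&` A))%E.
  by apply: (etrans (measure_addE _ _ _)).
have nuT k : nu k [set: T] = lam%:E.
  rewrite nuE setTI pT -[pt p0 A]fineK ?fA // -!EFinM -EFinD; congr EFin.
  by rewrite /c; field; rewrite gt_eqF.
have [p_ pE] := choice (fun k => mkPt (nuT k)).
pose w_ k x : R := (1 - e_ k) * 1 + (e_ k * c) * \1_A x.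
have w0 k x : 0 <= w_ k x by rewrite addr_ge0 // mulr_ge0.
have mw k : measurable_fun [set: T] (w_ k).
  by apply: measurable_funD => //; apply: measurable_funM.
have dens k : is_density (pt p0) (w_ k) (pt (p_ k)).
  split => //; split => // B mB; rewrite pE // nuE.
  under eq_integral do rewrite EFinD !EFinM.
  rewrite ge0_integralD //.
  - rewrite (_ : (fun x : T => ((1 - e_ k)%:E * 1%:E)%E) = cst (1 - e_ k)%:E); last first.
      by apply/funext => x; rewrite mule1.
    rewrite integral_cst // ge0_integralZl_EFin ?integral_indic //.
    + by rewrite setIC.
    + by apply/measurable_EFinP; exact: measurable_funTS.
  - by move=> x _; rewrite mule1 lee_fin.
  - by move=> x _; rewrite -EFinM lee_fin mulr_ge0.
  - by apply: measurable_funeM; apply/measurable_EFinP; exact: measurable_funTS.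
have ind x : 0 <= (\1_A x : R) <= 1 by rewrite indicE; case: (_ \in _); rewrite ?lexx ler01.
exists p_, w_, (1 + c); split => //.
- move=> e E0.
  have [rho rhoE] := finite_measure_of (ptfin p0).
  pose K := (1 + c) * lam; have K0 : 0 < K by rewrite mulr_gt0 // addr_gt0.
  near=> k.
  have ek : e_ k * K <= e.
    rewrite -ler_pdivlMr //; near: k; move/cvgrPdist_le: ecv => /(_ (e / K)).
    rewrite divr_gt0 // => /(_ isT); apply: filterS => k.
    by rewrite sub0r normrN gtr0_norm.
  have rint_ D f : (\int[rho]_(x in D) f x = \int[pt p0]_(x in D) f x)%E.
    by apply: eq_measure_integral => B _ _; exact: rhoE.
  exists rho, (fun=> 1), (w_ k); split.
  + by split => //; split => // B mB; rewrite rint_ integral_cst // mul1e.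
  + have [m1 [m2 m3]] := dens k; split => //; split => // B mB; rewrite rint_; exact: m3.
  rewrite rint_.
  apply: (@le_trans _ _ (\int[pt p0]_x (e_ k * (1 + c))%:E)%E).
    apply: ge0_le_integral => //.
      by apply/measurable_EFinP; apply: measurableT_comp => //; apply: measurable_funB.
    move=> x _; rewrite lee_fin /w_ (_ : _ - _ = e_ k * (1 - c * \1_A x)); last by ring.
    rewrite normrM gtr0_norm // ler_pM2l //.
    have /andP[i0 i1] := ind x; apply: (le_trans (ler_normB _ _)).
    rewrite normr1 lerD2l normrM !ger0_norm ?(ltW c0) //.
    by rewrite ler_piMr // ltW.
  by rewrite integral_cst // pT -EFinM lee_fin -mulrA.
- by move=> k; rewrite pE.
- move=> k; apply: lt_le_trans (tv_ub (ptfin p0) (ptfin (p_ k)) mA).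
  rewrite normr_gt0 pE // nuE setIid -[pt p0 A]fineK ?fA // -!EFinM -EFinD /=.
  rewrite (_ : _ - _ = e_ k * (fine (pt p0 A) - lam)); last by rewrite /c; field; rewrite gt_eqF.
  by apply: mulf_neq0; [rewrite gt_eqF|rewrite subr_eq0 lt_eqF].
split => [k x|x].
  have /andP[i0 i1] := ind x; rewrite ger0_norm // /w_ mulr1; apply: lerD.
    by rewrite gerBl ltW.
  apply: (@le_trans _ _ (1 * c * 1)); last by rewrite mul1r mulr1.
  by apply: ler_pM => //; rewrite ler_wpM2r // ltW.
rewrite /w_ -[X in _ --> X](_ : (1 - 0) * 1 + (0 * c) * \1_A x = 1); last by ring.
apply: cvgD; apply: cvgMl; first by apply: cvgB => //; exact: cvg_cst.
by apply: cvgMl.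
Unshelve. all: by end_near.
Qed.

(* Both sides are compared along points [p_ k] different from [p0], where the
   field extending [phi] has simple values; when the measure is 0/lam-valued
   there are no such points, but [phi] is constant almost everywhere. *)
Theorem Theta_formula d (T : measurableType d) (p0 : Pt T) phi : pt p0 [set: T] = lam%:E ->
  (forall j, tang p0 (phi j)) ->
  Theta p0 phi = \sum_(P | adm P) a P * mom (pt p0) P phi.
Proof.
move=> pT tp.
have Lphi j : Lr r (pt p0) (phi j) by have /tangE[] := tp j.
have mphi j := (Lphi j).1.
have [triv|ntriv] := pselect (forall A, measurable A -> fine (pt p0 A) = 0 \/ fine (pt p0 A) = lam).
  have ae1 j := trivial_measure_cst pT (Lphi j) triv.
  pose c j : T -> R := fun=> \int[pt p0]_x phi j x / lam.
  have tc j : tang p0 (c j).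
    apply/tangE; split; first exact: (Lr_cst r0 (@ptfin d T)).
    by move=> c1; rewrite Rintegral_cst //; have /tangE[_ ->] := tp j; rewrite ?mul0r.
  have [wd _ _] := @tf d T; rewrite (wd _ _ c) //.
  rewrite Theta_simple //; last first.
    by move=> j; split; [exact: measurable_cst|exact: fvals_cst].
  apply: eq_bigr => P _; congr (_ * _); symmetry; apply: mom_ae => // j.
  exact: measurable_cst.
have [A mA [A0 Alam]] : exists2 A, measurable A & 0 < fine (pt p0 A) /\ fine (pt p0 A) < lam.
  move/existsNP: ntriv => [A /not_implyP[mA /not_orP[n0 nl]]]; exists A => //.
  have /andP[a1 a2] := fine_le_measure (ptfin p0) mA.
  split; first by rewrite lt_neqAle a1 andbT eq_sym; exact/eqP.
  by rewrite lt_neqAle; apply/andP; split; [exact/eqP|rewrite pT in a2].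
have [p_ [w_ [C [pp pTk tvdk dens [wC wcv]]]]] := perturbation pT mA A0 Alam.
pose X j p := ctrp p (roundf r (@pt d T) p0 (phi j) p).
have tX j p : tang p (X j p) := tang_roundf r0 r1 (@ptfin d T) (@pt1 d T) (@tangE d T) (Lphi j) p.
have cX j q0 q_ : Lcvg (@pt d T) q_ q0 -> field_cvg r (@pt d T) (X j) q_ q0.
  exact: (roundf_cvg r0 r1 (@ptfin d T) (@pt1 d T) (Lphi j)).
have X0 : (fun j => X j p0) = phi.
  apply/funext => j.
  by rewrite /X /roundf (tvd_self (@ptfin d T)) eqxx (ctr_tang (@tangE d T) (tp j)).
have lim0 : Theta (p_ k) (fun j => X j (p_ k)) @[k --> \oo] --> Theta p0 (fun j => X j p0).
  exact: (tensor_seq r0 r1 (@ptfin d T) (@tf d T) tX cX pp).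
have {X0 lim0} lim0 : Theta (p_ k) (fun j => X j (p_ k)) @[k --> \oo] --> Theta p0 phi.
  exact: (eq_ind _ (fun f => Theta (p_ k) (fun j => X j (p_ k)) @[k --> \oo] --> Theta p0 f) lim0 _ X0).
pose t_ k := lev r (@pt d T) p0 (p_ k).
have t_0 k : 0 <= t_ k by exact: powR_ge0.
have rE k j : roundf r (@pt d T) p0 (phi j) (p_ k) = rint (phi j) (t_ k).
  by rewrite /roundf ifF //; apply/negbTE; rewrite gt_eqF //; exact: tvdk.
have tcv : t_ k @[k --> \oo] --> +oo.
  apply: cvg_powRN_pinfty => //; first by rewrite divr_gt0.
  apply/cvgrPdist_le => e E0; have := pp e E0; apply: filterS => k L1.
  rewrite sub0r normrN ger0_norm ?(ltW (tvdk k)) //; exact: L1close_tv L1.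
have sX k j : simple (X j (p_ k)).
  rewrite /X rE; have [m1 v1] := simple_rint (mphi j) (t_ k).
  split; first exact: measurable_funB.
  exact: (fvals_op (fun a b => a - b) v1 (fvals_cst _ _)).
have ThE k : Theta (p_ k) (fun j => X j (p_ k)) =
    \sum_(P | adm P) a P * mom (pt (p_ k)) P (fun j => X j (p_ k)).
  by apply: Theta_simple => // j; exact: tX.
have lim1 : (\sum_(P | adm P) a P * mom (pt (p_ k)) P (fun j => X j (p_ k))) @[k --> \oo] -->
  Theta p0 phi by under eq_fun do rewrite -ThE.
pose mk_ k j := meanp (p_ k) (rint (phi j) (t_ k)).
have intE k (psi : T -> R) : (pt (p_ k)).-integrable [set: T] (EFin \o psi) ->
    \int[pt (p_ k)]_x psi x = \int[pt p0]_x (psi x * w_ k x).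
  by move=> ii; exact: Rintegral_density (dens k) ii.
have mrint k j := (simple_rint (mphi j) (t_ k)).1.
have mw k : measurable_fun [set: T] (w_ k) by have [] := dens k.
have C0 : 0 <= C := le_trans (normr_ge0 _) (wC 0%N point).
have irint k j : (pt (p_ k)).-integrable [set: T] (EFin \o rint (phi j) (t_ k)).
  apply: (bounded_integrable (ptfin _) (mrint k j)) => x; exact: rint_bound.
(* In the case of [P^r] the subtracted means tend to the mean of [phi j], which is 0. *)
have mkcv j : mk_ k j @[k --> \oo] --> 0.
  rewrite /mk_ /mean; case: (boolP cen) => c1; last exact: cvg_cst.
  have B1 : #|[set j]%SET|%:R <= r^-1 by rewrite cards1 rV_ge1.
  have := @prod_cvg _ T _ r n r0 (pt p0) [set j]%SET (fun k i => rint (phi i) (t_ k)) phi phi w_ C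
    (ptfin p0) B1 Lphi (fun k i => mrint k i) mphi mw wC wcv
    (fun k i x => rint_le _ x (t_0 k)) (fun i x => @rint_cvg _ _ _ (phi i) t_ x tcv).
  rewrite (_ : \int[pt p0]_x _ = 0); last first.
    under eq_Rintegral do rewrite finset.big_set1.
    by have /tangE[_ ->] := tp j.
  rewrite (_ : (fun k => _) = (fun k => \int[pt (p_ k)]_x rint (phi j) (t_ k) x)) //.
  apply/funext => k; rewrite intE //.
  by apply: eq_Rintegral => x _; rewrite finset.big_set1.
(* Bounds the subtracted means uniformly in [k], so that [H] below dominates the field at all the
   points [p_ k]. *)
pose M j : R := \int[pt p0]_x `|phi j x| * C.
have iphi j := Lr_integrable r0 r1 (ptfin p0) (Lphi j).
have mkM k j : `|mk_ k j| <= M j.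
  rewrite /mk_ /mean; have M0 : 0 <= M j by rewrite mulr_ge0 // Rintegral_ge0.
  case: ifP => c1; last by rewrite normr0.
  rewrite intE //.
  have irw : (pt p0).-integrable [set: T] (EFin \o (fun x => rint (phi j) (t_ k) x * w_ k x)).
    exact: (integrable_density (dens k)).
  apply: (le_trans (le_normr_Rintegral _ irw)) => //.
  rewrite /M -RintegralZr //; last exact: integrable_norm.
  apply: le_Rintegral => //; first exact: integrable_norm.
    have := integrableZr measurableT C (integrable_norm (iphi j)); apply: eq_integrable => // x _.
  by move=> x _; rewrite normrM; apply: ler_pM => //; exact: rint_le.
pose H j x : R := `|phi j x| + M j.
have LH j : Lr r (pt p0) (H j).
  have mn : measurable_fun [set: T] (fun x => `|phi j x|) by exact: measurableT_comp.
  have L1 : Lr r (pt p0) (fun x => `|phi j x|).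
    by apply: (Lr_dominated r0 mn _ (Lphi j)) => x; rewrite normr_id.
  have := LrB r0 L1 (Lr_cst r0 (@ptfin d T) p0 (- M j)).
  by under eq_fun do rewrite opprK.
have M0 j : 0 <= M j by rewrite mulr_ge0 // Rintegral_ge0.
have XE k j x : X j (p_ k) x = rint (phi j) (t_ k) x - mk_ k j by rewrite /X rE.
have XH k j x : `|X j (p_ k) x| <= `|H j x|.
  rewrite XE [leRHS]ger0_norm ?addr_ge0 // (le_trans (ler_normB _ _)) //.
  by apply: lerD; [exact: rint_le|exact: mkM].
have Xcv j x : X j (p_ k) x @[k --> \oo] --> phi j x.
  rewrite -[X in _ --> X]subr0; under eq_fun do rewrite XE.
  by apply: cvgB; [exact: rint_cvg|exact: mkcv].
have momcv P : adm P ->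
    mom (pt (p_ k)) P (fun j => X j (p_ k)) @[k --> \oo] --> mom (pt p0) P phi.
  move=> aP; rewrite /mom big_mkcond /=.
  under eq_fun do rewrite big_mkcond /=.
  apply: cvg_big => [|B _]; first exact: mul_continuous.
  case: ifPn => [BP|_]; last exact: cvg_cst.
  have := @prod_cvg _ T _ r n r0 (pt p0) B (fun k j => X j (p_ k)) phi H w_ C
    (ptfin p0) (adm_card aP BP) LH (fun k i => (sX k i).1) mphi mw wC wcv XH Xcv.
  under [X in X @ _ --> _ -> _]eq_fun => k.
    rewrite -intE; first over.
    apply: (integrable_prod r0 (ptfin _) (adm_card aP BP)) => j.
    by have /tangE[] := tX j (p_ k).
  by [].
have lim2 : (\sum_(P | adm P) a P * mom (pt (p_ k)) P (fun j => X j (p_ k))) @[k --> \oo] -->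
    \sum_(P | adm P) a P * mom (pt p0) P phi.
  rewrite big_mkcond /=; under eq_fun do rewrite big_mkcond /=.
  apply: cvg_big => [|P _]; first exact: add_continuous.
  case: ifPn => aP; last exact: cvg_cst.
  by apply: cvgMr; exact: momcv.
by rewrite -(cvg_lim (@Rhausdorff R) lim1) (cvg_lim (@Rhausdorff R) lim2).
Qed.

End Coefficients.

Lemma disc_tauP (I : finType) (x0 : I) (P : Pt (disc x0)) (p : I -> R)
    (f : 'I_n -> I -> R) Q :
  (forall x : I, pt P [set (x : disc x0)] = (p x)%:E) -> ispart Q ->
  tauP r (pt P) Q f = r^-1 ^+ n * smom p Q f.
Proof.
by move=> PE pQ; rewrite tauP_mom // (mom_disc _ _ PE).
Qed.

(** Atoms with the same label have equal weight, so the mean is a multiple of the sum of [ucoef],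
    which is 0 in the case of [P^r]. *)
Lemma tang_testfun (Q : Pt (tdisc)) (p : testspace n -> R) w P j :
  (forall x : testspace n, pt Q [set (x : tdisc)] = (p x)%:E) ->
  (forall B k, p (Some (B, k)) = w) -> ispart P -> tang Q (testfun P (ucoef R cen) j).
Proof.
move=> QE pw pP; apply/tangE; split; first exact: disc_Lr.
move=> c1; rewrite /Rintegral (disc_Rintegral (testfun P (ucoef R cen) j) setT (ptfin Q)) /=.
have := sum_testfun (ucoef R cen) pP (finset.set11 j) (w := fun=> w) pw.
under [X in _ * (_ * X)]eq_bigr do rewrite cards1 expr1.
rewrite sum_ucoef1 // !mulr0 => E0; rewrite -[RHS]E0.
rewrite (eq_bigl predT) => [|x]; last by rewrite in_setT.
by apply: eq_bigr => x _; rewrite QE finset.big_set1 mulrC.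
Qed.

Definition formula (c : {set {set 'I_n}} -> R) :=
  forall d (T : measurableType d) (p : Pt T) phi, pt p [set: T] = lam%:E ->
  (forall j, tang p (phi j)) ->
  Theta p phi = \sum_(P | adm P) c P * tauP r (pt p) P phi.

Lemma adm_ucoef (P : {set {set 'I_n}}) B : adm P -> B \in P ->
  \sum_k ucoef R cen k ^+ #|B| != 0.
Proof.
move=> aP BP; apply: sum_ucoef_neq0 => c1; move: aP; rewrite /adm c1.
by move=> /andP[_ /forall_inP /(_ _ BP) /andP[]].
Qed.

Lemma formula_testfun c (Q : Pt (tdisc)) P :
  (forall x : testspace n, pt Q [set (x : tdisc)] = (unif lam x)%:E) ->
  formula c -> ispart P ->
  Theta Q (testfun P (ucoef R cen)) =
  r^-1 ^+ n * \sum_(P' | adm P') c P' * smom (@unif R lam (testspace n)) P' (testfun P (ucoef R cen)).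
Proof.
move=> QE fc pP; rewrite fc.
- rewrite mulr_sumr; apply: eq_bigr => P' /adm_ispart pP'.
  by rewrite (disc_tauP _ QE) // mulrCA.
- exact: (disc_point_mass (isdist_unif lam0 (None : testspace n)) QE).
- by move=> j; apply: (tang_testfun _ QE (w := lam / #|{: testspace n}|%:R)).
Qed.

(** One point suffices: at the uniform distribution on [testspace] the test functions are tangent,
    and the admissible partitions give a triangular system for the coefficients. *)
Lemma formula_unique c c' : formula c -> formula c' -> forall P, adm P -> c' P = c P.
Proof.
move=> fc fc' P aP; apply/eqP; rewrite -subr_eq0; apply/eqP; move: P aP.
have [Q QE] := disc_point None (isdist_unif lam0 (None : testspace n)).
apply: (@smom_testfun_inj _ _ (adm) (ucoef R cen) (@unif R lam _) (lam / #|{: testspace n}|%:R)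
   (fun P => c' P - c P)) => //.
- by move=> P; exact: adm_ispart.
- by move=> P B; exact: adm_ucoef.
- by rewrite gt_eqF // (unif_gt0 lam0 None).
move=> P /adm_ispart pP.
have := formula_testfun QE fc pP; rewrite (formula_testfun QE fc' pP).
have rn : r^-1 ^+ n != 0 by rewrite expf_neq0 // gt_eqF // invr_gt0.
move=> /(mulfI rn)/eqP; rewrite -subr_eq0 -sumrB => /eqP E0; rewrite -[RHS]E0.
by apply: eq_bigr => P' _; rewrite mulrBl.
Qed.

Lemma formula_exists : exists c, formula c.
Proof.
have [a Ha] := Thetac_moments.
exists (fun P => a P * r ^+ n) => d T p phi pT tp.
rewrite (Theta_formula Ha pT tp).
apply: eq_bigr => P /adm_ispart pP; rewrite tauP_mom // -mulrA; congr (_ * _).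
by rewrite mulrA -exprMn mulfV ?expr1n ?mul1r // gt_eqF.
Qed.

End Family.

(** * Transport along a congruent kernel *)

Section CongruentTransport.
Context d d' (T : measurableType d) (T' : measurableType d') (R : realType).
Variables (K : R.-pker T ~> T') (kappa : T' -> T).
Hypothesis mk : measurable_fun [set: T'] kappa.
Hypothesis Kk : forall (w : T) (A : set T), measurable A -> K w (kappa @^-1` A) = \d_w A.
Variables (mu : {measure set T -> \bar R}) (mu' : {measure set T' -> \bar R}).
Hypothesis muT : (mu [set: T] < +oo)%E.
Hypothesis muE : forall A, measurable A -> mu' A = push_dens K mu (fun=> 1) A.

Let mpre A : measurable A -> measurable (kappa @^-1` A).
Proof. by move=> mA; rewrite -[X in measurable X]setTI; exact: mk. Qed.

Let K1 x B : measurable B -> (K x B <= 1)%E.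
Proof. by move=> mB; rewrite -(@prob_kernel _ _ _ _ _ K x); apply: le_measure; rewrite ?inE. Qed.

Let Kfin x B : measurable B -> K x B \is a fin_num.
Proof. by move=> mB; rewrite ge0_fin_numE // (le_lt_trans (K1 x mB)) // ltry. Qed.

(* K x is carried by the fibre of kappa over x. *)
Let KI x A B : measurable A -> measurable B ->
  K x (kappa @^-1` A `&` B) = ((\1_A x)%:E * K x B)%E.
Proof.
move=> mA mB; rewrite indicE.
have null C : measurable C -> x \notin C -> K x (kappa @^-1` C `&` B) = 0%E.
  move=> mC xC; apply/eqP; rewrite eq_le measure_ge0 andbT.
  have <- : K x (kappa @^-1` C) = 0%E by rewrite Kk // diracE (negbTE xC).
  by apply: le_measure; rewrite ?inE //; [apply: measurableI => //|]; exact: mpre.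
have [xA|xA] := boolP (x \in A); last by rewrite null // mul0e.
have -> : K x B = (K x (kappa @^-1` A `&` B) + K x (kappa @^-1` (~` A) `&` B))%E.
  rewrite -measureU; first by rewrite -setIUl -preimage_setU setUv preimage_setT setTI.
  - by apply: measurableI => //; exact: mpre.
  - by apply: measurableI => //; apply: mpre; exact: measurableC.
  - by rewrite setIACA -preimage_setI setICr preimage_set0 set0I.
by rewrite [X in (_ + X)%E]null ?adde0 ?mul1e //; [exact: measurableC|rewrite in_setC xA].
Qed.

Lemma congruent_restr A B : measurable A -> measurable B ->
  mu' (kappa @^-1` A `&` B) = (\int[mu]_(x in A) K x B)%E.
Proof.
move=> mA mB; rewrite muE; last by apply: measurableI => //; exact: mpre.
rewrite /push_dens [RHS]integral_mkcond; apply: eq_integral => x _.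
rewrite mule1 KI // patchE indicE; case: ifP => _; by rewrite ?mul1e ?mul0e.
Qed.

Lemma congruent_pre A : measurable A -> mu' (kappa @^-1` A) = mu A.
Proof.
move=> mA; rewrite -[X in mu' X]setIT congruent_restr //.
under eq_integral do rewrite prob_kernel.
by rewrite integral_cst // mul1e.
Qed.

Lemma congruent_mass : mu' [set: T'] = mu [set: T].
Proof. by rewrite -(preimage_setT kappa) congruent_pre. Qed.

Lemma congruent_ge0_integral (g : T -> \bar R) : (forall x, 0 <= g x)%E ->
  measurable_fun [set: T] g -> (\int[mu']_y g (kappa y) = \int[mu]_x g x)%E.
Proof.
move=> g0 mg; have := ge0_integral_pushforward mk mu' measurableT mg (fun x _ => g0 x).
rewrite preimage_setT => <-; apply: eq_measure_integral => A mA _.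
exact: congruent_pre.
Qed.

Lemma congruent_integrable (g : T -> R) : mu.-integrable [set: T] (EFin \o g) ->
  mu'.-integrable [set: T'] (EFin \o (fun y => g (kappa y))).
Proof.
move=> /integrableP[/measurable_EFinP mg ig]; apply/integrableP; split.
  by apply/measurable_EFinP; exact: measurableT_comp.
have := @congruent_ge0_integral (fun x => `|(EFin \o g) x|)%E; rewrite /= => -> //.
by apply/measurable_EFinP; exact: measurableT_comp.
Qed.

Lemma congruent_integral (g : T -> R) : mu.-integrable [set: T] (EFin \o g) ->
  (\int[mu']_y (g (kappa y))%:E = \int[mu]_x (g x)%:E)%E.
Proof.
move=> ig; have := integral_pushforward mk (measurable_int _ ig) (congruent_integrable ig) measurableT.
rewrite preimage_setT => <-; apply: eq_measure_integral => A mA _.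
exact: congruent_pre.
Qed.

(** The image under [kappa] of [mu'] restricted to [B] has density [K x B] with respect to [mu],
    because [K x] is carried by the fibre over [x]. Integrating [g] against this image in both ways
    gives the equality, which says that [g] composed with [kappa] is the density of the transported
    signed measure. *)
Lemma congruent_density (g : T -> R) : mu.-integrable [set: T] (EFin \o g) ->
  forall B, measurable B ->
  (\int[mu']_(y in B) (g (kappa y))%:E = push_dens K mu g B)%E.
Proof.
move=> ig B mB.
have mg : measurable_fun [set: T] g by apply/measurable_EFinP; exact: measurable_int ig.
have igk := congruent_integrable ig.
pose rB : {measure set T' -> \bar R} := mrestr mu' mB.
pose pushB : {measure set T -> \bar R} := pushforward rB kappa.
pose Nu := pushB mk.
have d1 : is_density mu' \1_B rB.
  split; first exact: measurable_indic.
  split => // A mA; rewrite integral_indic // /rB /= /mrestr.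
  by rewrite setIC.
have d2 : is_density mu (fun x => fine (K x B)) Nu.
  split; first by apply: measurableT_comp => //; exact: measurable_kernel.
  split => [x|A mA]; first exact: fine_ge0.
  rewrite /Nu /= /pushforward /rB /= /mrestr congruent_restr //.
  by apply: eq_integral => x _; rewrite fineK // Kfin.
have irB : rB.-integrable [set: T'] (EFin \o (fun y => g (kappa y))).
  apply/integrableP; split; first exact: measurable_int igk.
  have /integrableP[m1 i1] := igk; apply: le_lt_trans i1.
  rewrite (ge0_integral_density d1) //; last exact: measurableT_comp.
  apply: ge0_le_integral => //; try exact: measurableT_comp.
  - apply: emeasurable_funM; first exact: measurableT_comp.
    by apply/measurable_EFinP; exact: measurable_indic.
  - move=> y _; rewrite -EFinM lee_fin indicE; case: (_ \in _); rewrite ?mulr1 ?mulr0 //.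
have iNu : Nu.-integrable [set: T] (EFin \o g).
  by apply: (integrable_pushforward mk (measurable_int _ ig)).
have e1 := Rintegral_density d1 irB; have e2 := Rintegral_density d2 iNu.
have e3 : \int[Nu]_x g x = \int[rB]_y g (kappa y).
  congr fine; have := integral_pushforward mk (measurable_int _ ig) irB measurableT.
  by rewrite preimage_setT.
rewrite integral_mkcond (eq_integral (fun y => (g (kappa y) * \1_B y)%:E)); last first.
  by move=> y _; rewrite patchE indicE; case: ifP => _; rewrite ?mulr1 ?mulr0.
rewrite -[LHS]fineK; last exact: (integrable_fin_num measurableT (integrable_density d1 irB)).
rewrite /push_dens [RHS](eq_integral (fun x => (g x * fine (K x B))%:E)); last first.
  by move=> x _; rewrite EFinM fineK ?Kfin // muleC.
rewrite -[RHS]fineK; last exact: (integrable_fin_num measurableT (integrable_density d2 iNu)).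
by congr EFin; rewrite -[LHS]e1 -e3 e2.
Qed.

Lemma congruent_density_ae (g : T -> R) psi : mu.-integrable [set: T] (EFin \o g) ->
  is_signed_density mu' psi (push_dens K mu g) -> {ae mu', forall y, psi y = g (kappa y)}.
Proof.
move=> ig [mpsi [ipsi E]].
have := @integral_ae_eq _ _ _ mu' setT measurableT (EFin \o (fun y => g (kappa y))) (EFin \o psi) ipsi.
move=> /(_ (measurable_int _ (congruent_integrable ig))) H.
have {H} : ae_eq mu' [set: T'] (EFin \o psi) (EFin \o (fun y => g (kappa y))).
  by apply: H => B _ mB; rewrite congruent_density // E.
by apply: filterS => y /(_ Logic.I) [].
Qed.

Variable r : R.
Hypotheses (r0 : 0 < r) (r1 : r <= 1).

Lemma congruent_Lr (g : T -> R) psi : Lr r mu g ->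
  is_signed_density mu' psi (push_dens K mu g) -> Lr r mu' psi.
Proof.
move=> Lg dpsi; have ae := congruent_density_ae (Lr_integrable r0 r1 muT Lg) dpsi.
have [mg gL] := Lg; have [mpsi _] := dpsi; split => //.
rewrite (@ae_eq_integral _ _ _ mu' setT (fun y => (`|g (kappa y)| `^ r^-1)%:E)) //.
- rewrite (@congruent_ge0_integral (fun x => (`|g x| `^ r^-1)%:E)) //.
  by apply/measurable_EFinP; exact: measurable_norm_powR.
- by apply/measurable_EFinP; exact: measurable_norm_powR.
- apply/measurable_EFinP; apply: (@measurable_norm_powR _ _ _ (fun y => g (kappa y))).
  exact: measurableT_comp.
- by apply: filterS ae => y -> _.
Qed.

Lemma congruent_integral_signed (g : T -> R) psi : Lr r mu g ->
  is_signed_density mu' psi (push_dens K mu g) ->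
  (\int[mu']_y (psi y)%:E = \int[mu]_x (g x)%:E)%E.
Proof.
move=> Lg [_ [_ E]]; rewrite E // -congruent_density ?congruent_integral //.
all: exact: Lr_integrable Lg.
Qed.

Lemma congruent_tauP n (P : {set {set 'I_n}}) (g : 'I_n -> T -> R) psi :
  (forall B, B \in P -> #|B|%:R <= r^-1) -> (forall j, Lr r mu (g j)) ->
  (forall j, is_signed_density mu' (psi j) (push_dens K mu (g j))) ->
  tauP r mu' P psi = tauP r mu P g.
Proof.
move=> cP Lg dpsi; apply: eq_bigr => B BP; congr (_ * fine _).
rewrite -(@congruent_integral (fun x => \prod_(j in B) g j x)); last first.
  exact: (integrable_prod r0 muT (cP _ BP) Lg).
have ae : {ae mu', forall y, forall j, psi j y = g j (kappa y)}.
  apply: filter_forall => j.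
  exact: congruent_density_ae (Lr_integrable r0 r1 muT (Lg j)) (dpsi j).
apply: ae_eq_integral => //.
- by apply/measurable_EFinP; apply: measurable_set_prod => j; exact: (dpsi j).1.
- apply/measurable_EFinP; apply: (@measurable_set_prod _ _ _ _ _ (fun j y => g j (kappa y))) => j.
  by apply: measurableT_comp => //; exact: (Lg j).1.
- by apply: filterS ae => y h _; congr EFin; apply: eq_bigr => j _; rewrite h.
Qed.

End CongruentTransport.

(** * The two cases *)

Section MeasureCase.
Variables (R : realType) (r : R) (n : nat).
Hypotheses (r0 : 0 < r) (r1 : r <= 1).
Variable Theta : MFamily R n.
Hypothesis tf : is_M_tensor_family r Theta.

Let Pt d (T : measurableType d) : Type := {finite_measure set T -> \bar R}.
Let pt d (T : measurableType d) := @fmeas R d T.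
Let tang d (T : measurableType d) := @tangM R r d T.

Let ptfin d (T : measurableType d) (p : Pt T) : (pt p [set: T] < +oo)%E.
Proof. by rewrite -ge0_fin_numE //; exact: fin_num_measure. Qed.

Let pt1 d (T : measurableType d) : false -> forall p : Pt T, fine (pt p [set: T]) = 1.
Proof. by []. Qed.

Let tangE d (T : measurableType d) (p : Pt T) phi :
  tang p phi <-> Lr r (pt p) phi /\ (false -> \int[pt p]_x phi x = 0).
Proof. by split => [|[]]. Qed.

Let mkPt lam d (T : measurableType d) (m : {measure set T -> \bar R}) :
  m [set: T] = lam%:E -> exists p : Pt T, forall A, measurable A -> pt p A = m A.
Proof.
move=> mT; have mfin : (m [set: T] < +oo)%E by rewrite mT ltry.
by have [m' mE] := finite_measure_of mfin; exists m' => A _; exact: mE.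
Qed.

Lemma formulaM_formula a : formulaM r Theta a <->
  forall t, 0 < t -> formula r t false pt tang Theta (fun P => a P t).
Proof.
split=> [fa t t0 d T p phi pT tp|fa d T mu mu0 phi tp].
  have -> : t = fine (fmeas p [set: T]) by rewrite [fmeas p _]pT.
  by apply: fa => //; rewrite [X in (_ < X)%E]pT lte_fin.
have muf : fmeas mu [set: T] \is a fin_num by exact: fin_num_measure.
apply: (fa (fine (mu [set: T]))) => //.
  by apply: fine_gt0; rewrite mu0 -ge0_fin_numE.
by rewrite [RHS]fineK.
Qed.

Section Mass.
Variable a : {set {set 'I_n}} -> R -> R.
Hypothesis fa : formulaM r Theta a.

(** On fixed test functions, the tensor at the uniform distribution of mass [t] on [testspace] is
    continuous in [t]; [smom_testfun_cvg] passes this on to the coefficients. *)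
Lemma coef_cvg (t_ : nat -> R) (t : R) P : (forall k, 0 < t_ k) -> 0 < t ->
  t_ k @[k --> \oo] --> t -> admissibleM r P -> a P (t_ k) @[k --> \oo] --> a P t.
Proof.
move=> t_0 t0 tcv.
have fa' := (formulaM_formula a).1 fa.
pose N : R := #|{: testspace n}|%:R.
have N0 : 0 < N := card_pos R (None : testspace n).
pose x0 : testspace n := None.
have [Q QE] := disc_point (@mkPt t) x0 (isdist_unif t0 x0).
have [Q_ Q_E] := choice (fun k => disc_point (@mkPt (t_ k)) x0 (isdist_unif (t_0 k) x0)).
have QQ : Lcvg (@pt _ (disc x0)) Q_ Q.
  apply: (disc_Lcvg ptfin _ _ Q_E QE).
  - by move=> k x; rewrite divr_ge0 ?ltW.
  - by move=> x; rewrite divr_ge0 ?ltW.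
  - by move=> x; apply: cvgMl.
move: P; apply: (@smom_testfun_cvg R n (adm r false) (ucoef R false)
  (fun k => @unif R (t_ k) _) (@unif R t _) (fun k => t_ k / N) (t / N)
  (fun k P => a P (t_ k)) (fun P => a P t)) => //.
- by move=> P; exact: adm_ispart.
- by move=> P B; exact: adm_ucoef.
- by rewrite gt_eqF // divr_gt0.
- by move=> k; rewrite gt_eqF // divr_gt0.
- by apply: cvgMl.
move=> P /adm_ispart pP.
have rn : r^-1 ^+ n != 0 by rewrite expf_neq0 // gt_eqF // invr_gt0.
have E s S : 0 < s -> (forall x : testspace n, pt S [set (x : disc x0)] = (unif s x)%:E) ->
    \sum_(Q | adm r false Q) a Q s * smom (@unif R s _) Q (testfun P (ucoef R false)) =
    (r^-1 ^+ n)^-1 * Thetac (@pt _ (disc x0)) false (@Theta _ (disc x0)) S (testfun P (ucoef R false)).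
  move=> s0 SE; rewrite (Thetac_tang (@tangE _ _)); last first.
    by move=> j; apply: (tang_testfun r0 ptfin tangE _ SE (w := s / N)).
  rewrite (formula_testfun r0 s0 ptfin tangE SE (fa' s s0) pP).
  by rewrite mulKf.
rewrite (E _ _ t0 QE); under eq_fun do rewrite (E _ _ (t_0 _) (Q_E _)).
apply: cvgMr.
apply: (Thetac_cvg r0 r1 (@ptfin _ _) (@pt1 _ _) (@tangE _ _) (@tf _ _)
  (M := \sum_j \sum_i `|testfun P (ucoef R false) j i|)) => //.
move=> j x; apply: (le_trans (disc_bounded (testfun P (ucoef R false) j) x)).
by rewrite [leRHS](bigD1 j) //= lerDl sumr_ge0 // => i _; apply: sumr_ge0.
Qed.

Lemma coef_continuous P : admissibleM r P -> {within `]0, +oo[, continuous (a P)}.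
Proof.
move=> aP; rewrite continuous_open_subspace; last exact: interval_open.
move=> t; rewrite inE /= in_itv /= andbT => t0.
apply/(@cvg_nbhsP _ R^o) => w wt.
(* A sequence tending to [t > 0] may begin with nonpositive terms; putting [t] in their place does
   not affect the limit. *)
pose v k := if 0 < w k then w k else t.
have vw : \forall k \near \oo, v k = w k.
  move/cvgrPdist_lt: wt => /(_ t t0); apply: filterS => k.
  by rewrite /v => h; rewrite ifT //; move: h; rewrite ltr_distlC addrC => /andP[]; lra.
have vt : v k @[k --> \oo] --> t.
  apply: cvg_trans wt; apply: near_eq_cvg.
  by apply: filterS vw => k ->.
have v0 k : 0 < v k by rewrite /v; case: ifP.
have := coef_cvg v0 t0 vt aP; apply: cvg_trans; apply: near_eq_cvg.
by apply: filterS vw => k /= ->.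
Qed.

(** The formula concerns positive mass only, while congruence also has to hold at the zero measure.
    There every tangent vector is 0 almost everywhere. *)
Lemma Theta_null_pos d (T : measurableType d) (mu : {finite_measure set T -> \bar R}) phi :
  (0 < n)%N -> (forall j, tangM r mu (phi j)) -> fmeas mu [set: T] = 0%E -> Theta mu phi = 0.
Proof.
move=> n0 tp mu0; have [wd _ _] := @tf d T.
pose z (j : 'I_n) (x : T) : R := 0.
have tz j : tangM r mu (z j) by exact: (Lr_cst r0 (@ptfin d T)).
have ae j : {ae pt mu, forall x, phi j x = z j x} by exists [set: T]; split.
rewrite (wd mu phi z tp tz ae).
exact: (@Theta_slot0 R r n Pt pt tang Theta tf d T mu z (Ordinal n0) tz erefl).
Qed.

(** For [n = 0] the tensor field is a continuous function of the point. Its value at the zero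
    measure is a limit along small multiples of a Dirac measure, and by the formula this limit
    involves the coefficients but not the space. *)
Lemma Theta_null_cvg d (T : measurableType d) (mu : {finite_measure set T -> \bar R}) phi :
  n = 0%N -> fmeas mu [set: T] = 0%E ->
  \sum_(P | admissibleM r P) a P (k.+1%:R^-1) @[k --> \oo] --> Theta mu phi.
Proof.
move=> n0 mu0; have no (j : 'I_n) : False by case: j => m; rewrite n0.
pose e_ (k : nat) : R := k.+1%:R^-1.
have e0 k : 0 < e_ k by rewrite invr_gt0.
pose nu k : {measure set T -> \bar R} := mscale (NngNum (ltW (e0 k))) (\d_(point : T)).
have nuT k : nu k [set: T] = (e_ k)%:E.
  by rewrite /nu /= /mscale /= diracT mule1.
have [p_ pE] := choice (fun k => mkPt (nuT k)).
have pp : Lcvg (@pt d T) p_ mu.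
  move=> e E0; near=> k.
  exists (\d_(point : T)), (fun=> 0), (fun=> e_ k); split.
  - split => //; split => // A mA; rewrite integral0.
    apply/eqP; rewrite eq_le measure_ge0 andbT -mu0.
    by apply: le_measure; rewrite ?inE.
  - by split => //; split => [x|A mA]; [exact: ltW|rewrite pE // integral_cst].
  - rewrite integral_cst // [X in (_ * X)%E](diracT R (point : T)) mule1 lee_fin sub0r normrN gtr0_norm //.
    near: k; have /cvgrPdist_le /(_ e E0) := @cvg_harmonic R; apply: filterS => k.
    by rewrite sub0r normrN gtr0_norm.
have X j : False := no j.
have := tensor_seq r0 r1 (@ptfin d T) (@tf d T) (X := fun j => False_rect _ (no j))
   (fun j => False_ind _ (no j)) (fun j => False_ind _ (no j)) pp.
have phiE (f g : 'I_n -> T -> R) : f = g by apply/funext => j; case: (no j).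
rewrite (phiE (fun j => _) phi).
apply: cvg_trans; apply: near_eq_cvg; near=> k.
have pT : fmeas (p_ k) [set: T] = (e_ k)%:E by rewrite [LHS]pE // nuT.
rewrite fa; [|by rewrite [X in (_ < X)%E]pT lte_fin|by move=> j; case: (no j)].
rewrite (_ : fine _ = e_ k); last by rewrite [X in fine X]pT.
apply: eq_bigr => P /andP[pP _].
(* With no slots, the empty partition is the only one, and its tensor is the empty product. *)
have -> : P = finset.set0.
  apply/eqP; rewrite -cards_eq0 -leqn0 -n0; exact: ispart_card_le.
by rewrite /tauP finset.big_set0 mulr1.
Unshelve. all: by end_near.
Qed.

Lemma formulaM_congruent d d' (T : measurableType d) (T' : measurableType d')
    (K : R.-pker T ~> T') : congruent K -> pullback_eqM r K (@Theta d' T') (@Theta d T).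
Proof.
move=> [kappa [mk Kk]] mu mu' muE phi psi tp dpsi.
have tpsi j : tangM r mu' (psi j).
  exact: (congruent_Lr mk Kk (ptfin mu) muE r0 r1 (tp j) (dpsi j)).
have mass := congruent_mass mk Kk muE.
have [mu0|mu0] := eqVneq (fmeas mu [set: T]) 0%E.
  have mu'0 : fmeas mu' [set: T'] = 0%E by rewrite [LHS]mass.
  have [n0|n0] := posnP n; last by rewrite !Theta_null_pos.
  have l1 := Theta_null_cvg (phi := phi) n0 mu0; have l2 := Theta_null_cvg (phi := psi) n0 mu'0.
  by rewrite -(cvg_lim (@Rhausdorff R) l1) -(cvg_lim (@Rhausdorff R) l2).
rewrite !fa //.
- rewrite [X in fine X]mass; apply: eq_bigr => P aP; congr (_ * _).
  apply: (congruent_tauP mk Kk (ptfin mu) muE r0 r1) => // B BP.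
  exact: (@adm_card _ _ _ false P).
- by rewrite lt_neqAle eq_sym mu0 measure_ge0.
- by rewrite [X in (_ < X)%E]mass lt_neqAle eq_sym mu0 measure_ge0.
Qed.

End Mass.

Lemma formulaM_unique a b : formulaM r Theta a -> formulaM r Theta b ->
  forall P, admissibleM r P -> forall t, 0 < t -> b P t = a P t.
Proof.
move=> /formulaM_formula fa /formulaM_formula fb P aP t t0.
exact: (formula_unique r0 t0 ptfin tangE (@mkPt t) (fa t t0) (fb t t0)).
Qed.

Hypothesis C2 : forall dI (I : measurableType dI), finite_discrete I ->
  forall d (T : measurableType d) (K : R.-pker I ~> T),
  congruent K -> pullback_eqM r K (@Theta d T) (@Theta dI I).

(** The coefficients are obtained at each mass separately and then chosen as functions of the mass;
    their continuity is a consequence of the formula. *)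
Lemma formulaM_exists : exists a, formulaM r Theta a.
Proof.
have H t : 0 < t -> exists c, formula r t false pt tang Theta c.
  move=> t0; apply: (formula_exists r0 r1 t0 ptfin pt1 tangE tf (@mkPt t)).
  move=> I x0 d T K cK p p' pp phi psi tphi dpsi.
  exact: (C2 (disc_finite_discrete x0) cK pp tphi dpsi).
have H' t : exists c, 0 < t -> formula r t false pt tang Theta c.
  by have [/H[c fc]|_] := boolP (0 < t); [exists c|exists (fun=> 0)].
have [c fc] := choice H'.
by exists (fun P t => c t P); apply/formulaM_formula => t t0; exact: fc.
Qed.

End MeasureCase.

(** Serves as [finite_copy] does, for the structure of probability measure. *)
Definition probability_copy d (T : measurableType d) (R : realType)
  (m : {measure set T -> \bar R}) (mT : m [set: T] = 1%E) : set T -> \bar R := m.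

Section ProbabilityCopy.
Context d (T : measurableType d) (R : realType).
Variables (m : {measure set T -> \bar R}) (mT : m [set: T] = 1%E).
HB.instance Definition _ := Measure.on (probability_copy mT).
HB.instance Definition _ := @Measure_isProbability.Build _ T _ (probability_copy mT) mT.

Lemma probability_of : exists m' : probability T R, forall A, m' A = m A.
Proof. by exists (probability_copy mT). Qed.
End ProbabilityCopy.

Section ProbabilityCase.
Variables (R : realType) (r : R) (n : nat).
Hypotheses (r0 : 0 < r) (r1 : r <= 1).
Variable Theta : PFamily R n.
Hypothesis tf : is_P_tensor_family r Theta.

Let Pt d (T : measurableType d) : Type := probability T R.
Let pt d (T : measurableType d) := @pmeas R d T.
Let tang d (T : measurableType d) := @tangP R r d T.

Let ptT d (T : measurableType d) (p : Pt T) : pt p [set: T] = 1%E.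
Proof. exact: probability_setT. Qed.

Let ptfin d (T : measurableType d) (p : Pt T) : (pt p [set: T] < +oo)%E.
Proof. by rewrite ptT ltry. Qed.

Let pt1 d (T : measurableType d) : true -> forall p : Pt T, fine (pt p [set: T]) = 1.
Proof. by move=> _ p; rewrite ptT. Qed.

Let tangE d (T : measurableType d) (p : Pt T) phi :
  tang p phi <-> Lr r (pt p) phi /\ (true -> \int[pt p]_x phi x = 0).
Proof.
split=> -[Lphi I0]; split => //; first by move=> _; rewrite /Rintegral [X in fine X]I0.
have fn := integrable_fin_num measurableT (Lr_integrable r0 r1 (ptfin p) Lphi).
by rewrite -[LHS](fineK fn) -[fine _]/(Rintegral _ _ _) I0.
Qed.

Let mkPt d (T : measurableType d) (m : {measure set T -> \bar R}) :
  m [set: T] = 1%:E -> exists p : Pt T, forall A, measurable A -> pt p A = m A.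
Proof. by move=> mT; have [m' mE] := probability_of mT; exists m' => A _; exact: mE. Qed.

Lemma formulaP_formula c : formulaP r Theta c <-> formula r 1 true pt tang Theta c.
Proof.
split=> [fc d T p phi _ tp|fc d T p phi tp]; first exact: fc.
by apply: fc => //; exact: ptT.
Qed.

Lemma formulaP_unique c c' : formulaP r Theta c -> formulaP r Theta c' ->
  forall P, admissibleP r P -> c' P = c P.
Proof.
move=> /formulaP_formula fc /formulaP_formula fc' P aP.
exact: (formula_unique r0 ltr01 ptfin tangE mkPt fc fc').
Qed.

Lemma formulaP_congruent c : formulaP r Theta c ->
  forall d d' (T : measurableType d) (T' : measurableType d') (K : R.-pker T ~> T'),
  congruent K -> pullback_eqP r K (@Theta d' T') (@Theta d T).
Proof.
move=> fc d d' T T' K [kappa [mk Kk]] mu mu' muE phi psi tp dpsi.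
have Lphi j : Lr r mu (phi j) by have [] := tp j.
rewrite !fc //; last first.
  move=> j; split.
    exact: (congruent_Lr mk Kk (ptfin mu) muE r0 r1 (Lphi j) (dpsi j)).
  rewrite (congruent_integral_signed mk Kk (ptfin mu) muE r0 r1 (Lphi j) (dpsi j)).
  by have [] := tp j.
apply: eq_bigr => P aP; congr (_ * _).
apply: (congruent_tauP mk Kk (ptfin mu) muE r0 r1) => // B BP.
exact: (@adm_card _ _ _ true P).
Qed.

Lemma formulaP_exists :
  (forall dI (I : measurableType dI), finite_discrete I ->
    forall d (T : measurableType d) (K : R.-pker I ~> T),
    congruent K -> pullback_eqP r K (@Theta d T) (@Theta dI I)) ->
  exists c, formulaP r Theta c.
Proof.
move=> C2; have [|c fc] := formula_exists r0 r1 ltr01 ptfin pt1 tangE tf mkPt.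
  move=> I x0 d T K cK p p' pp phi psi tphi dpsi.
  exact: (C2 _ _ (disc_finite_discrete x0) _ _ _ cK p p' pp phi psi tphi dpsi).
by exists c; apply/formulaP_formula.
Qed.

End ProbabilityCase.

Theorem theorem5p1 (R : realType) (r : R) (n : nat) :
  0 < r -> r <= 1 ->
  (* the case of M^r *)
  (forall Theta : MFamily R n, is_M_tensor_family r Theta ->
    let C1 := forall d d' (T : measurableType d) (T' : measurableType d')
                (K : R.-pker T ~> T'), congruent K ->
                pullback_eqM r K (Theta d' T') (Theta d T) in
    let C2 := forall dI (I : measurableType dI), finite_discrete I ->
                forall d (T : measurableType d) (K : R.-pker I ~> T),
                congruent K -> pullback_eqM r K (Theta d T) (Theta dI I) in
    let C3 := exists a : {set {set 'I_n}} -> R -> R,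
                [/\ forall P, admissibleM r P ->
                      {within `]0, +oo[, continuous (a P)},
                    formulaM r Theta a &
                    forall b : {set {set 'I_n}} -> R -> R,
                      (forall P, admissibleM r P ->
                         {within `]0, +oo[, continuous (b P)}) ->
                      formulaM r Theta b ->
                      forall P, admissibleM r P -> forall t, 0 < t ->
                        b P t = a P t] in
    (C1 <-> C2) /\ (C2 <-> C3)) /\
  (* the case of P^r *)
  (forall Theta : PFamily R n, is_P_tensor_family r Theta ->
    let C1 := forall d d' (T : measurableType d) (T' : measurableType d')
                (K : R.-pker T ~> T'), congruent K ->
                pullback_eqP r K (Theta d' T') (Theta d T) in
    let C2 := forall dI (I : measurableType dI), finite_discrete I ->
                forall d (T : measurableType d) (K : R.-pker I ~> T),
                congruent K -> pullback_eqP r K (Theta d T) (Theta dI I) in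
    let C3 := exists c : {set {set 'I_n}} -> R,
                [/\ formulaP r Theta c &
                    forall c' : {set {set 'I_n}} -> R, formulaP r Theta c' ->
                      forall P, admissibleP r P -> c' P = c P] in
    (C1 <-> C2) /\ (C2 <-> C3)).
Proof.
move=> r0 r1; split=> Theta tf C1 C2 C3.
- have c12 : C1 -> C2 by move=> H dI I _ d T K; exact: H.
  have c23 : C2 -> C3.
    move=> H; have [a fa] := formulaM_exists r0 r1 tf H; exists a; split => //.
      by move=> P; exact: (coef_continuous r0 r1 tf fa).
    by move=> b _ fb; exact: (formulaM_unique r0 fa fb).
  have c31 : C3 -> C1.
    by move=> [a [_ fa _]] d d' T T' K; exact: (formulaM_congruent r0 r1 tf fa).
  by split; split; auto.
- have c12 : C1 -> C2 by move=> H dI I _ d T K; exact: H.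
  have c23 : C2 -> C3.
    move=> H; have [c fc] := formulaP_exists r0 r1 tf H; exists c; split => // c' fc'.
    exact: (formulaP_unique r0 r1 fc fc').
  have c31 : C3 -> C1.
    by move=> [c [fc _]] d d' T T' K; exact: (formulaP_congruent r0 r1 fc).
  by split; split; auto.
Qed.
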